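(* Let $G$ be a locally convex Lie group with a smooth exponential map whose Lie algebra $\mathfrak g$ is a complete locally convex Lie algebra. Let $\gamma:\mathbb R\to\mathrm{Aut}(G)$ be a one-parameter group defining a continuous action of $\mathbb R$ on $G$, and assume that $\alpha:\mathbb R\to\mathrm{Aut}(\mathfrak g_{\mathbb C})$, $\alpha_t:=\mathbf L(\gamma_t)_{\mathbb C}$, defines a continuous action of $\mathbb R$ on $\mathfrak g_{\mathbb C}$. Let $\pi^\#(g,t)=\pi(g)U_t$ be a continuous unitary representation of $G\rtimes_\gamma\mathbb R$ on $\mathcal H$ and let $\mathcal H^\infty$ be the space of smooth vectors with respect to $\pi$. (i) Assume that $\alpha$ is equicontinuous. Then, for any subsets $E,F\subseteq\mathbb R$, $$\mathrm d\pi(\mathfrak g_{\mathbb C}(E))\,\mathcal H^\infty(F)\subseteq\mathcal H^\infty(E+F).$$ (ii) Assume that $\alpha$ is polynomially bounded. Then, for any subsets $E,F\subseteq\mathbb R$, $$\mathrm d\pi(\mathfrak g_{\mathbb C}(E;\mathcal S))\,\mathcal H^\infty(F)\subseteq\mathcal H^\infty(E+F).$$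
   Context: Smoothness is in the sense of calculus in (Hausdorff, real) locally convex spaces: a map is $C^1$ if its directional derivatives exist and define a continuous map $\mathrm d f(x)(h)$ of $(x,h)$; $C^k$ and $C^\infty$ are defined iteratively. Lie groups may be infinite dimensional. The exponential map is written $e^x:=\exp_G(x)$, $x\in\mathfrak g$. $\mathrm{Aut}(G)$ is the group of smooth automorphisms of $G$; $\mathbf L(\gamma_t)$ is the induced automorphism of $\mathfrak g$ and $\mathbf L(\gamma_t)_{\mathbb C}$ its complex linear extension to the complexification $\mathfrak g_{\mathbb C}$. Continuous actions are meant jointly: $(t,g)\mapsto\gamma_t(g)$ and $(t,x)\mapsto\alpha_t(x)$ are continuous. $G\rtimes_\gamma\mathbb R$ has product $(g,t)(g',t')=(g\gamma_t(g'),t+t')$. Continuous unitary representations are strongly continuous homomorphisms into the unitary group of a complex Hilbert space. Here $\pi$ is a continuous unitary representation of $G$ and $(U_t)_{t\in\mathbb R}$ is a strongly continuous unitary one-parameter group with $U_t\pi(g)U_t^*=\pi(\gamma_t(g))$. A vector $v\in\mathcal H$ is smooth (for $\pi$) if $G\to\mathcal H$, $g\mapsto\pi(g)v$, is smooth; $\mathcal H^\infty$ is the space of smooth vectors. For $x\in\mathfrak g$, $v\in\mathcal H^\infty$, $\mathrm d\pi(x)v:=\frac{d}{dt}\big|_{t=0}\pi(e^{tx})v$; by complex linear extension this defines a representation $\mathrm d\pi:\mathfrak g_{\mathbb C}\to\mathrm{End}(\mathcal H^\infty)$. For subsets $A\subseteq\mathfrak g_{\mathbb C}$, $B\subseteq\mathcal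 H^\infty$, $\mathrm d\pi(A)B=\{\mathrm d\pi(x)v: x\in A,v\in B\}$. For a locally convex space $V$, a homomorphism $\alpha:\mathbb R\to\mathrm{GL}(V)$ is equicontinuous if for every continuous seminorm $p$ on $V$ there is a continuous seminorm $q$ on $V$ with $p(\alpha_tx)\le q(x)$ for all $t\in\mathbb R,x\in V$. It is polynomially bounded if for every continuous seminorm $p$ on $V$ there are $N\in\mathbb N_0$ and a continuous seminorm $q$ on $V$ with $p(\alpha_tx)\le(1+|t|^N)q(x)$ for all $t,x$. Spectra: let $V$ be a complete complex locally convex space and $\alpha:\mathbb R\to\mathrm{GL}(V)$ a strongly continuous representation (all maps $t\mapsto\alpha_t(v)$ continuous). Let $\hat f(s)=\int_{\mathbb R}f(t)e^{ist}\,dt$. If $\alpha$ is polynomially bounded, put $\alpha_f(v):=\int_{\mathbb R}f(t)\alpha_t(v)\,dt$ for $f\in\mathcal S(\mathbb R)$ (complex-valued Schwartz functions) and $$\mathrm{Spec}_\alpha(v;\mathcal S):=\{y\in\mathbb R:(\forall f\in\mathcal S(\mathbb R))\ \alpha_fv=0\Rightarrow\hat f(y)=0\},\qquad V(E;\mathcal S):=\{v\in V:\mathrm{Spec}_\alpha(v;\mathcal S)\subseteq\overline E\}$$ for $E\subseteq\mathbb R$. If $\alpha$ is equicontinuous, $\alpha_f$ exists for all $f\in L^1(\mathbb R)$, and $\mathrm{Spec}_\alpha(v)$, $V(E)$ are defined by the same formulas with $\mathcal S(\mathbb R)$ replaced by $L^1(\mathbb R)$. This yields $\mathfrak g_{\mathbb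 C}(E)$, $\mathfrak g_{\mathbb C}(E;\mathcal S)$ (for $V=\mathfrak g_{\mathbb C}$ with $\alpha$) and $\mathcal H(E)$ (for $V=\mathcal H$ with the equicontinuous representation $U$). Finally $\mathcal H^\infty(E):=\mathcal H^\infty\cap\mathcal H(E)$. *)

(* Defs.v *)
From HB Require Import structures.
From mathcomp Require Import all_boot all_order all_algebra.
From mathcomp Require Import sesquilinear.
From mathcomp Require Import all_real_closed.
From mathcomp Require Import all_classical all_reals all_analysis.
Set Implicit Arguments.
Unset Strict Implicit.
Unset Printing Implicit Defensive.
Import Order.TTheory GRing.Theory Num.Theory.
Import numFieldNormedType.Exports.
Local Open Scope classical_set_scope.
Local Open Scope ring_scope.
Local Open Scope complex_scope.

Section ComplexTopology.
Context (R : realType).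

Lemma Re_continuous : continuous (@complex.Re R : R[i]^o -> R^o).
Proof.
have ReB (u v : R[i]) : complex.Re u - complex.Re v = complex.Re (u - v).
  by case: u v => [a b] [c d].
move=> x; apply: (iffRL (@cvgrPdist_lt R R^o _ (nbhs x) _ _ _)) => r r0.
have r0' : 0 < r%:C by rewrite ltcR.
near=> y; rewrite -ltcR ReB; apply: le_lt_trans (normc_ge_Re _) _.
by near: y; apply: (@cvgr_dist_lt R[i] R[i]^o).
Unshelve. all: by end_near. Qed.

Lemma Im_continuous : continuous (@complex.Im R : R[i]^o -> R^o).
Proof.
have -> : (@complex.Im R : R[i]^o -> R^o) =
    @complex.Re R \o (fun z : R[i]^o => (- 'i) *: z).
  by apply/funext => -[a b] /=; rewrite /GRing.scale/=; simpc.
move=> x; apply: continuous_comp; last exact: Re_continuous.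
exact: scaler_continuous.
Qed.

Lemma real_complex_continuous : continuous (real_complex R : R^o -> R[i]^o).
Proof.
move=> x; apply: (iffRL (@cvgrPdist_lt R[i] R[i]^o _ (nbhs x) _ _ _)) => -[r s].
rewrite ltcE/= => /andP[/eqP -> r0].
near=> y; rewrite -rmorphB normc_def/= expr0n addr0 sqrtr_sqr ltcR.
by near: y; exact: (@cvgr_dist_lt R R^o).
Unshelve. all: by end_near. Qed.

End ComplexTopology.

(** The real locally convex space underlying a complex one. *)
Definition realified (R : realType) (V : tvsType R[i]) : Type := V.

Section Realified.
Context (R : realType) (V : tvsType R[i]).
Local Notation W := (realified V).

HB.instance Definition _ := Uniform.on W.
HB.instance Definition _ := GRing.Zmodule.on W.

Let rscale (a : R) (x : W) : W := a%:C *: (x : V).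

Let rscaleA a b x : rscale a (rscale b x) = rscale (a * b) x.
Proof. by rewrite /rscale scalerA rmorphM. Qed.

Let rscale1 : left_id 1 rscale.
Proof. by move=> x; rewrite /rscale rmorph1 scale1r. Qed.

Let rscaleDr : right_distributive rscale +%R.
Proof. by move=> a x y; exact: scalerDr. Qed.

Let rscaleDl x : {morph rscale^~ x : a b / a + b}.
Proof. by move=> a b; rewrite /rscale rmorphD scalerDl. Qed.

HB.instance Definition _ :=
  GRing.Zmodule_isLmodule.Build R W rscaleA rscale1 rscaleDr rscaleDl.

Lemma realified_scaleE (a : R) (x : W) : a *: x = a%:C *: (x : V).
Proof. by []. Qed.

Let radd_continuous : continuous (fun x : W * W => x.1 + x.2).
Proof. exact: (@add_continuous V). Qed.

Let rscale_continuous : continuous (fun z : R^o * W => z.1 *: z.2).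
Proof.
move=> z; apply: (@continuous_comp _ (R[i]^o * V)%type _
  (fun z : R^o * W => (z.1%:C : R[i]^o, z.2 : V)) (fun z => z.1 *: z.2)); last first.
  exact: scale_continuous.
have c1 : {for z, continuous (fun z : R^o * W => z.1%:C : R[i]^o)}.
  apply: (@continuous_comp _ R^o R[i]^o fst (real_complex R)).
    exact: cvg_fst.
  exact: real_complex_continuous.
have c2 : {for z, continuous (fun z : R^o * W => z.2 : V)} by exact: cvg_snd.
exact: cvg_pair c1 c2.
Qed.

HB.instance Definition _ :=
  PreTopologicalNmodule_isTopologicalNmodule.Build W radd_continuous.
HB.instance Definition _ :=
  TopologicalNmodule_isTopologicalLmodule.Build R W rscale_continuous.

Let rlocally_convex :
  exists2 B : set_system W, (forall b, b \in B -> convex_set b) & basis B.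
Proof.
have [B Bc Bb] := @locally_convex R[i] V.
exists B => // b bB; apply/convex_setW => x y xb yb k k0 k1.
have k01 : Itv.spec (@Itv.num_sem R[i])
    (Itv.Real `[Posz 0, Posz 1]%Z) (k%:num%:C).
  rewrite /= /Itv.num_sem /= in_itv /= !lecR (ltW k0) (ltW k1) andbT.
  by rewrite realE lecR (ltW k0).
have := Bc b bB x y (Itv.mk k01) xb yb.
by rewrite !inE /conv /= realified_scaleE /unstable.onem !realified_scaleE rmorphB.
Qed.

HB.instance Definition _ := Uniform_isTvs.Build R W rlocally_convex.

End Realified.

(** The complexification of [g], with [(x, y)] standing for [x + i y]. *)
Definition complexified (R : realType) (g : tvsType R) : Type := (g * g)%type.

Section Complexified.
Context (R : realType) (g : tvsType R).
Local Notation W := (complexified g).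

HB.instance Definition _ := Uniform.copy W (g * g)%type.
HB.instance Definition _ := GRing.Zmodule.copy W (g * g)%type.

Let cscale (a : R[i]) (z : W) : W :=
  (complex.Re a *: z.1 - complex.Im a *: z.2,
   complex.Re a *: z.2 + complex.Im a *: z.1).

Let cscaleA a b x : cscale a (cscale b x) = cscale (a * b) x.
Proof.
case: a b x => [a a'] [b b'] [x y]; rewrite /cscale /=; congr (_, _).
  rewrite scalerBl scalerBr !scalerDl scalerDr !scalerA !opprD.
  by rewrite -!addrA; congr (_ + _); rewrite [RHS]addrCA [X in _ + X = _]addrC.
rewrite scalerBl scalerBr !scalerDl scalerDr !scalerA.
by rewrite -!addrA; congr (_ + _); rewrite [RHS]addrC -addrA.
Qed.

Let cscale1 : left_id 1 cscale.
Proof. by case=> x y; rewrite /cscale /= !scale1r !scale0r subr0 addr0. Qed.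

Let cscaleDr : right_distributive cscale +%R.
Proof.
move=> [a b] [x y] [x' y']; rewrite /cscale/=; congr (_, _).
  by rewrite !scalerDr opprD addrACA.
by rewrite !scalerDr addrACA.
Qed.

Let cscaleDl x : {morph cscale^~ x : a b / a + b}.
Proof.
move=> [a b] [a' b']; case: x => x y; rewrite /cscale/=; congr (_, _).
  by rewrite !scalerDl opprD addrACA.
by rewrite !scalerDl addrACA.
Qed.

HB.instance Definition _ :=
  GRing.Zmodule_isLmodule.Build R[i] W cscaleA cscale1 cscaleDr cscaleDl.

Lemma complexified_scaleE (a : R[i]) (z : W) :
  a *: z = (complex.Re a *: z.1 - complex.Im a *: z.2,
            complex.Re a *: z.2 + complex.Im a *: z.1).
Proof. by []. Qed.

Let cadd_continuous : continuous (fun x : W * W => x.1 + x.2).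
Proof. exact: (@add_continuous (g * g)%type). Qed.

Let scale_cvg (h : R[i]^o * W -> R^o) (k : R[i]^o * W -> g) :
  continuous h -> continuous k -> continuous (fun z => h z *: k z).
Proof.
move=> hc kc z; apply: (@continuous_comp _ (R^o * g)%type _
  (fun z => (h z, k z)) (fun z => z.1 *: z.2)).
  exact: cvg_pair (hc z) (kc z).
exact: scale_continuous.
Qed.

Let cscale_continuous : continuous (fun z : R[i]^o * W => z.1 *: z.2).
Proof.
have c1 : continuous (fun z : R[i]^o * W => complex.Re z.1 : R^o).
  move=> z; apply: (@continuous_comp _ R[i]^o R^o fst); first exact: cvg_fst.
  exact: Re_continuous.
have c2 : continuous (fun z : R[i]^o * W => complex.Im z.1 : R^o).
  move=> z; apply: (@continuous_comp _ R[i]^o R^o fst); first exact: cvg_fst.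
  exact: Im_continuous.
have d1 : continuous (fun z : R[i]^o * W => z.2.1 : g).
  move=> z; apply: (@continuous_comp _ (g * g)%type g snd fst).
    exact: cvg_snd.
  exact: cvg_fst.
have d2 : continuous (fun z : R[i]^o * W => z.2.2 : g).
  move=> z; apply: (@continuous_comp _ (g * g)%type g snd snd).
    exact: cvg_snd.
  exact: cvg_snd.
have e1 : continuous (fun z : R[i]^o * W => complex.Re z.1 *: z.2.1 : g).
  exact: scale_cvg c1 d1.
have e2 : continuous (fun z : R[i]^o * W => complex.Im z.1 *: z.2.2 : g).
  exact: scale_cvg c2 d2.
have e3 : continuous (fun z : R[i]^o * W => complex.Re z.1 *: z.2.2 : g).
  exact: scale_cvg c1 d2.
have e4 : continuous (fun z : R[i]^o * W => complex.Im z.1 *: z.2.1 : g).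
  exact: scale_cvg c2 d1.
have f1 : continuous (fun z : R[i]^o * W =>
    complex.Re z.1 *: z.2.1 - complex.Im z.1 *: z.2.2 : g).
  move=> z; apply: (@continuous_comp _ (g * g)%type g
    (fun z : R[i]^o * W => (complex.Re z.1 *: z.2.1, complex.Im z.1 *: z.2.2))
    (fun x => x.1 - x.2)); first exact: cvg_pair (e1 z) (e2 z).
  exact: sub_continuous.
have f2 : continuous (fun z : R[i]^o * W =>
    complex.Re z.1 *: z.2.2 + complex.Im z.1 *: z.2.1 : g).
  move=> z; apply: (@continuous_comp _ (g * g)%type g
    (fun z : R[i]^o * W => (complex.Re z.1 *: z.2.2, complex.Im z.1 *: z.2.1))
    (fun x => x.1 + x.2)); first exact: cvg_pair (e3 z) (e4 z).
  exact: add_continuous.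
by move=> z; exact: cvg_pair (f1 z) (f2 z).
Qed.

HB.instance Definition _ :=
  PreTopologicalNmodule_isTopologicalNmodule.Build W cadd_continuous.
HB.instance Definition _ :=
  TopologicalNmodule_isTopologicalLmodule.Build R[i] W cscale_continuous.

Let clocally_convex :
  exists2 B : set_system W, (forall b, b \in B -> convex_set b) & basis B.
Proof.
have [B Bc Bb] := @locally_convex R (g * g)%type.
exists B => // b bB; apply/(@convex_setW R[i] W) => x y xb yb [[k k'] kP] /=.
rewrite !ltcE/= => /andP[/eqP k'0 k0] /andP[_ k1].
have k01 : Itv.spec (@Itv.num_sem R) (Itv.Real `[Posz 0, Posz 1]%Z) k.
  by rewrite /= /Itv.num_sem /= in_itv /= (ltW k0) (ltW k1) num_real.
have := Bc b bB x y (Itv.mk k01) xb yb.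
rewrite !inE /conv /= /unstable.onem !complexified_scaleE/= k'0.
rewrite oppr0 addr0 !scale0r !subr0 !addr0.
by case: x {xb} y {yb} => [? ?] [? ?].
Qed.

HB.instance Definition _ := Uniform_isTvs.Build R[i] W clocally_convex.

End Complexified.

Section Calculus.
Context (R : realType).
Implicit Types E F : tvsType R.

Definition is_dderiv E F (f : E -> F) (x h : E) (l : F) : Prop :=
  t^-1 *: (f (x + t *: h) - f x) @[t --> (0 : R)^'] --> l.

(** The directional derivative [d f(x)(h)], with value [0] when the limit does
    not exist; limits are unique only if [F] is Hausdorff. *)
Definition dderiv E F (f : E -> F) (x h : E) : F := xget 0 (is_dderiv f x h).

(** [f] is of class [C^n] on [U]; meant for open [U], and only the values of
    [f] near the points of [U] matter. *)
Fixpoint Cn (n : nat) E F (U : set E) (f : E -> F) : Prop :=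
  match n with
  | 0 => {in U, continuous f}
  | m.+1 => (forall x h, U x -> exists l, is_dderiv f x h l) /\
            Cn m (U `*` [set: E]) (fun p : E * E => dderiv f p.1 p.2)
  end.

Definition Cinfty E F (U : set E) (f : E -> F) : Prop := forall n, Cn n U f.

(** Completeness for the uniform structure of the additive group: the interface
    [tvsType] does not relate its entourages to the addition. *)
Definition complete_tvs E : Prop :=
  forall F : set_system E, ProperFilter F ->
    (forall U : set E, nbhs 0 U ->
       exists2 A, F A & forall x y, A x -> A y -> U (x - y)) ->
    exists l : E, F --> l.

End Calculus.

Record chart (R : realType) (M : topologicalType) (E : tvsType R) := Chart {
  chart_dom : set M ;
  chart_cod : set E ;
  chart_fun :> M -> E ;
  chart_inv : E -> M }.

Section Manifolds.
Context (R : realType).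

Definition is_chart (M : topologicalType) (E : tvsType R) (c : chart M E) :
    Prop :=
  [/\ open (chart_dom c) /\ open (chart_cod c),
      set_bij (chart_dom c) (chart_cod c) c,
      {in chart_dom c, cancel c (chart_inv c)},
      {in chart_dom c, continuous c} &
      {in chart_cod c, continuous (chart_inv c)}].

Definition smooth_map (M N : topologicalType) (E F : tvsType R)
    (A : set (chart M E)) (B : set (chart N F)) (f : M -> N) : Prop :=
  continuous f /\
  forall c d, A c -> B d ->
    Cinfty (chart_cod c `&` [set y | chart_dom d (f (chart_inv c y))])
      (fun y => d (f (chart_inv c y))).

Definition smooth_atlas (M : topologicalType) (E : tvsType R)
    (A : set (chart M E)) : Prop :=
  [/\ A `<=` @is_chart M E,
      forall x, exists2 c, A c & chart_dom c x &
      smooth_map A A id].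

Definition prod_chart (M N : topologicalType) (E F : tvsType R)
    (c : chart M E) (d : chart N F) : chart (M * N)%type (E * F)%type :=
  Chart (chart_dom c `*` chart_dom d) (chart_cod c `*` chart_cod d)
    (fun p => (c p.1, d p.2)) (fun q => (chart_inv c q.1, chart_inv d q.2)).

Definition prod_atlas (M N : topologicalType) (E F : tvsType R)
    (A : set (chart M E)) (B : set (chart N F)) :
    set (chart (M * N)%type (E * F)%type) :=
  [set prod_chart c d | c in A & d in B].

Definition tvs_atlas (E : tvsType R) : set (chart E E) :=
  [set Chart setT setT id id].

End Manifolds.

Arguments tvs_atlas {R} E.

(** Nothing relates the group law to the topology here; see [lie_group]. *)
#[short(type="preTopologicalGroupType")]
HB.structure Definition PreTopologicalGroup := {G of Topological G & Group G}.

Section LieGroups.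
Context (R : realType) (g : tvsType R) (G : preTopologicalGroupType).
Local Open Scope group_scope.
Implicit Types (A : set (chart G g)) (phi : chart G g).

Definition lie_group A : Prop :=
  [/\ hausdorff_space G, smooth_atlas A,
      smooth_map (prod_atlas A A) A (fun p : G * G => p.1 * p.2) &
      smooth_map A A (fun x : G => x^-1)].

(** The Lie algebra [T_1 G] is identified with the model space [g] by means of
    a chart [phi] around the unit: the velocity at [0] of a curve [c] through
    [c 0 = 1] is the derivative of [phi \o c]. *)

Definition exponential_map A phi (exp : g -> G) : Prop :=
  [/\ smooth_map (tvs_atlas g) A exp,
      forall x (s t : R), exp ((s + t)%R *: x)%R = exp (s *: x)%R * exp (t *: x)%R &
      forall x, is_dderiv (fun t : R^o => phi (exp (t *: x)%R)) 0%R 1%R x].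

Definition automorphic_flow A (gamma : R -> G -> G) : Prop :=
  [/\ forall t, smooth_map A A (gamma t),
      forall t x y, gamma t (x * y) = gamma t x * gamma t y,
      gamma 0%R = id,
      forall s t, gamma (s + t)%R = gamma s \o gamma t &
      continuous (fun p : R * G => gamma p.1 p.2)].

(** The tangent map at the unit of [f : G -> G] with [f 1 = 1]. *)
Definition lie_map phi (f : G -> G) (x : g) : g :=
  dderiv (fun y => phi (f (chart_inv phi y))) (phi 1) x.

Definition lie_mapC phi (f : G -> G) (z : complexified g) : complexified g :=
  (lie_map phi f z.1, lie_map phi f z.2).

Definition semidirect_mul (gamma : R -> G -> G) (p q : G * R) : G * R :=
  (p.1 * gamma p.2 q.1, (p.2 + q.2)%R).

End LieGroups.

Section ComplexIntegral.
Context (R : realType).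
Local Notation mu := (@lebesgue_measure R).
Implicit Type f : R -> R[i].

Definition integrableC f : Prop :=
  mu.-integrable setT (EFin \o (@complex.Re R \o f)) /\
  mu.-integrable setT (EFin \o (@complex.Im R \o f)).

Definition integralC f : R[i] :=
  (\int[mu]_t complex.Re (f t))%R +i* (\int[mu]_t complex.Im (f t))%R.

Definition fourier f (s : R) : R[i] :=
  integralC (fun t => f t * (cos (s * t) +i* sin (s * t))).

Definition real_schwartz (h : R -> R) : Prop :=
  (forall n x, derivable (derive1n n h) x 1) /\
  (forall k n, exists C, forall x, `|x| ^+ k * `|derive1n n h x| <= C).

Definition schwartz f : Prop :=
  real_schwartz (@complex.Re R \o f) /\ real_schwartz (@complex.Im R \o f).

End ComplexIntegral.

Section Spectra.
Context (R : realType) (V : tvsType R[i]).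
Implicit Type alpha : R -> V -> V.

(** [w] is the (weak) integral of [F] over the real line; [w] is unique when
    [V] is Hausdorff. *)
Definition is_integral (F : R -> V) (w : V) : Prop :=
  forall l : {linear V -> R[i]^o}, continuous l ->
    integrableC (l \o F) /\ integralC (l \o F) = l w.

(** [T] is the class of test functions ([L^1] or Schwartz), and
    [is_integral _ 0] says that [alpha_f v = 0]. *)
Definition Spec (T : set (R -> R[i])) alpha (v : V) : set R :=
  [set y | forall f, T f -> is_integral (fun t => f t *: alpha t v) 0 ->
             fourier f y = 0].

Definition spectral_subspace (T : set (R -> R[i])) alpha (E : set R) : set V :=
  [set v | Spec T alpha v `<=` closure E].

Definition continuous_seminorm (p : V -> R) : Prop :=
  [/\ forall x y, p (x + y) <= p x + p y,
      forall a x, (p (a *: x))%:C = `|a| * (p x)%:C &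
      continuous p].

Definition equicontinuous_rep alpha : Prop :=
  forall p, continuous_seminorm p ->
    exists2 q, continuous_seminorm q & forall t x, p (alpha t x) <= q x.

Definition polynomially_bounded alpha : Prop :=
  forall p, continuous_seminorm p ->
    exists (N : nat) (q : V -> R), continuous_seminorm q /\
      forall t x, p (alpha t x) <= (1 + `|t| ^+ N) * q x.

End Spectra.

Section Representations.
Context (R : realType) (H : completeNormedModType R[i]).

Definition hilbert_dot (dot : {dot H for Num.conj}) : Prop :=
  forall v, `|v| ^+ 2 = dot v v.

Definition unitary_op (dot : {dot H for Num.conj}) (T : H -> H) : Prop :=
  [/\ linear T, forall u v, dot (T u) (T v) = dot u v &
      forall v, exists u, T u = v].

(** The group law [mul] is explicit, so that semidirect products need no type of
    their own; [rho 1 = id] follows from the invertibility of [rho 1]. *)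
Definition continuous_unitary_rep (dot : {dot H for Num.conj})
    (X : topologicalType) (mul : X -> X -> X) (rho : X -> H -> H) : Prop :=
  [/\ forall x, unitary_op dot (rho x),
      forall x y, rho (mul x y) = rho x \o rho y &
      forall v, continuous (fun x => rho x v)].

Context (g : tvsType R) (G : preTopologicalGroupType).

Definition smooth_vectors (A : set (chart G g)) (pi : G -> H -> H) : set H :=
  [set v | smooth_map A (tvs_atlas (realified H))
             (fun x => pi x v : realified H)].

Definition dpi_real (exp : g -> G) (pi : G -> H -> H) (x : g) (v : H) : H :=
  dderiv (fun t : R^o => pi (exp (t *: x)) v : realified H) 0 1.

Definition dpi (exp : g -> G) (pi : G -> H -> H) (z : complexified g) (v : H) :
    H :=
  dpi_real exp pi z.1 v + 'i *: dpi_real exp pi z.2 v.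

End Representations.

(* Main.v *)
(** For v and w smooth and x in the complexified Lie algebra, covariance gives
    <U_t dpi(x) v, w> = Phi(t, t) with
      Phi(s, t) = - <U_t v, q(alpha_s x)>,
      q(z) = dpi(conj z) w,
    and Phi(., t) has its frequencies in Spec x while Phi(s, .) has them in
    Spec v. The theorem thus becomes a statement on scalar functions of two
    variables: if Phi has frequencies in E x F and y0 is not in the closure of
    E + F, then y0 is not a frequency of t |-> Phi(t, t).

    No Fourier inversion is needed. Functions with band [-b, b] are those with
    |h^(n)(t)| <= K b^n (1 + |t|)^(-m) for all n. The diagonal integral of Psi is
    recovered from the integrals of e^(i w (t - s)) kappa(t - s) Psi(s, t), for
    kappa a power of sinc, by Fejer summation over w; for
    Psi(s, t) = Phi(s, t) e^(-i y0 t) h(t) each of them vanishes: either w is far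
    from E and the s-integral is 0, or y0 - w is far from F and the t-integral is.
    Finally, continuous linear functionals are approximated on the invariant
    subspace of smooth vectors by inner products with smooth vectors w. *)

Require Import Defs.
From HB Require Import structures.
From mathcomp Require Import all_boot all_order all_algebra.
From mathcomp Require Import sesquilinear all_real_closed.
From mathcomp Require Import all_classical all_reals all_analysis.
From mathcomp Require Import measurable_realfun ring lra.
Set Implicit Arguments.
Unset Strict Implicit.
Unset Printing Implicit Defensive.
Import Order.TTheory GRing.Theory Num.Theory.
Import numFieldNormedType.Exports.
Local Open Scope classical_set_scope.
Local Open Scope ring_scope.
Local Open Scope complex_scope.

(** * Calculus in locally convex spaces *)

(** In U_t dpi(x) v = dpi(alpha_t x) U_t v both the operator and the vector move, and no bound on
    dpi is uniform in the vector. Against a fixed smooth w, z |-> |q(z)| is a single continuous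
    seminorm, so the hypothesis on alpha bounds Phi polynomially in s, while unitarity bounds it in
    t. The growth exponent N comes from this seminorm and depends on w; the final test function must
    not. A cut-off that is sent to 1 removes the dependence, since the diagonal itself is bounded.

    Spectra are defined by single functions f with f^(z) <> 0, that is, by convolution equations. To
    localise such an equation near z, its solution is averaged with a band-limited function: the
    equation forces successive derivatives of the average to grow by a factor 2 d, whereas a band d
    allows only d, so the average vanishes. The short frequency intervals found in this way are
    joined by compactness, and longer bands are then reached by the diagonal argument itself,
    applied to phi(s) e^(-i y t) h(t). *)

Section Cousin.
Context (R : realType).

(** Cousin's lemma, a form of compactness: the supremum of the endpoints reachable from [a0] is
    reachable and cannot lie before [b0]. It yields the mean value theorem below and, later, a
    common band width over a compact interval of frequencies. *)
Lemma cousin (P : R -> R -> Prop) (a0 b0 : R) : a0 < b0 ->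
  (forall a b c, a < b -> b < c -> P a b -> P b c -> P a c) ->
  (forall s, a0 <= s <= b0 -> exists2 d, 0 < d &
     forall a b, s - d < a -> a <= s -> s <= b -> b < s + d -> a < b -> P a b) ->
  P a0 b0.
Proof.
move=> ab Padd Ploc.
pose S := [set x | a0 <= x <= b0 /\ (x = a0 \/ P a0 x)].
have S0 : S a0 by split; [rewrite lexx ltW|left].
have supS : has_sup S.
  by split; [exists a0|exists b0 => x [/andP[]]].
have mb : a0 <= sup S <= b0.
  rewrite sup_upper_bound//= ge_sup//; first by exists a0.
  by move=> x [/andP[]].
have [d d0 Pd] := Ploc _ mb.
have [x Sx xm] := sup_adherent d0 supS.
have xle : x <= sup S by exact: sup_upper_bound.
move: Sx => [/andP[ax xb] xP].
(* If the supremum were below [b0], this point beyond it would be reachable too. *)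
pose b := Num.min b0 (sup S + d / 2).
have mleb : sup S <= b.
  by rewrite /b le_min; case/andP: mb => _ ->; rewrite lerDl; lra.
have bd : b < sup S + d by rewrite /b gt_min; apply/orP; right; lra.
have Sb : x < b -> S b.
  move=> xltb; split.
    by rewrite (le_trans ax (ltW xltb)) /b ge_min lexx.
  right; have Pxb : P x b by apply: Pd => //; lra.
  case: xP => [<-//|Pax].
  have [xa|xa] := eqVneq x a0; first by rewrite -xa.
  by apply: Padd Pax Pxb => //; rewrite lt_neqAle eq_sym xa.
have fin c : S c -> c = b0 -> P a0 b0.
  by move=> [_ [->|Pc]] cb; [move: ab; rewrite cb ltxx|rewrite -cb].
have [xltb|blex] := ltP x b.
  have /sup_upper_bound Sbm := Sb xltb.
  have bm : b <= sup S by apply: Sbm.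
  apply: (fin b); first exact: Sb.
  by move: bm; rewrite /b; case: (leP b0 (sup S + d / 2)) => // _; lra.
apply: (fin x); first by split; rewrite ?ax.
apply/eqP; rewrite eq_le xb/=; move: blex; rewrite /b.
by case: (leP b0 (sup S + d / 2)) => // _; lra.
Qed.

End Cousin.

Section Calculus.
Context (R : realType).
Implicit Types E F K : tvsType R.

Definition convexP E (C : set E) := forall x y, C x -> C y ->
  forall k : R, 0 <= k -> k <= 1 -> C (k *: x + (1 - k) *: y).

Lemma nbhs_convex E (x : E) (W : set E) : nbhs x W ->
  exists C : set E, [/\ open C, C x, convexP C & C `<=` W].
Proof.
move=> Wx; have [B Bc [Bo Bb]] := @locally_convex R E.
have [C [BC Cx] CW] := Bb x W Wx.
exists C; split => //; first exact: Bo.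
move=> y z Cy Cz k k0 k1.
have k01 : Itv.spec (@Itv.num_sem R) (Itv.Real `[Posz 0, Posz 1]%Z) k.
  by rewrite /= /Itv.num_sem /= in_itv /= k0 k1 num_real.
have := Bc C; rewrite inE => /(_ BC y z (Itv.mk k01)).
by rewrite !inE => /(_ Cy Cz).
Qed.

(** The slope over [[a, c]] is the average of the slopes over [[a, b]] and [[b, c]], weighted by
    length. Having its slope in a convex set is therefore an additive property of an interval, as
    [cousin] requires. *)
Lemma convex_slope E (C : set E) (a b c : R) (x y z : E) : convexP C ->
  a < b -> b < c -> C ((b - a)^-1 *: (y - x)) -> C ((c - b)^-1 *: (z - y)) ->
  C ((c - a)^-1 *: (z - x)).
Proof.
move=> cC ab bc Cab Cbc.
have ac0 : c - a != 0 by rewrite subr_eq0 gt_eqF// (lt_trans ab).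
have := cC _ _ Cab Cbc ((b - a) / (c - a)).
have -> : (b - a) / (c - a) *: ((b - a)^-1 *: (y - x)) +
    (1 - (b - a) / (c - a)) *: ((c - b)^-1 *: (z - y)) =
    (c - a)^-1 *: (z - x).
  have -> : 1 - (b - a) / (c - a) = (c - b) / (c - a).
    by apply: (mulIf ac0); rewrite mulrBl !divfK//; lra.
  rewrite !scalerA mulrAC mulfV ?subr_eq0 ?gt_eqF// mul1r.
  rewrite mulrAC mulfV ?subr_eq0 ?gt_eqF// mul1r -scalerDr.
  by congr (_ *: _); rewrite addrC addrA subrK.
apply; first by rewrite divr_ge0// subr_ge0 ltW// (lt_trans ab).
by rewrite ler_pdivrMr ?subr_gt0 ?(lt_trans ab)// mul1r; lra.
Qed.

(** The mean value theorem with an open convex set in place of a norm: slopes over short intervals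
    ending or starting at [s] lie in [C] because the derivative at [s] does, and [cousin] joins
    them. *)
Lemma convex_mean_value E (C : set E) (c c' : R -> E) : open C -> convexP C ->
  (forall s, 0 <= s <= 1 ->
     t^-1 *: (c (s + t) - c s) @[t --> (0 : R)^'] --> c' s /\ C (c' s)) ->
  C (c 1 - c 0).
Proof.
move=> oC cC dc.
suff : C ((1 - 0)^-1 *: (c 1 - c 0)) by rewrite subr0 invr1 scale1r.
apply: (@cousin R (fun a b => C ((b - a)^-1 *: (c b - c a)))) => //.
  by move=> a b d ab bd; exact: convex_slope.
move=> s s01; have [dcs Cs] := dc s s01.
have : nbhs (c' s) C by exact: open_nbhs_nbhs.
move=> /dcs; rewrite /= !near_simpl => /nbhs_ballP[d /= d0 Cd].
have q t : 0 < `|t| -> `|t| < d -> C (t^-1 *: (c (s + t) - c s)).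
  move=> t0 td; apply: (Cd t); last by rewrite -normr_gt0.
  by rewrite /ball/= sub0r normrN.
exists d => // a b sa as_ sb bs ab.
have qa : a < s -> C ((s - a)^-1 *: (c s - c a)).
  move=> als; have := q (a - s); rewrite (addrC s) subrK => qq.
  rewrite -(opprB a s) invrN scaleNr -scalerN opprB; apply: qq.
    by rewrite normr_gt0 subr_eq0 lt_eqF.
  by rewrite ltr0_norm ?subr_lt0// opprB; lra.
have qb : s < b -> C ((b - s)^-1 *: (c b - c s)).
  move=> slb; have := q (b - s); rewrite (addrC s) subrK; apply.
    by rewrite normr_gt0 subr_eq0 gt_eqF.
  by rewrite gtr0_norm ?subr_gt0//; lra.
move: as_; rewrite le_eqVlt => /predU1P[aE|as_]; first by rewrite aE in ab *; exact: qb.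
move: sb; rewrite le_eqVlt => /predU1P[<-|sb]; first exact: qa.
exact: convex_slope (qa as_) (qb sb).
Qed.

End Calculus.

Section TvsLimits.
Context (K : numFieldType) (E : tvsType K) (T : Type) (F : set_system T).
Context {FF : Filter F}.
Implicit Types f g : T -> E.

Lemma tvs_cvgD f g a b : f @ F --> a -> g @ F --> b ->
  f t + g t @[t --> F] --> a + b.
Proof.
move=> fa gb; exact: (cvg_comp (fun t => (f t, g t)) (fun y : E * E => y.1 + y.2)
  (cvg_pair fa gb) (@add_continuous E (a, b))).
Qed.

Lemma tvs_cvgZ (k : T -> K^o) f (c : K^o) a : k @ F --> c -> f @ F --> a ->
  k t *: f t @[t --> F] --> c *: a.
Proof.
move=> kc fa; exact: (cvg_comp (fun t => (k t, f t)) (fun y : K^o * E => y.1 *: y.2)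
  (cvg_pair kc fa) (@scale_continuous K E (c, a))).
Qed.

Lemma tvs_cvgB f g a b : f @ F --> a -> g @ F --> b ->
  f t - g t @[t --> F] --> a - b.
Proof.
move=> fa gb; exact: (cvg_comp (fun t => (f t, g t)) (fun y : E * E => y.1 - y.2)
  (cvg_pair fa gb) (@sub_continuous E (a, b))).
Qed.

End TvsLimits.

(** * Uniformity of difference quotients of maps of class C^1 *)

Section StrongDifferentiability.
Context (R : realType).
Implicit Types E F K : tvsType R.

Lemma hausdorff_prod (S T : topologicalType) : hausdorff_space S ->
  hausdorff_space T -> hausdorff_space (S * T)%type.
Proof.
move=> hS hT [p1 p2] [q1 q2] clpq; congr (_, _).
  apply: hS => A B pA qB.
  have [|//|[x y] [[/= Ax _] [/= Bx _]]] := clpq (A `*` setT) (B `*` setT).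
  - by exists (A, setT) => //=; split => //; exact: filterT.
  - by exists (B, setT) => //=; split => //; exact: filterT.
  - by exists x.
apply: hT => A B pA qB.
have [|//|[x y] [[/= _ Ay] [/= _ By]]] := clpq (setT `*` A) (setT `*` B).
- by exists (setT, A) => //=; split => //; exact: filterT.
- by exists (setT, B) => //=; split => //; exact: filterT.
- by exists y.
Qed.

Lemma mulr_dnbhs0 (t : R) : t != 0 -> u * t @[u --> (0 : R)^'] --> (0 : R)^'.
Proof.
move=> t0 A /nbhs_ballP[d /= d0 dA].
apply/nbhs_ballP; exists (d / `|t|) => /=; first by rewrite divr_gt0 ?normr_gt0.
move=> u; rewrite /ball/= sub0r normrN => ud u0; apply: (dA (u * t)).
  by rewrite /ball/= sub0r normrN normrM -ltr_pdivlMr ?normr_gt0.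
by rewrite mulf_neq0.
Qed.

Lemma dderivE E F (f : E -> F) x h l : hausdorff_space F ->
  is_dderiv f x h l -> dderiv f x h = l.
Proof.
move=> hF fl; apply: xget_unique => // l' fl'.
exact: (cvg_unique hF fl' fl).
Qed.

Lemma dderivP E F (f : E -> F) x h : (exists l, is_dderiv f x h l) ->
  is_dderiv f x h (dderiv f x h).
Proof. by move=> fl; rewrite /dderiv; exact: xgetPex. Qed.

Lemma slope_convex E F (f : E -> F) (C : set F) x h (t : R) :
  open C -> convexP C -> t != 0 ->
  (forall s, 0 <= s <= 1 ->
     exists2 l, is_dderiv f (x + (s * t) *: h) h l & C l) ->
  C (t^-1 *: (f (x + t *: h) - f x)).
Proof.
move=> oC cC t0 df.
(* The factor [t^-1] cancels the speed [t] of the segment, so that the derivatives of [c] are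
   directional derivatives in the direction [h] itself. *)
pose c s := t^-1 *: f (x + (s * t) *: h).
pose c' s := xget 0 [set l | is_dderiv f (x + (s * t) *: h) h l /\ C l].
have := @convex_mean_value R F C c c' oC cC.
rewrite /c mul1r mul0r scale0r addr0 -scalerBr; apply => s s01.
have [l fl Cl] := df s s01.
have : [set l | is_dderiv f (x + (s * t) *: h) h l /\ C l] (c' s).
  by apply: xgetPex; exists l.
move=> [] dc' Cc'; split => //.
have -> : (fun u => u^-1 *:
      (t^-1 *: f (x + ((s + u) * t) *: h) - t^-1 *: f (x + (s * t) *: h))) =
    (fun v => v^-1 *: (f (x + (s * t) *: h + v *: h) - f (x + (s * t) *: h)))
      \o (fun u => u * t).
  apply/funext => u /=.
  by rewrite -scalerBr scalerA -invfM mulrDl scalerDl addrA.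
by apply: cvg_comp; [exact: mulr_dnbhs0|exact: dc'].
Qed.

(** By the mean value theorem a slope stays in any convex open set that contains the derivatives
    along the segment; joint continuity of the derivative makes this uniform in base points and
    directions near (x, h). *)
Lemma strong_dderiv E F (f : E -> F) (U : set E) x h (W : set F) :
  open U -> Cn 1 U f -> U x -> nbhs (dderiv f x h) W ->
  \forall p \near (x, h) & t \near (0 : R), t != 0 ->
    W (t^-1 *: (f (p.1 + t *: p.2) - f p.1)).
Proof.
move=> oU [df cdf] Ux Wd.
have [C [oC Cd cC CW]] := nbhs_convex Wd.
pose O := [set p : E * E | U p.1 /\ C (dderiv f p.1 p.2)].
have nO : nbhs (x, h) O.
  apply: filterI.
    apply: (@cvg_fst E E (nbhs x) (nbhs h)).
    exact: open_nbhs_nbhs.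
  have := cdf (x, h); rewrite inE => /(_ (conj Ux I)); apply.
  exact: open_nbhs_nbhs.
pose m := fun z : (E * E) * R^o => (z.1.1 + z.2 *: z.1.2, z.1.2).
have cm : m z @[z --> ((x, h), 0 : R^o)] --> (x, h).
  have c1 : z.1.1 @[z --> ((x, h), 0 : R^o)] --> x.
    by apply: (cvg_comp fst fst); [exact: cvg_fst|exact: cvg_fst].
  have c2 : z.1.2 @[z --> ((x, h), 0 : R^o)] --> h.
    by apply: (cvg_comp fst snd); [exact: cvg_fst|exact: cvg_snd].
  have c3 : z.2 @[z --> ((x, h), 0 : R^o)] --> (0 : R^o) by exact: cvg_snd.
  have c4 : z.1.1 + z.2 *: z.1.2 @[z --> ((x, h), 0 : R^o)] --> x.
    by have := tvs_cvgD c1 (tvs_cvgZ c3 c2); rewrite scale0r addr0; exact.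
  exact: (cvg_pair c4 c2).
have [[A B] /= [Ax /nbhs_ballP[d /= d0 dB]] ABO] := cm _ nO.
exists (A, ball (0 : R) d); first by split => //; exact: nbhsx_ballx.
move=> [[y r] t] /= [Ay td] t0; apply: CW.
apply: (slope_convex oC cC t0) => s /andP[s0 s1].
have [] := ABO ((y, r), s * t) => /=.
  split => //=; apply: dB; move: td; rewrite /ball/= !sub0r !normrN normrM.
  by apply: le_lt_trans; rewrite ger0_norm// ler_piMl.
move=> Uy Cy; exists (dderiv f (y + (s * t) *: r) r) => //.
by apply: dderivP; exact: df.
Qed.

(* The slope converges for a varying base point and direction; both the chain
   rule and the additivity of the derivative are instances. *)
Lemma strong_dderiv_cvg E F (f : E -> F) (U : set E) x h (y r : R -> E) :
  open U -> Cn 1 U f -> U x ->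
  y t @[t --> (0 : R)^'] --> x -> r t @[t --> (0 : R)^'] --> h ->
  t^-1 *: (f (y t + t *: r t) - f (y t)) @[t --> (0 : R)^'] --> dderiv f x h.
Proof.
move=> oU fU Ux yx rh W Wd.
have [[A B] /= [Ax B0] AB] := strong_dderiv oU fU Ux Wd.
have nt : \forall t \near (0 : R)^', t != 0 by exact: nbhs_dnbhs_neq.
have nB : \forall t \near (0 : R)^', B t by exact: nbhs_dnbhs.
have nA : \forall t \near (0 : R)^', A (y t, r t).
  by apply: (cvg_pair yx rh).
suff : \forall t \near (0 : R)^', W (t^-1 *: (f (y t + t *: r t) - f (y t))) by [].
near=> t; have At : A (y t, r t) by near: t.
have Bt : B t by near: t.
have t0 : t != 0 by near: t.
exact: (AB ((y t, r t), t) (conj At Bt) t0).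
Unshelve. all: by end_near. Qed.

Lemma dderiv_curve E F (f : E -> F) (U : set E) (y : R -> E) (h : E) :
  open U -> Cn 1 U f -> U (y 0) ->
  t^-1 *: (y t - y 0) @[t --> (0 : R)^'] --> h ->
  t^-1 *: (f (y t) - f (y 0)) @[t --> (0 : R)^'] --> dderiv f (y 0) h.
Proof.
move=> oU fU Uy yh.
have yc : y 0 @[t --> (0 : R)^'] --> y 0 by exact: cvg_cst.
have := strong_dderiv_cvg oU fU Uy yc yh; apply: cvg_trans.
apply: near_eq_cvg; near=> t.
have t0 : t != 0 by near: t; exact: nbhs_dnbhs_neq.
by rewrite scalerA mulfV// scale1r (addrC (y 0)) subrK.
Unshelve. all: by end_near. Qed.

Lemma dderivZ E F (f : E -> F) (U : set E) x h (a : R) :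
  hausdorff_space F -> open U -> Cn 1 U f -> U x ->
  dderiv f x (a *: h) = a *: dderiv f x h.
Proof.
move=> hF oU fU Ux.
have [->|a0] := eqVneq a 0.
  rewrite !scale0r; apply: dderivE => //; rewrite /is_dderiv.
  under eq_fun do rewrite scaler0 addr0 subrr scaler0.
  exact: cvg_cst.
apply: dderivE => //; have /dderivP fx := fU.1 x h Ux.
rewrite /is_dderiv.
have -> : (fun t => t^-1 *: (f (x + t *: (a *: h)) - f x)) =
   (fun y => a *: y) \o
   ((fun u => u^-1 *: (f (x + u *: h) - f x)) \o (fun t => t * a)).
  apply/funext => t /=; rewrite !scalerA invfM mulrCA mulfV// mulr1.
  by [].
exact: (tvs_cvgZ (cvg_cst (a : R^o)) (cvg_comp _ _ (mulr_dnbhs0 a0) fx)).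
Qed.

Lemma dderivD E F (f : E -> F) (U : set E) x h k :
  hausdorff_space F -> open U -> Cn 1 U f -> U x ->
  dderiv f x (h + k) = dderiv f x h + dderiv f x k.
Proof.
move=> hF oU fU Ux; apply: dderivE => //; rewrite /is_dderiv.
have th : x + t *: h @[t --> (0 : R)^'] --> x.
  apply: cvg_within_filter.
  have t0 : t @[t --> (0 : R^o)] --> (0 : R^o) by exact: cvg_id.
  have := tvs_cvgD (cvg_cst x : (fun _ : R^o => x) @ nbhs (0 : R^o) --> x)
    (tvs_cvgZ t0 (cvg_cst h)).
  by rewrite scale0r addr0; exact.
have kk : k @[t --> (0 : R)^'] --> k by exact: cvg_cst.
have s1 := strong_dderiv_cvg oU fU Ux th kk.
have /dderivP s2 := fU.1 x h Ux.
apply: cvg_trans (tvs_cvgD s2 s1); apply: near_eq_cvg; near=> t => /=.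
rewrite -scalerDr (scalerDr t h) (addrA x); congr (_ *: _).
by rewrite [LHS]addrC addrA subrK.
Unshelve. all: by end_near. Qed.

End StrongDifferentiability.

(** * Maps of class C^n: locality, pairs, composition *)

Section CnMaps.
Context (R : realType).
Implicit Types E F K : tvsType R.

Lemma openXT E F (U : set E) : open U -> open (U `*` [set: F]).
Proof.
rewrite !openE => oU [x y] /= [Ux _].
exists (U, setT); first by split => //=; [exact: oU|exact: filterT].
by move=> [a b] [].
Qed.

(** At a successor, [Cn] asks only for continuity of the derivative, so continuity of [f] has to be
    recovered. The derivative is continuous at (x, 0) with value 0, and the mean value theorem on a
    convex neighbourhood carries its smallness over to f(y) - f(x). *)
Lemma C1_continuous E F (U : set E) (f : E -> F) : hausdorff_space F ->
  open U -> Cn 1 U f -> {in U, continuous f}.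
Proof.
move=> hF oU fU x; rewrite inE => Ux W Wfx.
have d0 : dderiv f x 0 = 0.
  by rewrite -[X in dderiv f x X](scale0r 0) (dderivZ 0 0 hF oU fU Ux) scale0r.
have : nbhs (dderiv f x 0) [set v | W (f x + v)].
  rewrite d0; have : f x + v @[v --> (0 : F)] --> f x.
    by have := tvs_cvgD (@cvg_cst _ (f x) F (nbhs 0) _) (@cvg_id F (nbhs 0)); rewrite addr0; exact.
  by apply.
move=> /nbhs_convex[C [oC Cd cC CW]].
have nO : nbhs (x, 0) [set p : E * E | U p.1 /\ C (dderiv f p.1 p.2)].
  apply: filterI.
    by apply: (@cvg_fst E E (nbhs x) (nbhs 0)); exact: open_nbhs_nbhs.
  have := fU.2 (x, 0); rewrite inE => /(_ (conj Ux I)); apply.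
  exact: open_nbhs_nbhs.
have [[A B] /= [/nbhs_convex[A' [oA' A'x cA' A'A]] nB] ABO] := nO.
have nB' : \forall y \near x, B (y - x).
  have : y - x @[y --> x] --> 0.
    by have := tvs_cvgB (@cvg_id E (nbhs x)) (@cvg_cst _ x E (nbhs x) _); rewrite subrr; exact.
  by apply.
suff : \forall y \near x, W (f y) by [].
have nA' : nbhs x A' by exact: open_nbhs_nbhs.
near=> y.
have A'y : A' y by near: y.
have By : B (y - x) by near: y.
have : C (1^-1 *: (f (x + 1 *: (y - x)) - f x)).
  apply: (slope_convex oC cC (oner_neq0 R)) => s /andP[s0 s1].
  have A's : A' (x + (s * 1) *: (y - x)).
    have := cA' _ _ A'y A'x s s0 s1.
    by rewrite mulr1 scalerBr scalerBl scale1r addrC -addrA [- _ + _]addrC.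
  have [Us Cs] := ABO (_, y - x) (conj (A'A _ A's) By).
  by exists (dderiv f (x + (s * 1) *: (y - x)) (y - x)) => //; apply/dderivP/fU.1.
move=> /CW /=; rewrite invr1 !scale1r.
by rewrite [x + _]addrC subrK [f x + _]addrC subrK.
Unshelve. all: by end_near. Qed.

Lemma Cn_le n E F (U : set E) (f : E -> F) : hausdorff_space F -> open U ->
  Cn n.+1 U f -> Cn n U f.
Proof.
move=> hF; elim: n => [|n IH] in E U f * => oU; first exact: C1_continuous.
move=> [df cdf]; split => //; exact: IH (openXT oU) cdf.
Qed.

Lemma Cn_leq m n E F (U : set E) (f : E -> F) : hausdorff_space F -> open U ->
  (m <= n)%N -> Cn n U f -> Cn m U f.
Proof.
move=> hF oU; elim: n => [|n IH]; first by rewrite leqn0 => /eqP ->.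
rewrite leq_eqVlt => /predU1P[->//|]; rewrite ltnS => mn /(Cn_le hF oU).
exact: IH.
Qed.

Lemma is_dderiv_eq E F (U : set E) (f g : E -> F) x h l : open U ->
  {in U, f =1 g} -> U x -> is_dderiv f x h l -> is_dderiv g x h l.
Proof.
move=> oU fg Ux; apply: cvg_trans; apply: near_eq_cvg.
have Ut : \forall t \near (0 : R)^', U (x + t *: h).
  have c : x + t *: h @[t --> (0 : R)^'] --> x.
    apply: cvg_within_filter.
    have t0 : t @[t --> (0 : R^o)] --> (0 : R^o) by exact: cvg_id.
    have := tvs_cvgD (cvg_cst x : (fun _ : R^o => x) @ nbhs (0 : R^o) --> x)
      (tvs_cvgZ t0 (cvg_cst h)).
    by rewrite scale0r addr0; exact.
  by apply: c; exact: open_nbhs_nbhs.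
by near=> t; rewrite !fg ?inE//; near: t.
Unshelve. all: by end_near. Qed.

Lemma dderiv_eq E F (U : set E) (f g : E -> F) x h : hausdorff_space F ->
  open U -> {in U, f =1 g} -> U x -> dderiv f x h = dderiv g x h.
Proof.
move=> hF oU fg Ux; rewrite /dderiv; congr (xget _ _); apply/seteqP.
split=> l; first exact: is_dderiv_eq fg Ux.
by apply: is_dderiv_eq Ux => // y Uy; rewrite fg.
Qed.

Lemma Cn_eq n E F (U : set E) (f g : E -> F) : hausdorff_space F -> open U ->
  {in U, f =1 g} -> Cn n U f -> Cn n U g.
Proof.
move=> hF; elim: n => [|n IH] in E U f g *; move=> oU fg.
  move=> cf x xU; move: (xU); rewrite inE => Ux.
  have := cf x xU; rewrite /prop_for /continuous_at fg//; apply: cvg_trans.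
  apply: near_eq_cvg; have nU : nbhs x U by exact: open_nbhs_nbhs.
  by near=> y; rewrite fg// inE; near: y.
move=> [df cdf]; split.
  by move=> x h Ux; have [l fl] := df x h Ux; exists l; exact: is_dderiv_eq fg Ux fl.
apply: (IH _ _ _ _ (openXT oU)) cdf => -[x h]; rewrite inE => -[/= Ux _].
exact: (dderiv_eq h hF oU fg Ux).
Unshelve. all: by end_near. Qed.

Lemma Cn_local n E F (U : set E) (f : E -> F) :
  (forall x, U x -> exists V, [/\ open V, V x & Cn n V f]) -> Cn n U f.
Proof.
elim: n => [|n IH] in E U f *; move=> loc.
  move=> x; rewrite inE => Ux; have [V [oV Vx]] := loc x Ux.
  by apply; rewrite inE.
split.
  by move=> x h Ux; have [V [oV Vx [dV _]]] := loc x Ux; exact: dV.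
apply: IH => -[x h] [/= Ux _]; have [V [oV Vx [_ cV]]] := loc x Ux.
by exists (V `*` setT); split => //; exact: openXT.
Qed.

Lemma Cn_sub n E F (U V : set E) (f : E -> F) : open U -> V `<=` U ->
  Cn n U f -> Cn n V f.
Proof.
by move=> oU VU fU; apply: Cn_local => x Vx; exists U; split => //; exact: VU.
Qed.

Lemma is_dderiv_linear E F (l : {linear E -> F}) x h : is_dderiv l x h (l h).
Proof.
have lc : l h @[t --> (0 : R)^'] --> l h by exact: cvg_cst.
apply: cvg_trans lc; apply: near_eq_cvg; near=> t.
have t0 : t != 0 by near: t; exact: nbhs_dnbhs_neq.
by rewrite [x + _]addrC linearP addrK scalerA mulVf// scale1r.
Unshelve. all: by end_near. Qed.

Lemma Cn_linear n E F (U : set E) (l : {linear E -> F}) : hausdorff_space F ->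
  continuous l -> Cn n U l.
Proof.
move=> hF; elim: n => [|n IH] in E U l *; move=> lc; first by move=> x _; exact: lc.
split; first by move=> x h _; exists (l h); exact: is_dderiv_linear.
have -> : (fun p : E * E => dderiv l p.1 p.2) = l \o snd.
  by apply/funext => p /=; apply: dderivE => //; exact: is_dderiv_linear.
have ls : linear (l \o (@snd E E)) by move=> a p q /=; rewrite linearP.
pose L := GRing.isLinear.Build _ _ _ _ _ ls.
pose l' : {linear (E * E)%type -> F} := HB.pack (l \o (@snd E E)) L.
apply: (IH _ _ l') => p; apply: (@continuous_comp _ _ _ snd l).
  exact: cvg_snd.
exact: lc.
Qed.

Lemma Cn_cst n E F (U : set E) (a : F) : hausdorff_space F ->
  Cn n U (fun _ => a).
Proof.
move=> hF; elim: n => [|n IH] in E U a *; first by move=> x _; exact: cvg_cst.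
have d0 x h : is_dderiv (fun _ : E => a) x h 0.
  by rewrite /is_dderiv; under eq_fun do rewrite subrr scaler0; exact: cvg_cst.
split; first by move=> x h _; exists 0.
have -> : (fun p : E * E => dderiv (fun _ => a) p.1 p.2) = fun _ => 0.
  by apply/funext => p; exact: dderivE.
exact: IH.
Qed.

Lemma is_dderiv_pair E F K (f : E -> F) (g : E -> K) x h l k :
  is_dderiv f x h l -> is_dderiv g x h k ->
  is_dderiv (fun y => (f y, g y) : F * K) x h (l, k).
Proof. by move=> fl gk; exact: (cvg_pair fl gk). Qed.

Lemma Cn_pair n E F K (U : set E) (f : E -> F) (g : E -> K) :
  hausdorff_space F -> hausdorff_space K -> open U ->
  Cn n U f -> Cn n U g -> Cn n U (fun y => (f y, g y) : F * K).
Proof.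
move=> hF hK; elim: n => [|n IH] in E U f g *; move=> oU.
  by move=> cf cg x xU; exact: (cvg_pair (cf x xU) (cg x xU)).
move=> [df cdf] [dg cdg]; split.
  move=> x h Ux; have [l fl] := df x h Ux; have [k gk] := dg x h Ux.
  by exists (l, k); exact: is_dderiv_pair.
apply: (Cn_eq (f := fun p => (dderiv f p.1 p.2, dderiv g p.1 p.2))).
- exact: hausdorff_prod.
- exact: openXT.
- move=> -[x h]; rewrite inE => -[/= Ux _]; apply/esym/dderivE.
    exact: hausdorff_prod.
  by apply: is_dderiv_pair; apply: dderivP; [exact: df|exact: dg].
- exact: (IH _ _ _ _ (openXT oU) cdf cdg).
Qed.

Lemma is_dderiv_comp E F K (U : set E) (V : set F) (f : E -> F) (g : F -> K) x h l :
  open V -> Cn 1 V g -> V (f x) -> is_dderiv f x h l ->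
  is_dderiv (g \o f) x h (dderiv g (f x) l).
Proof.
move=> oV gV Vx fl.
have := @dderiv_curve R F K g V (fun t => f (x + t *: h)) l oV gV.
by rewrite scale0r addr0; apply.
Qed.

Lemma open_preimage_in (S T : topologicalType) (U : set S) (V : set T) (f : S -> T) :
  open U -> {in U, continuous f} -> open V -> open (U `&` f @^-1` V).
Proof.
rewrite !openE => oU cf oV x [Ux Vfx]; apply: filterI; first exact: oU.
by have := cf x; rewrite inE => /(_ Ux); apply; exact: oV.
Qed.

Lemma dderiv_comp_linear E F K (l : {linear E -> F}) (f : F -> K) x h :
  is_dderiv (f \o l) x h = is_dderiv f (l x) (l h).
Proof.
apply/funext => k; rewrite /is_dderiv.
by under eq_fun do rewrite /= [x + _]addrC linearP [_ + l x]addrC.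
Qed.

(** Proved ahead of the chain rule, whose induction applies it to [fst]. The difference quotients of
    [f \o l] are those of [f], so the derivative is again a composite with a linear map. *)
Lemma Cn_comp_linear n E F K (U : set F) (l : {linear E -> F}) (f : F -> K) :
  continuous l -> Cn n U f -> Cn n (l @^-1` U) (f \o l).
Proof.
elim: n => [|n IH] in E F U l f *; move=> lc fU.
  move=> x; rewrite inE => Ux; apply: continuous_comp; first exact: lc.
  by apply: fU; rewrite inE.
split; first by move=> x h Ux; rewrite dderiv_comp_linear; exact: fU.1.
have ls : linear (fun p : E * E => (l p.1, l p.2) : F * F).
  by move=> a p q /=; rewrite !linearP.
pose L := GRing.isLinear.Build _ _ _ _ _ ls.
pose l' : {linear (E * E)%type -> (F * F)%type} :=
  HB.pack (fun p : E * E => (l p.1, l p.2) : F * F) L.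
have lc' : continuous l'.
  move=> p; apply: cvg_pair; apply: (@continuous_comp _ _ _ _ l); try exact: lc.
    exact: cvg_fst.
  exact: cvg_snd.
have := IH _ _ _ l' _ lc' fU.2.
have -> : (fun p : E * E => dderiv (f \o l) p.1 p.2) =
    (fun p : F * F => dderiv f p.1 p.2) \o l'.
  by apply/funext => p /=; rewrite /dderiv dderiv_comp_linear.
suff -> : l' @^-1` (U `*` setT) = (l @^-1` U) `*` setT by [].
by apply/seteqP; split => p.
Qed.

(** The derivative of [g \o f] is that of [g] after (f o fst, df), which is of class C^n by the
    induction hypothesis; hence the induction is over all spaces at once. *)
Lemma Cn_comp n E F K (U : set E) (V : set F) (f : E -> F) (g : F -> K) :
  hausdorff_space F -> hausdorff_space K -> open U -> open V ->
  Cn n U f -> Cn n V g -> (forall x, U x -> V (f x)) -> Cn n U (g \o f).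
Proof.
move=> + hK; elim: n => [|n IH] in E F U V f g *; move=> hF oU oV fU gV UV.
  move=> x; rewrite inE => Ux; apply: continuous_comp; first by apply: fU; rewrite inE.
  by apply: gV; rewrite inE; exact: UV.
have g1 : Cn 1 V g by exact: (@Cn_leq 1 n.+1).
have fn : Cn n U f by exact: Cn_le.
split.
  move=> x h Ux; have [l fl] := fU.1 x h Ux.
  exists (dderiv g (f x) l); exact: (is_dderiv_comp setT oV g1 (UV x Ux) fl).
pose df := fun p : E * E => (f p.1, dderiv f p.1 p.2) : F * F.
apply: (Cn_eq (f := (fun p : F * F => dderiv g p.1 p.2) \o df)) => //.
- exact: openXT.
- move=> -[x h]; rewrite inE => -[/= Ux _]; apply/esym/dderivE => //.
  apply: (is_dderiv_comp setT oV g1 (UV x Ux)).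
  by apply: dderivP; exact: fU.1.
- apply: (IH _ _ _ (V `*` setT)).
  + exact: hausdorff_prod.
  + exact: openXT.
  + exact: openXT.
  + apply: Cn_pair => //; [exact: openXT| |exact: fU.2].
    have -> : U `*` setT = (@fst E E) @^-1` U by apply/seteqP; split => [p []|p].
    apply: (@Cn_comp_linear n (E * E)%type E F U (@fst E E)) fn => p.
    exact: cvg_fst.
  + exact: gV.2.
  + by move=> [x h] [/= Ux _]; split => //=; exact: UV.
Qed.

End CnMaps.

(** * Smooth maps between manifolds *)

Section SmoothMaps.
Context (R : realType).

(** Smoothness is local, so around each point a chart of the middle manifold is inserted. Only the
    middle family of charts has to cover; the outer ones can be products of charts or the one chart
    of a vector space. *)
Lemma smooth_map_comp (M N P : topologicalType) (E F K : tvsType R)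
    (A : set (chart M E)) (B : set (chart N F)) (D : set (chart P K))
    (f : M -> N) (g : N -> P) :
  hausdorff_space F -> hausdorff_space K ->
  (forall c, A c -> open (chart_cod c) /\
     {in chart_cod c, continuous (chart_inv c)}) ->
  B `<=` @is_chart R N F -> (forall y, exists2 b, B b & chart_dom b y) ->
  (forall d, D d -> open (chart_dom d)) ->
  smooth_map A B f -> smooth_map B D g -> smooth_map A D (g \o f).
Proof.
move=> hF hK hA hB covB hD [cf sf] [cg sg]; split.
  by move=> x; apply: continuous_comp; [exact: cf|exact: cg].
move=> c d Ac Dd n; have [oc ci] := hA c Ac; have od := hD d Dd.
apply: Cn_local => y0 [/= cy0 dy0].
have [b Bb by0] := covB (f (chart_inv c y0)).
have [[ob obc] bb bK bc bi] := hB b Bb.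
have cfi : {in chart_cod c, continuous (f \o chart_inv c)}.
  by move=> y yc; apply: continuous_comp; [exact: ci|exact: cf].
have cgi : {in chart_cod b, continuous (g \o chart_inv b)}.
  by move=> y yc; apply: continuous_comp; [exact: bi|exact: cg].
have cgfi : {in chart_cod c, continuous (g \o (f \o chart_inv c))}.
  by move=> y yc; apply: continuous_comp; [exact: cfi|exact: cg].
have oV1 := open_preimage_in oc cfi ob.
have oV2 := open_preimage_in oc cgfi od.
have oW := open_preimage_in obc cgi od.
pose V := (chart_cod c `&` (f \o chart_inv c) @^-1` chart_dom b) `&`
          (chart_cod c `&` (g \o (f \o chart_inv c)) @^-1` chart_dom d).
have oV : open V by exact: openI.
exists V; split => //.
apply: (Cn_eq (f := (fun z => d (g (chart_inv b z))) \o (fun y => b (f (chart_inv c y))))) => //.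
  by move=> y; rewrite inE => -[[cy by_] _] /=; rewrite bK// inE.
apply: (Cn_comp hF hK oV oW).
- by apply: Cn_sub oV1 _ (sf c b Ac Bb n) => y [].
- exact: sg.
- move=> y [[cy by_] [_ dy]] /=; split; first exact: (set_bij_sub bb).
  by rewrite /= bK// inE.
Qed.

Lemma smooth_into_tvs (M : topologicalType) (E F : tvsType R)
    (A : set (chart M E)) (f : M -> F) :
  smooth_map A (tvs_atlas F) f <->
  continuous f /\ forall c, A c -> Cinfty (chart_cod c) (f \o chart_inv c).
Proof.
split=> [[cf sf]|[cf sf]]; split => // c.
  move=> Ac; have := sf c _ Ac erefl; rewrite /=.
  by rewrite (_ : [set y | _] = setT) ?setIT//; apply/seteqP; split.
move=> d Ac -> /=; rewrite (_ : [set y | _] = setT) ?setIT; last first.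
  by apply/seteqP; split.
exact: sf.
Qed.

Lemma open_setX (S T : topologicalType) (U : set S) (V : set T) :
  open U -> open V -> open (U `*` V).
Proof.
rewrite !openE => oU oV [x y] /= [Ux Vy].
by exists (U, V); first by split => /=; [exact: oU|exact: oV].
Qed.

Lemma prod_chart_inv (M N : topologicalType) (E F : tvsType R)
    (c : chart M E) (d : chart N F) :
  is_chart c -> is_chart d -> open (chart_cod (prod_chart c d)) /\
  {in chart_cod (prod_chart c d), continuous (chart_inv (prod_chart c d))}.
Proof.
move=> [[_ oc] _ _ _ ci] [[_ od] _ _ _ di]; split.
  exact: open_setX.
move=> [x y]; rewrite inE => -[/= cx dy]; apply: cvg_pair => /=.
  apply: (@cvg_comp _ _ _ fst (chart_inv c)); first exact: cvg_fst.
  by apply: ci; rewrite inE.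
apply: (@cvg_comp _ _ _ snd (chart_inv d)); first exact: cvg_snd.
by apply: di; rewrite inE.
Qed.

End SmoothMaps.

(** * One-parameter groups of automorphisms *)

Section UnitaryOperators.
Context (R : realType) (H : completeNormedModType R[i]).
Context (dot : {dot H for Num.conj}) (hdot : hilbert_dot dot).

Lemma unitary_norm (T : H -> H) (v : H) : unitary_op dot T -> `|T v| = `|v|.
Proof.
move=> [_ isoT _]; apply/eqP; rewrite -(@eqrXn2 _ 2)//; apply/eqP.
by rewrite !hdot isoT.
Qed.

Lemma unitary_linear (T : H -> H) : unitary_op dot T ->
  {l : {linear realified H -> realified H} | l = T :> (H -> H) &
     continuous l}.
Proof.
move=> uT; have [lT _ _] := uT.
have lT' : linear (T : realified H -> realified H).
  by move=> a x y; exact: lT.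
pose L := GRing.isLinear.Build _ _ _ _ _ lT'.
pose l : {linear realified H -> realified H} :=
  HB.pack (T : realified H -> realified H) L.
exists l; first by [].
move=> x; apply: (iffRL (@cvgrPdist_lt R[i] H _ (nbhs x) _ T (T x))) => e e0.
have nx := @cvgr_dist_lt R[i] H _ (nbhs x) _ id x (@cvg_id H (nbhs x)) e e0.
near=> y; have -> : T x - T y = T (x - y).
  by have := lT (-1) y x; rewrite !scaleN1r (addrC (- y)) (addrC (- T y)).
by rewrite (unitary_norm _ uT); near: y; exact: nx.
Unshelve. all: by end_near. Qed.

End UnitaryOperators.

Lemma realified_hausdorff (R : realType) (H : completeNormedModType R[i]) :
  hausdorff_space (realified H).
Proof. exact: (@norm_hausdorff R[i] H). Qed.

Section LieGroupFlow.
Context (R : realType) (g : tvsType R) (G : preTopologicalGroupType).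
Context (A : set (chart G g)) (phi : chart G g) (expG : g -> G).
Context (gamma : R -> G -> G).
Context (hg : hausdorff_space g) (lieG : lie_group A) (Aphi : A phi).
Context (phi1 : chart_dom phi 1%g) (hexp : exponential_map A phi expG).
Context (hgamma : automorphic_flow A gamma).

Let e : g := phi 1%g.

Lemma chart_phi : is_chart phi.
Proof. by have [_ [chA _ _] _ _] := lieG; exact: chA. Qed.

Lemma chart_inv_phi : {in chart_dom phi, cancel phi (chart_inv phi)}.
Proof. by have [] := chart_phi. Qed.

Lemma cod_phi1 : chart_cod phi e.
Proof.
have [_ b _ _ _] := chart_phi.
by apply: (set_bij_sub b); exists 1%g.
Qed.

Lemma exp0 : expG 0 = 1%g.
Proof.
have [_ hD _] := hexp; have := hD 0 0 0; rewrite !scaler0 => h.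
by apply: (@mulgI _ (expG 0)); rewrite mulg1 -h.
Qed.

Lemma continuous_exp_line (x : g) :
  expG (t *: x) @[t --> (0 : R)^'] --> (1%g : G).
Proof.
have [[ce _] _ _] := hexp; rewrite -exp0.
apply: (cvg_comp (fun t : R => t *: x) expG); last exact: ce.
apply: cvg_within_filter.
have t0 : t @[t --> (0 : R^o)] --> (0 : R^o) by exact: cvg_id.
by have := tvs_cvgZ t0 (cvg_cst x); rewrite scale0r; exact.
Qed.

Lemma exp_velocity (x : g) :
  t^-1 *: (phi (expG (t *: x)) - e) @[t --> (0 : R)^'] --> x.
Proof.
have [_ _ hd] := hexp; have := hd x; rewrite /is_dderiv.
rewrite scale0r exp0; apply: cvg_trans; apply: near_eq_cvg; near=> t.
by rewrite add0r [t *: 1]mulr1.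
Unshelve. all: by end_near. Qed.

Lemma gamma1 t : gamma t 1%g = 1%g.
Proof.
have [_ hM _ _ _] := hgamma.
by apply: (@mulgI _ (gamma t 1%g)); rewrite mulg1 -hM mulg1.
Qed.

Lemma gammaV t x : gamma t x^-1%g = (gamma t x)^-1%g.
Proof.
have [_ hM _ _ _] := hgamma.
by apply: (@mulgI _ (gamma t x)); rewrite -hM !mulgV gamma1.
Qed.

Lemma continuous_gamma t : continuous (gamma t).
Proof. by have [sg _ _ _ _] := hgamma; have [] := sg t. Qed.

Definition flow_chart t (y : g) : g := phi (gamma t (chart_inv phi y)).

Definition flow_dom t : set g :=
  chart_cod phi `&` (gamma t \o chart_inv phi) @^-1` chart_dom phi.

Lemma open_flow_dom t : open (flow_dom t).
Proof.
have [[od oc] _ _ _ ci] := chart_phi; apply: open_preimage_in => // y yc.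
by apply: continuous_comp; [exact: ci|exact: continuous_gamma].
Qed.

Lemma flow_dom1 t : flow_dom t e.
Proof.
split; first exact: cod_phi1.
by rewrite /= /e chart_inv_phi ?inE// gamma1.
Qed.

Lemma Cn_flow_chart n t : Cn n (flow_dom t) (flow_chart t).
Proof. by have [sg _ _ _ _] := hgamma; have [_] := sg t; apply. Qed.

Lemma flow_chart1 t : flow_chart t e = e.
Proof. by rewrite /flow_chart /e chart_inv_phi ?inE// gamma1. Qed.

Local Notation alpha t := (lie_map phi (gamma t)).

Lemma lie_mapD t x y : alpha t (x + y) = alpha t x + alpha t y.
Proof. exact: (dderivD _ _ hg (open_flow_dom t) (Cn_flow_chart 1 t) (flow_dom1 t)). Qed.

Lemma lie_mapZ t a x : alpha t (a *: x) = a *: alpha t x.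
Proof. exact: (dderivZ _ _ hg (open_flow_dom t) (Cn_flow_chart 1 t) (flow_dom1 t)). Qed.

Lemma flow_velocity t x :
  is_dderiv (flow_chart t) e x (alpha t x).
Proof. by apply: dderivP; exact: (Cn_flow_chart 1 t).1 (flow_dom1 t). Qed.

Lemma lie_map_comp s t x : alpha (s + t) x = alpha s (alpha t x).
Proof.
have [_ _ _ gD _] := hgamma.
apply: dderivE => //; apply: (is_dderiv_eq (open_flow_dom t)
  (f := flow_chart s \o flow_chart t)).
- move=> y; rewrite inE => -[cy dy]; rewrite /flow_chart /= chart_inv_phi ?inE//.
  by rewrite gD.
- exact: flow_dom1.
have := is_dderiv_comp setT (open_flow_dom s) (Cn_flow_chart 1 s) _ (@flow_velocity t x).
by rewrite flow_chart1; apply; exact: flow_dom1.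
Qed.

(** The Lie algebra element is transported as the velocity of a curve through the unit;
    [orbit_velocity] turns this velocity into the derivative of the representation along the
    curve. *)
Lemma flow_exp_velocity t x :
  u^-1 *: (phi (gamma t (expG (u *: x))) - e) @[u --> (0 : R)^'] --> alpha t x.
Proof.
have := @dderiv_curve R g g (flow_chart t) _ (fun u => phi (expG (u *: x))) x
  (open_flow_dom t) (Cn_flow_chart 1 t).
rewrite scale0r exp0 => /(_ (flow_dom1 t) (@exp_velocity x)).
rewrite flow_chart1; apply: cvg_trans; apply: near_eq_cvg.
have [[od _] _ _ _ _] := chart_phi.
have nd : \forall u \near (0 : R)^', chart_dom phi (expG (u *: x)).
  by apply: (@continuous_exp_line x); exact: open_nbhs_nbhs.
near=> u; rewrite /flow_chart chart_inv_phi// inE; near: u; exact: nd.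
Unshelve. all: by end_near. Qed.

End LieGroupFlow.

(** * Complex-valued integrals on the line *)

Section AffineSubstitution.
Context (R : realType).
Notation mu := (@lebesgue_measure R).
Local Open Scope ereal_scope.

Lemma measurable_affine (c b : R) :
  measurable_fun [set: measurableTypeR R] (fun x : measurableTypeR R => (c * x + b)%R : measurableTypeR R).
Proof. by apply: measurable_funD => //; exact: measurable_funM. Qed.

(** By uniqueness of the measure with the given values on half-open intervals. For negative [c] the
    preimage of such an interval is half-open on the other side. *)
Lemma lebesgue_measure_affine (c b : R) (A : set R) : (c != 0)%R -> measurable A ->
  mu A = `|c|%:E * mu ((fun x : R => (c * x + b)%R) @^-1` A).
Proof.
move=> c0 mA.
pose mphi := isMeasurableFun.Build _ _ _ _ _ (measurable_affine c b).
pose phi : {mfun measurableTypeR R >-> measurableTypeR R} :=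
  HB.pack (fun x : measurableTypeR R => (c * x + b)%R : measurableTypeR R) mphi.
rewrite (@lebesgue_measure_unique R (mscale (NngNum (normr_ge0 c)) (pushforward mu phi)))//.
move=> _ [[x y]] _ <-.
transitivity (`|c|%:E * mu ((fun x : R => (c * x + b)%R) @^-1` [set` `]x, y]])); last by [].
rewrite lebesgue_measure_itv /=.
have [c_gt0|c_lt0] : (0 < c \/ c < 0)%R by case: (ltgtP c 0%R) c0 => //; [right|left].
  rewrite [X in _ * lebesgue_measure X](_ : _ = [set` `]((x - b) / c)%R, ((y - b) / c)%R]]); last first.
    apply/seteqP; split => z /=; rewrite !in_itv/= ltr_pdivrMr// ler_pdivlMr//.
      by rewrite mulrC; lra.
    by rewrite mulrC; lra.
  rewrite lebesgue_measure_itv /= !lte_fin ltr_pM2r ?invr_gt0// ltrD2r.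
  case: ifP => _; last by rewrite mule0.
  by rewrite gtr0_norm// -!EFinB -EFinM; congr EFin; field.
rewrite [X in _ * lebesgue_measure X](_ : _ = [set` `[((y - b) / c)%R, ((x - b) / c)%R[]); last first.
  apply/seteqP; split => z /=; rewrite !in_itv/= ltr_ndivlMr// ler_ndivrMr//.
    by rewrite mulrC; lra.
  by rewrite mulrC; lra.
rewrite lebesgue_measure_itv /= !lte_fin ltr_nM2r ?invr_lt0// ltrD2r.
case: ifP => _; last by rewrite mule0.
by rewrite ltr0_norm// -!EFinB -EFinM; congr EFin; field.
Qed.

Lemma ge0_integral_affine (f : R -> \bar R) (c b : R) : (c != 0)%R ->
  measurable_fun [set: R] f -> (forall x, 0 <= f x) ->
  \int[mu]_x f x = `|c|%:E * \int[mu]_x f (c * x + b)%R.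
Proof.
move=> c0 mf f0.
pose mphi := isMeasurableFun.Build _ _ _ _ _ (measurable_affine c b).
pose phi : {mfun measurableTypeR R >-> measurableTypeR R} :=
  HB.pack (fun x : measurableTypeR R => (c * x + b)%R : measurableTypeR R) mphi.
rewrite (@eq_measure_integral _ _ _ _ (mscale (NngNum (normr_ge0 c)) (pushforward mu phi))).
  rewrite ge0_integral_mscale//; congr (_ * _).
  by rewrite ge0_integral_pushforward// preimage_setT.
by move=> /= S mS _; exact: lebesgue_measure_affine.
Qed.

Lemma integral_affine (f : R -> \bar R) (c b : R) : (c != 0)%R ->
  mu.-integrable setT f -> mu.-integrable setT (fun x => f (c * x + b)%R) /\
  \int[mu]_x f x = `|c|%:E * \int[mu]_x f (c * x + b)%R.
Proof.
move=> c0 /[dup] intf /integrableP[mf foo].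
have mfc : measurable_fun setT (fun x : R => f (c * x + b)%R).
  exact: (measurableT_comp mf (measurable_affine c b)).
have intfc : mu.-integrable setT (fun x => f (c * x + b)%R).
  apply/integrableP; split => //.
  move: foo; rewrite (ge0_integral_affine b c0)//; last exact: measurableT_comp.
  rewrite -[X in _ < X](@gt0_muley _ `|c|%:E) ?lte_fin ?normr_gt0//.
  by rewrite lte_pmul2l// ?lte_fin ?normr_gt0.
split => //; rewrite integralE.
rewrite (ge0_integral_affine b c0 (measurable_funepos mf))//.
rewrite (ge0_integral_affine b c0 (measurable_funeneg mf))//.
pose h x := f (c * x + b)%R.
have pE : (fun x => f^\+ (c * x + b)%R) = h^\+ by apply/funext => x; rewrite /h !funeposE.
have nE : (fun x => f^\- (c * x + b)%R) = h^\- by apply/funext => x; rewrite /h !funenegE.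
rewrite pE nE -muleBr//; first by rewrite [in RHS]integralE.
rewrite fin_num_adde_defl// fin_numN.
exact: (integrable_neg_fin_num measurableT intfc).
Qed.

End AffineSubstitution.

Section ComplexNumbers.
Context (R : realType).
Implicit Types (z w : R[i]) (a b : R).

(* The l^1 norm on R[i]: real-valued and submultiplicative. *)
Definition c1 z : R := `|complex.Re z| + `|complex.Im z|.

Definition J a : R[i] := cos a +i* sin a.

Lemma c1_ge0 z : 0 <= c1 z. Proof. by rewrite addr_ge0. Qed.

Lemma c1_0 : c1 0 = 0. Proof. by rewrite /c1 normr0 addr0. Qed.

Lemma c1_eq0 z : c1 z = 0 -> z = 0.
Proof.
case: z => x y; rewrite /c1 /= => /eqP.
by rewrite paddr_eq0// !normr_eq0 => /andP[/eqP -> /eqP ->].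
Qed.

Lemma c1D z w : c1 (z + w) <= c1 z + c1 w.
Proof.
case: z w => x y [x' y']; rewrite /c1 /= addrACA.
by rewrite lerD// ler_normD.
Qed.

Lemma c1N z : c1 (- z) = c1 z.
Proof. by case: z => x y; rewrite /c1 /= !normrN. Qed.

Lemma c1B z w : c1 (z - w) <= c1 z + c1 w.
Proof. by rewrite -(c1N w) c1D. Qed.

Lemma c1M z w : c1 (z * w) <= c1 z * c1 w.
Proof.
case: z w => x y [x' y']; rewrite /c1 /=.
rewrite mulrDl !mulrDr -!normrM [X in _ <= _ + X]addrC addrACA.
by apply: lerD; [exact: ler_normB|exact: ler_normD].
Qed.

Lemma c1R a z : c1 (a%:C * z) = `|a| * c1 z.
Proof. by case: z => x y; rewrite /c1 /=; simpc; rewrite !normrM mulrDr. Qed.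

Lemma c1_real a : c1 a%:C = `|a|.
Proof. by rewrite /c1 /= normr0 addr0. Qed.

Lemma c1J a : c1 (J a) <= 2.
Proof.
rewrite /c1 /=; have h2 := cos_max a; have h1 := cos2Dsin2 a.
have h3 : `|sin a| <= 1 by rewrite ler_norml sin_geN1 sin_le1.
by lra.
Qed.

Lemma JD a b : J (a + b) = J a * J b.
Proof. by rewrite /J cosD sinD; simpc; rewrite [X in _ +i* X]addrC. Qed.

Lemma J0 : J 0 = 1. Proof. by rewrite /J cos0 sin0. Qed.

Lemma JN a : J (- a) * J a = 1. Proof. by rewrite -JD addNr J0. Qed.

Lemma Re_ler_c1 z : `|complex.Re z| <= c1 z. Proof. by rewrite /c1 lerDl. Qed.

Lemma Im_ler_c1 z : `|complex.Im z| <= c1 z. Proof. by rewrite /c1 lerDr. Qed.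

End ComplexNumbers.

Section MeasurableC.
Context (R : realType) d (T : measurableType d).
Implicit Types f g : T -> R[i].

Definition mC f := measurable_fun setT (@complex.Re R \o f) /\
  measurable_fun setT (@complex.Im R \o f).

Lemma mC_cst z : mC (fun=> z).
Proof. by split; exact: measurable_cst. Qed.

Lemma mC_real (h : T -> R) : measurable_fun setT h -> mC (fun t => (h t)%:C).
Proof. by move=> mh; split => //; exact: measurable_cst. Qed.

Lemma mCD f g : mC f -> mC g -> mC (fun t => f t + g t).
Proof.
move=> [f1 f2] [g1 g2]; split.
  rewrite (_ : _ \o _ = (@complex.Re R \o f) \+ (@complex.Re R \o g)).
    exact: measurable_funD.
  by apply/funext => t /=; case: (f t) (g t) => ? ? [].
rewrite (_ : _ \o _ = (@complex.Im R \o f) \+ (@complex.Im R \o g)).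
  exact: measurable_funD.
by apply/funext => t /=; case: (f t) (g t) => ? ? [].
Qed.

Lemma mCM f g : mC f -> mC g -> mC (fun t => f t * g t).
Proof.
move=> [f1 f2] [g1 g2]; split.
  rewrite (_ : _ \o _ = ((@complex.Re R \o f) \* (@complex.Re R \o g)) \-
      ((@complex.Im R \o f) \* (@complex.Im R \o g))).
    by apply: measurable_funB; exact: measurable_funM.
  by apply/funext => t /=; case: (f t) (g t) => ? ? [].
rewrite (_ : _ \o _ = ((@complex.Re R \o f) \* (@complex.Im R \o g)) \+
    ((@complex.Im R \o f) \* (@complex.Re R \o g))).
  by apply: measurable_funD; exact: measurable_funM.
by apply/funext => t /=; case: (f t) (g t) => ? ? [].
Qed.

Lemma measurable_c1 f : mC f -> measurable_fun setT (fun t => c1 (f t)).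
Proof.
by move=> [f1 f2]; apply: measurable_funD; exact: measurableT_comp.
Qed.

Lemma mC_comp d' (T' : measurableType d') f (h : T' -> T) :
  measurable_fun setT h ->
  measurable_fun setT (@complex.Re R \o f) /\ measurable_fun setT (@complex.Im R \o f) ->
  measurable_fun setT (@complex.Re R \o (f \o h)) /\
  measurable_fun setT (@complex.Im R \o (f \o h)).
Proof.
by move=> mh [f1 f2]; split; [exact: (measurableT_comp f1 mh)|
  exact: (measurableT_comp f2 mh)].
Qed.

Lemma mC_J (h : T -> R) : measurable_fun setT h -> mC (fun t => J (h t)).
Proof.
move=> mh; split.
  apply: (@measurableT_comp _ _ _ _ _ _ (@cos R) _ h) => //.
  by apply: continuous_measurable_fun; exact: continuous_cos.
apply: (@measurableT_comp _ _ _ _ _ _ (@sin R) _ h) => //.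
by apply: continuous_measurable_fun; exact: continuous_sin.
Qed.

End MeasurableC.

Section IntegralC.
Context (R : realType).
Notation mu := (@lebesgue_measure R).
Implicit Types (f g : R -> R[i]) (h p : R -> R).

Definition rint h := mu.-integrable setT (EFin \o h).

Lemma rint_measurable h : rint h -> measurable_fun setT h.
Proof. by move=> /integrableP[/measurable_EFinP]. Qed.

Lemma rint_le h p : measurable_fun setT h -> rint p ->
  (forall x, `|h x| <= p x) -> rint h.
Proof.
move=> mh ip hp; apply: (le_integrable measurableT _ _ ip).
  exact/measurable_EFinP.
by move=> x _; rewrite /= lee_fin (le_trans (hp x))// ler_norm.
Qed.

Lemma rintD h p : rint h -> rint p -> rint (fun x => h x + p x).
Proof. by move=> ih ip; exact: (integrableD measurableT ih ip). Qed.

Lemma rintZ c h : rint h -> rint (fun x => c * h x).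
Proof. by move=> ih; exact: (integrableZl measurableT c ih). Qed.

Lemma integrableC_mC f : integrableC f -> mC f.
Proof. by move=> [/rint_measurable f1 /rint_measurable f2]. Qed.

Lemma integrableC_dom f p : mC f -> rint p -> (forall x, c1 (f x) <= p x) ->
  integrableC f.
Proof.
move=> [f1 f2] ip fp; split; apply: (rint_le _ ip) => // x.
  exact: le_trans (Re_ler_c1 _) (fp x).
exact: le_trans (Im_ler_c1 _) (fp x).
Qed.

Lemma integrableC_c1 f : integrableC f -> rint (fun x => c1 (f x)).
Proof.
by move=> [f1 f2]; apply: rintD; exact: integrable_norm.
Qed.

Lemma integrableCD f g : integrableC f -> integrableC g ->
  integrableC (fun x => f x + g x).
Proof.
move=> fi gi; apply: (integrableC_dom (p := fun x => c1 (f x) + c1 (g x))).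
- by apply: mCD; exact: integrableC_mC.
- by apply: rintD; exact: integrableC_c1.
- by move=> x; exact: c1D.
Qed.

Lemma integrableCZ z f : integrableC f -> integrableC (fun x => z * f x).
Proof.
move=> fi; apply: (integrableC_dom (p := fun x => c1 z * c1 (f x))).
- by apply: mCM; [exact: mC_cst|exact: integrableC_mC].
- by apply: rintZ; exact: integrableC_c1.
- by move=> x; exact: c1M.
Qed.

Lemma integralCD f g : integrableC f -> integrableC g ->
  integralC (fun x => f x + g x) = integralC f + integralC g.
Proof.
move=> [f1 f2] [g1 g2]; rewrite /integralC.
have <- : (\int[mu]_x complex.Re (f x) + \int[mu]_x complex.Re (g x)) +i*
  (\int[mu]_x complex.Im (f x) + \int[mu]_x complex.Im (g x)) =
  (\int[mu]_x complex.Re (f x))%R +i* (\int[mu]_x complex.Im (f x))%R +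
  ((\int[mu]_x complex.Re (g x))%R +i* (\int[mu]_x complex.Im (g x))%R) by [].
rewrite -!RintegralD//; congr (_ +i* _); apply: eq_Rintegral => x _;
  by case: (f x) (g x) => ? ? [].
Qed.

Lemma integralCZ z f : integrableC f ->
  integralC (fun x => z * f x) = z * integralC f.
Proof.
case: z => a b [f1 f2]; rewrite /integralC; simpc.
rewrite -!RintegralZl//.
rewrite -RintegralB//; try exact: rintZ.
rewrite -RintegralD//; try exact: rintZ.
by congr (_ +i* _); apply: eq_Rintegral => x _; case: (f x).
Qed.

Lemma integralC0 : integralC (fun _ : R => 0) = 0 :> R[i].
Proof. by rewrite /integralC /= !Rintegral_cst// !mul0r. Qed.

Lemma c1_integralC f p : integrableC f -> rint p ->
  (forall x, c1 (f x) <= p x) -> c1 (integralC f) <= \int[mu]_x p x.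
Proof.
move=> [f1 f2] ip fp; rewrite /c1 /integralC /=.
have n1 := integrable_norm f1; have n2 := integrable_norm f2.
rewrite (le_trans (lerD (le_normr_Rintegral measurableT f1)
  (le_normr_Rintegral measurableT f2)))//.
rewrite -RintegralD//; apply: le_Rintegral => //; first exact: rintD.
by move=> x _; exact: fp.
Qed.

Lemma integralC_affine f (c b : R) : c != 0 -> integrableC f ->
  integrableC (fun x => f (c * x + b)) /\
  integralC f = `|c|%:C * integralC (fun x => f (c * x + b)).
Proof.
move=> c0 [f1 f2].
have [i1 e1] := integral_affine b c0 f1; have [i2 e2] := integral_affine b c0 f2.
split => //; rewrite /integralC; simpc.
by rewrite /Rintegral; congr (_ +i* _); rewrite ?e1 ?e2 fineM//;
  exact: integrable_fin_num.
Qed.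

Lemma integralC_shift f (b : R) : integrableC f ->
  integrableC (fun x => f (x + b)) /\ integralC (fun x => f (x + b)) = integralC f.
Proof.
move=> /(@integralC_affine _ 1 b (oner_neq0 _))[].
rewrite normr1 mul1r => + ->.
by rewrite (_ : (fun x => f (1 * x + b)) = (fun x => f (x + b)))//;
  apply/funext => x; rewrite mul1r.
Qed.

Lemma integralC_reflect f (b : R) : integrableC f ->
  integrableC (fun x => f (b - x)) /\ integralC (fun x => f (b - x)) = integralC f.
Proof.
have N1 : (-1 : R) != 0 by rewrite oppr_eq0 oner_eq0.
move=> /(@integralC_affine _ (-1) b N1)[].
rewrite normrN1 mul1r => + ->.
by rewrite (_ : (fun x => f (-1 * x + b)) = (fun x => f (b - x)))//;
  apply/funext => x; rewrite mulN1r addrC.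
Qed.

Lemma Rintegral_cvg (h_ : nat -> R -> R) h p :
  (forall n, measurable_fun setT (h_ n)) -> measurable_fun setT h -> rint p ->
  (forall n x, `|h_ n x| <= p x) -> (forall x, h_ n x @[n --> \oo] --> h x) ->
  \int[mu]_x h_ n x @[n --> \oo] --> \int[mu]_x h x.
Proof.
move=> mh_ mh ip hp hc.
have [||||| ih _ c] := @dominated_convergence _ _ _ mu setT measurableT
   (fun n => EFin \o h_ n) (EFin \o h) (EFin \o p).
- by move=> n; apply/measurable_EFinP; exact: mh_.
- exact/measurable_EFinP.
- by apply: aeW => x _; apply: cvg_EFin; [exact: nearW|exact: hc].
- exact: ip.
- by apply: aeW => x n _; rewrite /= lee_fin.
apply: fine_cvg; rewrite fineK; last exact: integrable_fin_num.
exact: c.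
Qed.

Lemma integralC_cvg (f_ : nat -> R -> R[i]) f p :
  (forall n, mC (f_ n)) -> rint p -> (forall n x, c1 (f_ n x) <= p x) ->
  mC f -> (forall x, c1 (f_ n x - f x) @[n --> \oo] --> (0 : R)) ->
  c1 (integralC (f_ n) - integralC f) @[n --> \oo] --> (0 : R).
Proof.
move=> mf_ ip fp mf fc.
have fRe x : complex.Re (f_ n x) @[n --> \oo] --> complex.Re (f x).
  apply/cvgrPdist_lt => e e0; have /cvgrPdist_lt/(_ e e0) := fc x.
  apply: filterS => n; rewrite sub0r normrN ger0_norm ?c1_ge0//.
  apply: le_lt_trans; rewrite distrC; apply: le_trans (Re_ler_c1 _).
  by case: (f_ n x) (f x) => ? ? [].
have fIm x : complex.Im (f_ n x) @[n --> \oo] --> complex.Im (f x).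
  apply/cvgrPdist_lt => e e0; have /cvgrPdist_lt/(_ e e0) := fc x.
  apply: filterS => n; rewrite sub0r normrN ger0_norm ?c1_ge0//.
  apply: le_lt_trans; rewrite distrC; apply: le_trans (Im_ler_c1 _).
  by case: (f_ n x) (f x) => ? ? [].
have h1 : \int[mu]_x complex.Re (f_ n x) @[n --> \oo] --> \int[mu]_x complex.Re (f x).
  apply: (Rintegral_cvg _ _ ip) => //; [by move=> n; case: (mf_ n)|by case: mf|].
  by move=> n x; exact: le_trans (Re_ler_c1 _) (fp n x).
have h2 : \int[mu]_x complex.Im (f_ n x) @[n --> \oo] --> \int[mu]_x complex.Im (f x).
  apply: (Rintegral_cvg _ _ ip) => //; [by move=> n; case: (mf_ n)|by case: mf|].
  by move=> n x; exact: le_trans (Im_ler_c1 _) (fp n x).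
have norm0 (u : nat -> R) (a : R) : u n @[n --> \oo] --> a ->
    `|u n - a| @[n --> \oo] --> (0 : R).
  move=> ua; rewrite -(@normr0 _ R) -(subrr a); apply: cvg_norm.
  by apply: cvgB => //; exact: cvg_cst.
by have := cvgD (norm0 _ _ h1) (norm0 _ _ h2); rewrite addr0; exact.
Qed.

Lemma integralC_eq0_lim (f_ : nat -> R -> R[i]) f p :
  (forall n, mC (f_ n)) -> rint p -> (forall n x, c1 (f_ n x) <= p x) ->
  mC f -> (forall x, c1 (f_ n x - f x) @[n --> \oo] --> (0 : R)) ->
  (forall n, integralC (f_ n) = 0) -> integralC f = 0.
Proof.
move=> mf_ ip fp mf fc f0; apply: c1_eq0.
have := integralC_cvg mf_ ip fp mf fc.
under eq_fun do rewrite f0 sub0r c1N.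
by move=> /cvg_lim <- //; rewrite lim_cst.
Qed.

End IntegralC.

(** * Fubini's theorem and joint measurability *)

Section Fubini.
Context (R : realType).
Notation mu := (@lebesgue_measure R).
Notation RT := (measurableTypeR R).

Lemma fubini_dominated (f : RT * RT -> R) (p q : R -> R) :
  measurable_fun setT f -> rint p -> rint q ->
  (forall s, 0 <= p s) -> (forall t, 0 <= q t) ->
  (forall z, `|f z| <= p z.1 * q z.2) ->
  [/\ rint (fun s => \int[mu]_t f (s, t)), rint (fun t => \int[mu]_s f (s, t)) &
  \int[mu]_s \int[mu]_t f (s, t) = \int[mu]_t \int[mu]_s f (s, t)].
Proof.
move=> mf ip iq p0 q0 fpq.
have mF : measurable_fun setT (EFin \o f) by exact/measurable_EFinP.
have m1 s : measurable_fun setT (fun t : RT => f (s, t)).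
  exact: (measurableT_comp mf (pair1_measurable s)).
have m2 t : measurable_fun setT (fun s : RT => f (s, t)).
  exact: (measurableT_comp mf (pair2_measurable t)).
have i1 s : rint (fun t => f (s, t)).
  apply: (rint_le (m1 s) (rintZ (p s) iq)) => t; exact: (fpq (s, t)).
have i2 t : rint (fun s => f (s, t)).
  apply: (rint_le (m2 t) (rintZ (q t) ip)) => s.
  by rewrite mulrC; exact: (fpq (s, t)).
have imF : (mu \x mu)%E.-integrable setT (EFin \o f).
  apply/integrable12ltyP => //.
  apply: (@le_lt_trans _ _ (\int[mu]_s ((\int[mu]_t q t) * p s)%:E)%E).
    apply: ge0_le_integral => //.
    - by move=> s _; apply: integral_ge0 => t _; rewrite abse_ge0.
    - apply: (measurable_fun_fubini_tonelli_F (m2 := mu) (fun z => `|(f z)%:E|%E)) => //.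
      by apply: measurableT_comp => //; exact/measurable_EFinP.
    - apply/measurable_EFinP; apply: measurable_funM => //.
      exact: rint_measurable.
    - move=> s _; rewrite EFinM muleC /Rintegral fineK; last exact: integrable_fin_num.
      rewrite -integralZl//.
      apply: ge0_le_integral => //.
      + by apply: measurableT_comp => //; apply/measurable_EFinP; exact: m1.
      + apply/measurable_EFinP; apply: measurable_funM => //.
        exact: rint_measurable.
      + by move=> t _; rewrite /= lee_fin; exact: (fpq (s, t)).
  exact: (integrable_lty measurableT (rintZ (\int[mu]_t q t) ip)).
have FE s : (\int[mu]_t (f (s, t))%:E)%E = (\int[mu]_t f (s, t))%:E.
  by rewrite fineK//; exact: (integrable_fin_num measurableT (i1 s)).
have GE t : (\int[mu]_s (f (s, t))%:E)%E = (\int[mu]_s f (s, t))%:E.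
  by rewrite fineK//; exact: (integrable_fin_num measurableT (i2 t)).
split.
- have := integrable_fubini_F imF; rewrite /fubini_F /=.
  by under eq_fun do rewrite FE.
- apply: (rint_le (p := fun t => (\int[mu]_s p s) * q t)); last 2 first.
  + exact: rintZ.
  + move=> t; rewrite (le_trans (le_normr_Rintegral measurableT (i2 t)))//.
    rewrite mulrC -RintegralZl//; apply: le_Rintegral => //.
    * exact: integrable_norm (i2 t).
    * exact: (rintZ (q t) ip).
    * by move=> s _; rewrite mulrC; exact: (fpq (s, t)).
  have := measurable_fubini_G imF; rewrite /fubini_G /=.
  under eq_fun do rewrite GE.
  by move=> /measurable_EFinP.
have := Fubini imF => /=.
under eq_integral do rewrite FE.
under [in X in _ = X -> _]eq_integral do rewrite GE.
by rewrite [in X in _ -> X = _]/Rintegral [in X in _ -> _ = X]/Rintegral => ->.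
Qed.

Lemma fubiniC (F : RT * RT -> R[i]) (p q : R -> R) :
  mC F -> rint p -> rint q -> (forall s, 0 <= p s) -> (forall t, 0 <= q t) ->
  (forall z, c1 (F z) <= p z.1 * q z.2) ->
  [/\ integrableC (fun s => integralC (fun t => F (s, t))),
      integrableC (fun t => integralC (fun s => F (s, t))) &
  integralC (fun s => integralC (fun t => F (s, t))) =
  integralC (fun t => integralC (fun s => F (s, t)))].
Proof.
move=> [mF1 mF2] ip iq p0 q0 Fpq.
have [//|a1 b1 e1] := fubini_dominated mF1 ip iq p0 q0.
  by move=> z; exact: le_trans (Re_ler_c1 _) (Fpq z).
have [//|a2 b2 e2] := fubini_dominated mF2 ip iq p0 q0.
  by move=> z; exact: le_trans (Im_ler_c1 _) (Fpq z).
split; [by split|by split|].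
by congr (_ +i* _).
Qed.

Lemma mC_pair2 (F : RT * RT -> R[i]) (t : R) : mC F -> mC (fun s : RT => F (s, t)).
Proof.
move=> [F1 F2]; split.
  exact: (measurableT_comp F1 (pair2_measurable t)).
exact: (measurableT_comp F2 (pair2_measurable t)).
Qed.

Lemma mC_continuous (f : R -> R[i]) :
  (continuous (fun t : R => complex.Re (f t) : R)) ->
  (continuous (fun t : R => complex.Im (f t) : R)) -> mC (f : RT -> R[i]).
Proof. by move=> f1 f2; split; exact: continuous_measurable_fun. Qed.

(** Rounding s down to a multiple of 1/(n + 1) leaves, on each strip, a measurable function of t
    alone; continuity in s makes these functions converge. *)
Lemma measurable_caratheodory (f : RT -> RT -> R) :
  (forall t, continuous (f ^~ t : R -> R)) ->
  (forall s, measurable_fun setT (f s)) ->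
  measurable_fun setT (fun z : RT * RT => f z.1 z.2).
Proof.
move=> cf mf.
pose h (n : nat) (z : RT * RT) : R :=
  f ((Num.floor (n.+1%:R * z.1))%:~R / n.+1%:R) z.2.
apply: (@measurable_fun_cvg _ _ _ setT h).
- move=> n.
  (* The strips are indexed by integers and enumerated by [nat] through [unpickle]; a number that
     codes no integer gets the empty set. *)
  pose E (i : nat) : set (RT * RT) := if @unpickle int i is Some k then
    [set z | k%:~R <= n.+1%:R * z.1 < (k + 1)%:~R] else set0.
  have mE i : measurable (E i).
    rewrite /E; case: (unpickle i) => [k|]; last exact: measurable0.
    have mg : measurable_fun setT (fun z : RT * RT => n.+1%:R * z.1 : RT).
      by apply: measurable_funM => //; exact: measurable_fst.
    have := mg measurableT [set` `[(k%:~R : R), (k + 1)%:~R[] (measurable_itv _).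
    by rewrite setTI; exact.
  have UE : \bigcup_i E i = setT.
    apply/seteqP; split => // z _; exists (pickle (Num.floor (n.+1%:R * z.1))) => //.
    by rewrite /E pickleK /= floor_itv.
  rewrite -UE; apply: (measurable_fun_bigcup (h n) mE).2 => i.
  rewrite /E; case: (unpickle i) => [k|]; last exact: measurable_fun_set0.
  apply: (@eq_measurable_fun _ _ _ _ _ (fun z => f (k%:~R / n.+1%:R) z.2)).
    move=> z; rewrite inE => kz; rewrite /h.
    by rewrite (floor_def kz).
  apply: measurable_funTS.
  exact: (measurableT_comp (mf _) measurable_snd).
- move=> [s t] _ /=.
  have sn : (Num.floor (n.+1%:R * s))%:~R / n.+1%:R @[n --> \oo] --> s.
    apply/cvgrPdist_lt => e e0; near=> n.
    have n0 : (0 : R) < n.+1%:R by [].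
    have /andP[f1 f2] := floor_itv (n.+1%:R * s).
    have -> : s - (Num.floor (n.+1%:R * s))%:~R / n.+1%:R =
        (n.+1%:R * s - (Num.floor (n.+1%:R * s))%:~R) / n.+1%:R.
      by rewrite mulrBl mulrAC mulfV ?mul1r// gt_eqF.
    rewrite ger0_norm ?divr_ge0// ?subr_ge0//.
    rewrite ltr_pdivrMr//; move: f2; rewrite intrD => f2.
    have : 1 < e * n.+1%:R.
      rewrite -ltr_pdivrMr// div1r.
      near: n; exact: near_infty_natSinv_lt (PosNum e0).
    by move: f2; lra.
  exact: (cvg_comp _ _ sn (cf t s)).
Unshelve. all: by end_near. Qed.

Lemma mC_caratheodory (F : R -> R -> R[i]) :
  (forall t, continuous (fun s => complex.Re (F s t) : R)) ->
  (forall t, continuous (fun s => complex.Im (F s t) : R)) ->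
  (forall s, mC (F s : RT -> R[i])) -> mC (fun z : RT * RT => F z.1 z.2).
Proof.
move=> c1 c2 mF; split.
  by apply: (measurable_caratheodory (f := fun s t => complex.Re (F s t))) => // s;
    case: (mF s).
by apply: (measurable_caratheodory (f := fun s t => complex.Im (F s t))) => // s;
  case: (mF s).
Qed.

End Fubini.

(** * Polynomial weights *)

Section Weights.
Context (R : realType).
Notation mu := (@lebesgue_measure R).

(** This weight is submultiplicative with constant 1, so a translation by a costs at most the factor
    [W a], for growth and for decay alike. *)
Definition W (t : R) : R := 1 + `|t|.

Lemma W_ge1 t : 1 <= W t. Proof. by rewrite lerDl. Qed.

Lemma W_gt0 t : 0 < W t. Proof. by rewrite (lt_le_trans ltr01)// W_ge1. Qed.

Lemma W_ge0 t : 0 <= W t. Proof. exact: ltW (W_gt0 t). Qed.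

Lemma WD s t : W (s + t) <= W s * W t.
Proof.
rewrite /W mulrDl mul1r mulrDr mulr1 (le_trans (lerD (lexx _) (ler_normD _ _)))//.
by rewrite addrA addrACA addrC -subr_ge0; have := mulr_ge0 (normr_ge0 s) (normr_ge0 t); lra.
Qed.

Lemma WN t : W (- t) = W t. Proof. by rewrite /W normrN. Qed.

Lemma measurable_W : measurable_fun setT W.
Proof. by apply: measurable_funD => //. Qed.

Lemma continuous_W : continuous (W : R -> R).
Proof.
move=> t; apply: cvgD; first exact: cvg_cst.
by apply: cvg_norm; exact: cvg_id.
Qed.

Lemma continuous_WV m : continuous (fun t => (W t)^-1 ^+ m : R).
Proof.
move=> t; apply: (@continuous_comp _ _ _ (fun t => (W t)^-1) (fun x => x ^+ m)).
  by apply: cvgV; [rewrite gt_eqF// W_gt0|exact: continuous_W].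
exact: exprn_continuous.
Qed.

Lemma rint_oneDsqrV : rint (fun t : R => (1 + t ^+ 2)^-1).
Proof.
apply/integrableP; split.
  apply/measurable_EFinP; apply: continuous_measurable_fun.
  exact: continuous_oneDsqrV.
under eq_integral do rewrite gee0_abs ?lee_fin ?invr_ge0 ?addr_ge0 ?sqr_ge0//.
rewrite ge0_symfun_integralT.
- have := @integral0y_oneDsqr R.
  rewrite set_itvcy => ->.
  by rewrite -EFinM ltry.
- by move=> x; rewrite invr_ge0 addr_ge0 ?sqr_ge0.
- exact: continuous_oneDsqrV.
- by move=> x /=; rewrite sqrrN.
Qed.

Lemma rint_W m : (2 <= m)%N -> rint (fun t => (W t)^-1 ^+ m).
Proof.
move=> m2; apply: rint_le rint_oneDsqrV _.
  apply: continuous_measurable_fun; exact: continuous_WV.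
move=> t; rewrite ger0_norm ?exprn_ge0 ?invr_ge0 ?W_ge0//.
rewrite (le_trans (y := (W t)^-1 ^+ 2))//.
  by rewrite ler_wiXn2l ?invr_ge0 ?W_ge0// invf_le1 ?W_gt0 ?W_ge1.
rewrite exprVn lef_pV2 ?posrE ?exprn_gt0 ?W_gt0 ?ltr_pwDl ?sqr_ge0//.
rewrite /W sqrrD expr1n mul1r real_normK ?num_real//.
by have := normr_ge0 t; lra.
Qed.
End Weights.

(** * Band-limited functions *)

Section Bands.
Context (R : realType).
Notation mu := (@lebesgue_measure R).
Implicit Types (k l : nat -> R -> R) (b : R) (m : nat).

(* The bound on all derivatives says that k 0 extends to an entire function of
   exponential type b, so that its Fourier transform lives on [-b, b]. *)
Definition band b m k := (forall n (x : R), is_derive x (1 : R) (k n) (k n.+1 x)) /\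
  exists K, forall n t, `|k n t| <= K * b ^+ n * (W t)^-1 ^+ m.

Lemma band_bound b m k : band b m k -> exists2 K, 0 <= K &
  forall n t, `|k n t| <= K * b ^+ n * (W t)^-1 ^+ m.
Proof.
move=> [_ [K kK]]; exists K => //.
have := kK 0%N 0; rewrite expr0 mulr1 /W normr0 addr0 invr1 expr1n mulr1.
exact: le_trans.
Qed.

Lemma WV_ge0 (t : R) m : 0 <= (W t)^-1 ^+ m.
Proof. by rewrite exprn_ge0// invr_ge0 W_ge0. Qed.

Lemma WV_le1 (t : R) : (W t)^-1 <= 1.
Proof. by rewrite invf_le1 ?W_gt0 ?W_ge1. Qed.

Lemma band_mono b b' m m' k : 0 <= b -> b <= b' -> (m' <= m)%N ->
  band b m k -> band b' m' k.
Proof.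
move=> b0 bb mm bk; have [K K0 kK] := band_bound bk; split; first by case: bk.
exists K => n t; apply: (le_trans (kK n t)).
apply: ler_pM; rewrite ?WV_ge0 ?mulr_ge0 ?exprn_ge0//.
  by rewrite ler_wpM2l// lerXn2r ?nnegrE ?(le_trans b0).
by rewrite ler_wiXn2l ?invr_ge0 ?W_ge0 ?WV_le1.
Qed.

Lemma band_continuous b m k n : band b m k -> continuous (k n).
Proof.
move=> [dk _] x; apply: differentiable_continuous.
by apply/derivable1_diffP; have [] := dk n x.
Qed.

Lemma WVM (x y : R) : (W (x * y)) <= W x * W y.
Proof.
rewrite /W normrM; have := normr_ge0 x; have := normr_ge0 y.
by rewrite mulrDl mul1r mulrDr mulr1; lra.
Qed.

Lemma WV_shift (s t : R) : (W (t + s))^-1 <= W s * (W t)^-1.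
Proof.
rewrite ler_pdivlMr ?W_gt0// mulrC ler_pdivrMr ?W_gt0// mulrC.
have := WD (t + s) (- s); rewrite addrK WN.
by rewrite mulrC.
Qed.

Lemma WV_affine (c d t : R) : c != 0 ->
  (W (c * t + d))^-1 <= W c^-1 * W (d / c) * (W t)^-1.
Proof.
move=> c0; rewrite ler_pdivlMr ?W_gt0// mulrC ler_pdivrMr ?W_gt0//.
have tE : t = c^-1 * (c * t + d) - d / c.
  by rewrite mulrDr mulrA mulVf// mul1r [d / c]mulrC addrK.
rewrite {1}tE (le_trans (WD _ _))// WN mulrAC ler_wpM2r ?W_ge0//.
by rewrite WVM.
Qed.

Lemma is_derive_affine (c d x : R) :
  is_derive x (1 : R) (fun t : R => c * t + d) c.
Proof.
have h := is_deriveD (is_deriveZ c (is_derive_id x (1 : R)))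
  (is_derive_cst d x (1 : R)).
by rewrite addr0 [c *: 1]mulr1 in h.
Qed.

Lemma is_derive_mul (f g : R -> R) (x a b : R) : is_derive x (1 : R) f a ->
  is_derive x (1 : R) g b -> is_derive x (1 : R) (fun t => f t * g t) (a * g x + f x * b).
Proof.
move=> df dg; have := is_deriveM df dg.
by rewrite [_ *: b + _]addrC [g x *: a]mulrC.
Qed.

Lemma is_derive_scale (c : R) (f : R -> R) (x a : R) : is_derive x (1 : R) f a ->
  is_derive x (1 : R) (fun t => c * f t) (c * a).
Proof. exact: is_deriveZ. Qed.

Lemma is_derive_under_integral (f f' : R -> R -> R) (B : set R) (a : R) (G : R -> R) :
  measurable B ->
  (forall x, a - 1 < x < a + 1 -> mu.-integrable B (EFin \o f x)) ->
  (forall x y, is_derive x (1 : R) (f ^~ y) (f' x y)) ->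
  (forall y, 0 <= G y) -> mu.-integrable B (EFin \o G) ->
  (forall x y, a - 1 < x < a + 1 -> B y -> `|f' x y| <= G y) ->
  is_derive a (1 : R) (fun x => \int[mu]_(y in B) f x y) (\int[mu]_(y in B) f' a y).
Proof.
move=> mB intf df G0 iG fG.
have pE : partial1of2 f = f'.
  by apply/funext => x; apply/funext => y; rewrite partial1of2E; exact: derive_val.
have Ia : [set` `]a - 1, a + 1[] a by rewrite /= in_itv /=; lra.
have i1 x : [set` `]a - 1, a + 1[] x -> mu.-integrable B (EFin \o f x).
  by rewrite /= in_itv /=; exact: intf.
have i2 x y : [set` `]a - 1, a + 1[] x -> B y -> derivable (f ^~ y) x 1.
  by move=> _ _; exact: ex_derive.
have i3 x y : [set` `]a - 1, a + 1[] x -> B y -> `|partial1of2 f x y| <= G y.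
  by rewrite /= in_itv /= pE; exact: fG.
have dF := @derivable_under_integral R _ _ mu f B mB a _ _ Ia i1 i2 G G0 iG i3.
apply: (DeriveDef dF).
rewrite -derive1E (@differentiation_under_integral R _ _ mu f B mB a _ _ Ia i1 i2 G G0 iG i3).
by apply: eq_Rintegral => y _; rewrite pE.
Qed.

Lemma band_affine b m k (c d : R) : c != 0 -> band b m k ->
  band (`|c| * b) m (fun n t => c ^+ n * k n (c * t + d)).
Proof.
move=> c0 bk; have [K K0 kK] := band_bound bk; split.
  move=> n x.
  have := is_deriveZ (c ^+ n) (@is_derive1_comp R (k n) (fun t => c * t + d) x _ c
    (bk.1 n (c * x + d)) (is_derive_affine c d x)).
  by rewrite [_ *: _](_ : _ = c ^+ n.+1 * k n.+1 (c * x + d)) // /GRing.scale /= exprSr; ring.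
exists (K * (W c^-1 * W (d / c)) ^+ m) => n t.
rewrite normrM normrX [(`|c| * b) ^+ n]exprMn.
rewrite (le_trans (y := `|c| ^+ n * (K * b ^+ n * (W (c * t + d))^-1 ^+ m)))//.
  by rewrite ler_wpM2l ?exprn_ge0.
have -> : K * (W c^-1 * W (d / c)) ^+ m * (`|c| ^+ n * b ^+ n) * (W t)^-1 ^+ m =
   `|c| ^+ n * (K * b ^+ n * (W c^-1 * W (d / c) * (W t)^-1) ^+ m).
  by rewrite [in RHS]exprMn; ring.
(* [b] is not assumed nonnegative; the bound at t = 0 shows that [K * b ^+ n] is. *)
have [n0|nN] := boolP (0 <= K * b ^+ n).
  rewrite ler_wpM2l ?exprn_ge0//  ler_wpM2l// lerXn2r ?nnegrE ?invr_ge0 ?W_ge0//.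
    by rewrite !mulr_ge0 ?invr_ge0 ?W_ge0.
  exact: WV_affine.
exfalso; move: nN; rewrite -ltNge.
have := le_trans (normr_ge0 _) (kK n 0).
by rewrite /W normr0 addr0 invr1 expr1n mulr1 leNgt => /negbTE ->.
Qed.

Lemma band_mul b b' m m' k l : band b m k -> band b' m' l ->
  band (b + b') (m + m')
    (fun n t => \sum_(i < n.+1) ('C(n, i)%:R * k i t * l (n - i)%N t)).
Proof.
move=> bk bl; have [K K0 kK] := band_bound bk; have [L L0 lL] := band_bound bl.
split.
  move=> n x.
  have d : is_derive x (1 : R)
      (\sum_(i < n.+1) (fun t => 'C(n, i)%:R * k i t * l (n - i)%N t))
      (\sum_(i < n.+1) ('C(n, i)%:R * (k i.+1 x * l (n - i)%N x + k i x * l (n - i).+1 x))).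
    apply: is_derive_sum => i.
    apply: (is_derive_eq (is_derive_mul (is_derive_scale 'C(n, i)%:R (bk.1 i x))
      (bl.1 (n - i)%N x))).
    by ring.
  rewrite (_ : (fun t => _) = \sum_(i < n.+1) (fun t => 'C(n, i)%:R * k i t * l (n - i)%N t)); last first.
    by apply/funext => t; rewrite fct_sumE.
  apply: (is_derive_eq d).
  under eq_bigr do rewrite mulrDr.
  rewrite big_split /= [RHS]big_ord_recl /= bin0 subn0.
  under [X in _ = _ + X]eq_bigr do rewrite /bump /= add1n binS natrD !mulrDl subSS.
  rewrite big_split /= [X in _ = _ + (X + _)]big_ord_recr /= bin_small ?mul0r ?addr0//.
  rewrite [X in _ + X = _]big_ord_recl /= bin0 subn0 [RHS]addrA [RHS]addrC.
  congr (_ + _).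
    by apply: eq_bigr => i _; rewrite mulrA.
  rewrite mulrA; congr (_ + _); apply: eq_bigr => i _.
  by rewrite /bump /= !add1n subnSK ?ltn_ord// mulrA.
exists (K * L) => n t.
rewrite exprDn mulr_sumr mulr_suml (le_trans (ler_norm_sum _ _ _))//.
rewrite [X in _ <= X](reindex_inj rev_ord_inj) /=.
apply: ler_sum => i _; rewrite !normrM normr_nat.
have -> : (n - (n.+1 - i.+1))%N = i by rewrite subSS subKn// -ltnS.
rewrite subSS bin_sub ?leq_ord// -[X in _ <= _ * X * _]mulr_natl exprD.
rewrite (le_trans (ler_pM _ _ (ler_wpM2l _ (kK i t)) (lL (n - i)%N t)))// ?mulr_ge0//.
by rewrite le_eqVlt; apply/orP; left; apply/eqP; ring.
Qed.

Lemma band_cos (w th : R) :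
  band `|w| 0 (fun n t => w ^+ n * cos (w * t + th + n%:R * (pi / 2))).
Proof.
split.
  move=> n x.
  have a := is_derive_affine w (th + n%:R * (pi / 2)) x.
  have := is_deriveZ (w ^+ n) (@is_derive1_comp R cos (fun t => w * t + (th + n%:R * (pi / 2))) x _ w
    (is_derive_cos (w * x + (th + n%:R * (pi / 2)))) a).
  have -> : (w ^+ n \*: (cos \o (fun t : R => w * t + (th + n%:R * (pi / 2))))) =
    (fun t => w ^+ n * cos (w * t + th + n%:R * (pi / 2))).
    by apply/funext => t /=; rewrite addrA.
  rewrite [X in is_derive _ _ _ X](_ : _ = w ^+ n.+1 * cos (w * x + th + n.+1%:R * (pi / 2)))//.
  have -> : n.+1%:R * (pi / 2) = n%:R * (pi / 2) + pi / 2 :> R.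
    by rewrite -natr1 mulrDl mul1r.
  by rewrite !addrA cosDpihalf /GRing.scale /= exprSr; ring.
exists 1 => n t; rewrite mul1r expr0 mulr1 normrM normrX ler_piMr ?exprn_ge0//.
exact: cos_max.
Qed.

Definition isband b m (h : R -> R) := exists2 k, band b m k & k 0%N = h.

Lemma isband_mono b b' m m' h : 0 <= b -> b <= b' -> (m' <= m)%N ->
  isband b m h -> isband b' m' h.
Proof. by move=> b0 bb mm [k bk <-]; exists k => //; exact: band_mono bk. Qed.

Lemma isband_affine b m h (c d : R) : c != 0 -> isband b m h ->
  isband (`|c| * b) m (fun t => h (c * t + d)).
Proof.
move=> c0 [k bk <-]; exists (fun n t => c ^+ n * k n (c * t + d)).
  exact: band_affine.
by apply/funext => t; rewrite expr0 mul1r.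
Qed.

Lemma isband_mul b b' m m' h h' : isband b m h -> isband b' m' h' ->
  isband (b + b') (m + m') (fun t => h t * h' t).
Proof.
move=> [k bk <-] [l bl <-].
exists (fun n t => \sum_(i < n.+1) ('C(n, i)%:R * k i t * l (n - i)%N t)).
  exact: band_mul.
by apply/funext => t; rewrite big_ord1 bin0 mul1r.
Qed.

Lemma isband_cos (w th : R) : isband `|w| 0 (fun t => cos (w * t + th)).
Proof.
exists (fun n t => w ^+ n * cos (w * t + th + n%:R * (pi / 2))).
  exact: band_cos.
by apply/funext => t; rewrite mul0r addr0 mul1r.
Qed.

Lemma isband_sin (w : R) : isband `|w| 0 (fun t => sin (w * t)).
Proof.
have := isband_cos w (- (pi / 2)).
suff -> : (fun t => cos (w * t + - (pi / 2))) = (fun t => sin (w * t)) by [].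
by apply/funext => t; rewrite cosBpihalf.
Qed.

Lemma isband_bound b m h : isband b m h ->
  exists2 K, 0 <= K & forall t, `|h t| <= K * (W t)^-1 ^+ m.
Proof.
move=> [k /band_bound[K K0 kK] <-]; exists K => // t.
by have := kK 0%N t; rewrite expr0 mulr1.
Qed.

Lemma isband_continuous b m h : isband b m h -> continuous h.
Proof. by move=> [k bk <-]; exact: band_continuous bk. Qed.

(** The n-th derivative of sin t / t, written as the integral of cos(s t) over [0, 1], which is
    smooth at 0 and displays the band 1. The summand 0 is the phase [th] of [band_cos], which
    provides the derivative of the integrand. *)
Definition sincn n (t : R) : R :=
  \int[mu]_(s in [set` `[(0 : R), 1]]) (s ^+ n * cos (s * t + 0 + n%:R * (pi / 2))).

Lemma sincn_integrable n t : mu.-integrable [set` `[(0 : R), 1]]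
  (EFin \o (fun s : R => s ^+ n * cos (s * t + 0 + n%:R * (pi / 2)))).
Proof.
apply: continuous_compact_integrable; first exact: segment_compact.
apply: continuous_subspaceT => s.
have cc : continuous (fun s : R => cos (t * s + (0 + n%:R * (pi / 2)))).
  move=> u; apply: (@continuous_comp _ _ _
    (fun s : R => t * s + (0 + n%:R * (pi / 2))) (@cos R)).
    by apply: differentiable_continuous; apply/derivable1_diffP;
      have [] := is_derive_affine t (0 + n%:R * (pi / 2)) u.
  exact: continuous_cos.
have -> : (fun s : R => s ^+ n * cos (s * t + 0 + n%:R * (pi / 2))) =
  (fun s : R => s ^+ n) \* (fun s : R => cos (t * s + (0 + n%:R * (pi / 2)))).
  by apply/funext => u /=; rewrite mulrC addrA (mulrC u t) mulrC.
by apply: continuousM; [exact: exprn_continuous|exact: cc].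
Qed.

Lemma is_derive_sincn n x : is_derive x (1 : R) (sincn n) (sincn n.+1 x).
Proof.
apply: (@is_derive_under_integral
  (fun x s => s ^+ n * cos (s * x + 0 + n%:R * (pi / 2)))
  (fun x s => s ^+ n.+1 * cos (s * x + 0 + n.+1%:R * (pi / 2)))
  [set` `[(0 : R), 1]] x (fun=> 1)) => //.
- by move=> y _; exact: sincn_integrable.
- by move=> y s; exact: (band_cos s 0).1.
- apply: continuous_compact_integrable; first exact: segment_compact.
  by apply: continuous_subspaceT => s; exact: cvg_cst.
- move=> y s _; rewrite /= in_itv /= => /andP[s0 s1].
  rewrite normrM normrX mulr_ile1// ?exprn_ile1//; try by rewrite ger0_norm.
  exact: cos_max.
Qed.

Lemma Rintegral01_1 : \int[mu]_(s in [set` `[(0 : R), 1]]) (1 : R) = 1.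
Proof.
have m01 : mu [set` `[(0 : R), 1]] = 1%E.
  by rewrite lebesgue_measure_itv /= lte_fin ltr01 oppr0 adde0.
rewrite Rintegral_cst; last exact: measurable_itv.
by rewrite mul1r; exact: (congr1 fine m01).
Qed.

Lemma sincn_le1 n t : `|sincn n t| <= 1.
Proof.
rewrite (le_trans (le_normr_Rintegral _ (sincn_integrable n t)))//.
have i1 : mu.-integrable [set` `[(0 : R), 1]] (EFin \o (fun=> 1 : R)).
  apply: continuous_compact_integrable; first exact: segment_compact.
  by apply: continuous_subspaceT => s; exact: cvg_cst.
rewrite (le_trans (y := \int[mu]_(s in [set` `[(0 : R), 1]]) 1))//.
  apply: le_Rintegral => //; first exact: integrable_norm (sincn_integrable n t).
  move=> s; rewrite /= in_itv /= => /andP[s0 s1].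
  rewrite normrM normrX mulr_ile1// ?exprn_ile1//; try by rewrite ger0_norm.
  exact: cos_max.
by rewrite Rintegral01_1.
Qed.

Definition sinc := sincn 0.

Lemma sinc_sin t : t * sinc t = sin t.
Proof.
have cf : continuous (fun s : R => t * cos (s * t)).
  move=> s; apply: continuousM; first exact: cvg_cst.
  apply: (@continuous_comp _ _ _ (fun s : R => s * t) (@cos R)).
    by apply: continuousM; [exact: cvg_id|exact: cvg_cst].
  exact: continuous_cos.
have dF s : is_derive s (1 : R) (fun s => sin (s * t)) (t * cos (s * t)).
  have h := is_derive_affine t 0 s.
  have := @is_derive1_comp R sin (fun s => t * s + 0) s _ t (is_derive_sin (t * s + 0)) h.
  have -> : (sin \o (fun s => t * s + 0)) = (fun s => sin (s * t)).
    by apply/funext => z /=; rewrite addr0 mulrC.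
  by move=> h2; apply: (is_derive_eq h2); rewrite addr0 (mulrC t s) [LHS]mulrC.
have cF : continuous (fun s : R => sin (s * t)).
  move=> s; apply: differentiable_continuous.
  by apply/derivable1_diffP; have [] := dF s.
have := @continuous_FTC2 R (fun s => t * cos (s * t)) (fun s => sin (s * t)) 0 1 ltr01 => FTC.
have mI : measurable ([set` `[(0 : R), 1]] : set (measurableTypeR R)) by exact: measurable_itv.
rewrite -[LHS](RintegralZl t mI (sincn_integrable 0 t)).
rewrite (eq_Rintegral mu (g := fun s => t * cos (s * t))); last first.
  by move=> s _; rewrite expr0 mul1r mul0r !addr0.
rewrite /Rintegral FTC//=; first by rewrite mul1r mul0r sin0 oppr0 addr0.
- exact: continuous_subspaceT.
- split.
  + by move=> s _; have [] := dF s.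
  + by apply: cvg_at_right_filter; exact: cF.
  + by apply: cvg_at_left_filter; exact: cF.
- by move=> s _; rewrite derive1E; exact: derive_val.
Qed.

Lemma sinc0 : sinc 0 = 1.
Proof.
rewrite /sinc /sincn (eq_Rintegral mu (g := fun=> 1)).
  by rewrite Rintegral01_1.
by move=> s _; rewrite expr0 mul1r mulr0 mul0r !addr0 cos0.
Qed.

(** Differentiating t sinc t = sin t n times gives t sinc^(n) + n sinc^(n-1) = sin^(n). Here [q n]
    is the n-th derivative of the sine, a cosine with phase -pi/2. *)
Lemma sincn_decay n t : `|t * sincn n t| <= n%:R + 1.
Proof.
pose q n (t : R) := 1 ^+ n * cos (1 * t + - (pi / 2) + n%:R * (pi / 2)) : R.
have qE m u : u * sincn m u + m%:R * sincn m.-1 u = q m u.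
  elim: m u => [|m IH] u.
    rewrite mul0r addr0 sinc_sin /q mul1r mul0r addr0 mul1r.
    by rewrite cosBpihalf.
  have d1 : is_derive u (1 : R) (fun t => t * sincn m t + m%:R * sincn m.-1 t)
      (u * sincn m.+1 u + m.+1%:R * sincn m u).
    have d := is_deriveD (is_derive_mul (is_derive_id u (1 : R)) (is_derive_sincn m u))
      (is_derive_scale m%:R (is_derive_sincn m.-1 u)).
    apply: (is_derive_eq d); rewrite mul1r.
    case: m {IH d} => [|m] /=; first by rewrite !mul0r; ring.
    by rewrite -[in RHS]natr1; ring.
  have d2 : is_derive u (1 : R) (q m) (q m.+1 u) := (band_cos 1 (- (pi / 2))).1 m u.
  have qE : (fun t => t * sincn m t + m%:R * sincn m.-1 t) = q m.
    by apply/funext.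
  rewrite qE in d1.
  by rewrite -(@derive_val _ _ _ _ _ _ _ d1) -(@derive_val _ _ _ _ _ _ _ d2).
have -> : t * sincn n t = q n t - n%:R * sincn n.-1 t by rewrite -qE addrK.
rewrite (le_trans (ler_normB _ _))// addrC lerD//.
  by rewrite normrM normr_nat ler_piMr// sincn_le1.
by rewrite /q expr1n mul1r cos_max.
Qed.

(** The factor n + 1 of [sincn_decay] prevents the band 1 with weight 1. For b > 1 it is absorbed in
    b^n by Bernoulli's inequality, and the constant 2 + 1/(b - 1) is what makes its product with 1 +
    n (b - 1) at least n + 2. *)
Lemma isband_sinc b : 1 < b -> isband b 1 sinc.
Proof.
move=> b1; exists sincn => //; split; first exact: is_derive_sincn.
have e0 : 0 < b - 1 by rewrite subr_gt0.
exists (2 + (b - 1)^-1) => n t.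
have bern : 1 + n%:R * (b - 1) <= b ^+ n.
  elim: n => [|n IH]; first by rewrite mul0r addr0 expr0.
  rewrite exprS (le_trans _ (ler_wpM2l (ltW (lt_trans ltr01 b1)) IH))//.
  rewrite -natr1; have : 0 <= n%:R * (b - 1) ^+ 2 by rewrite mulr_ge0// sqr_ge0.
  by nra.
rewrite expr1 ler_pdivlMr ?W_gt0//.
rewrite (le_trans (y := n%:R + 2))//.
  rewrite /W mulrDr mulr1 mulrC -normrM.
  by have := sincn_decay n t; have := sincn_le1 n t; rewrite mulrC; lra.
rewrite (le_trans (y := (2 + (b - 1)^-1) * (1 + n%:R * (b - 1))))//.
  have -> : (2 + (b - 1)^-1) * (1 + n%:R * (b - 1)) =
    n%:R + 2 + ((b - 1)^-1 + 2 * (n%:R * (b - 1))).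
    by field; rewrite gt_eqF.
  by rewrite lerDl addr_ge0 ?invr_ge0 ?mulr_ge0// ltW.
by rewrite ler_wpM2l// addr_ge0 ?invr_ge0// ltW.
Qed.

Lemma isband_sincX (c b : R) M : 0 < c -> 1 < b ->
  isband (M%:R * (c * b)) M (fun t => sinc (c * t) ^+ M).
Proof.
move=> c0 b1; elim: M => [|M IH].
  rewrite mul0r; have := isband_cos 0 0; rewrite normr0.
  suff -> : (fun t : R => cos (0 * t + 0)) = (fun t => sinc (c * t) ^+ 0) by [].
  by apply/funext => t; rewrite mul0r addr0 cos0 expr0.
have s1 := isband_affine 0 (lt0r_neq0 c0) (isband_sinc b1).
have := isband_mul s1 IH.
rewrite gtr0_norm// add1n.
have -> : c * b + M%:R * (c * b) = M.+1%:R * (c * b) by rewrite -natr1; ring.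
suff -> : (fun t => sinc (c * t + 0) * sinc (c * t) ^+ M) =
  (fun t => sinc (c * t) ^+ M.+1) by [].
by apply/funext => t; rewrite addr0 exprS.
Qed.

End Bands.

(** * Correlation of polynomially bounded functions with band-limited ones *)

Section Convolution.
Context (R : realType).
Notation mu := (@lebesgue_measure R).
Implicit Types (phi f : R -> R[i]) (k : nat -> R -> R) (h : R -> R).

Definition growth phi (C : R) (N : nat) :=
  mC (phi : measurableTypeR R -> R[i]) /\ forall t, c1 (phi t) <= C * W t ^+ N.

Lemma growth_ge0 phi C N : growth phi C N -> 0 <= C.
Proof.
move=> [_ /(_ 0)]; rewrite /W normr0 addr0 expr1n mulr1.
exact: le_trans (c1_ge0 _).
Qed.

Lemma WX_WV (N m : nat) (t : R) : (N <= m)%N ->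
  W t ^+ N * (W t)^-1 ^+ m = (W t)^-1 ^+ (m - N).
Proof.
move=> Nm; rewrite -[in LHS](subnKC Nm) exprD mulrA -exprMn mulfV ?gt_eqF ?W_gt0//.
by rewrite expr1n mul1r.
Qed.

Lemma WXD (N : nat) (s t : R) : W (s + t) ^+ N <= W s ^+ N * W t ^+ N.
Proof. by rewrite -exprMn lerXn2r ?nnegrE ?mulr_ge0 ?W_ge0// WD. Qed.

Lemma growth_shift phi C N a : growth phi C N ->
  growth (fun t => phi (t + a)) (C * W a ^+ N) N.
Proof.
move=> [[mp1 mp2] gp]; split.
  have ma : measurable_fun setT (fun t : R => t + a) by exact: measurable_funD.
  split; first exact: (measurableT_comp mp1 ma).
  exact: (measurableT_comp mp2 ma).
move=> t; rewrite (le_trans (gp _))// -mulrA ler_wpM2l//.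
  exact: growth_ge0 (conj (conj mp1 mp2) gp).
by rewrite mulrC WXD.
Qed.

Lemma growth_J phi C N w : growth phi C N ->
  growth (fun t => J (w * t) * phi t) (2 * C) N.
Proof.
move=> gp; have C0 := growth_ge0 gp; case: gp => mp gp; split.
  by apply: mCM => //; apply: mC_J; exact: measurable_funM.
move=> t; rewrite (le_trans (c1M _ _))// -mulrA ler_pM ?c1_ge0//.
exact: c1J.
Qed.

Lemma band_measurable b m k n : band b m k -> measurable_fun setT (k n).
Proof. by move=> bk; apply: continuous_measurable_fun; exact: band_continuous bk. Qed.

Definition pairing phi (h : R -> R) : R[i] := integralC (fun t => phi t * (h t)%:C).

Lemma pairing_bound phi C N h (K : R) m : growth phi C N -> measurable_fun setT h ->
  (N.+2 <= m)%N -> (forall t, `|h t| <= K * (W t)^-1 ^+ m) ->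
  integrableC (fun t => phi t * (h t)%:C) /\
  c1 (pairing phi h) <= C * K * \int[mu]_t (W t)^-1 ^+ (m - N).
Proof.
move=> gp mh Nm hK; have C0 := growth_ge0 gp; case: gp => mp gp.
have Nm' : (N <= m)%N by rewrite (leq_trans _ Nm)// ltnW.
have iW : rint (fun t : R => (W t)^-1 ^+ (m - N)) by apply: rint_W; rewrite leq_subRL// addn2.
have ip := rintZ (C * K) iW.
have bd t : c1 (phi t * (h t)%:C) <= C * K * (W t)^-1 ^+ (m - N).
  rewrite mulrC c1R mulrC.
  rewrite (le_trans (ler_pM (c1_ge0 _) (normr_ge0 _) (gp t) (hK t)))//.
  by rewrite mulrACA WX_WV.
have ii : integrableC (fun t => phi t * (h t)%:C).
  by apply: (integrableC_dom _ ip bd); apply: mCM => //; exact: mC_real.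
split => //; rewrite -RintegralZl//.
exact: (c1_integralC ii ip bd).
Qed.

Lemma band_pairing_bound phi C N b m k n : growth phi C N -> band b m k ->
  (N.+2 <= m)%N -> integrableC (fun t => phi t * (k n t)%:C).
Proof.
move=> gp bk Nm; have [K K0 kK] := band_bound bk.
exact: (pairing_bound gp (band_measurable n bk) Nm (kK n)).1.
Qed.

(** The translation is put on [phi], because the equations known for [phi] are translation
    invariant. [corrE] moves it to [k], so that the correlation is differentiable although [phi] is
    not assumed to be, and its derivative is minus the correlation with the derivative of [k]. *)
Definition corr phi k n a : R[i] := pairing (fun t => phi (t + a)) (k n).

Lemma corr_bound phi C N b m k : growth phi C N -> band b m k -> (N.+2 <= m)%N ->
  exists2 D, 0 <= D & forall n a, c1 (corr phi k n a) <= D * b ^+ n * W a ^+ N.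
Proof.
move=> gp bk Nm; have C0 := growth_ge0 gp; have [K K0 kK] := band_bound bk.
exists (C * K * \int[mu]_t (W t)^-1 ^+ (m - N)).
  by rewrite !mulr_ge0//; apply: Rintegral_ge0 => t _; exact: WV_ge0.
move=> n a; have := (pairing_bound (growth_shift a gp) (band_measurable n bk) Nm (kK n)).2.
rewrite /corr => /le_trans; apply.
by rewrite le_eqVlt; apply/orP; left; apply/eqP; ring.
Qed.

Lemma corrE phi C N b m k n a : growth phi C N -> band b m k -> (N.+2 <= m)%N ->
  integrableC (fun t => phi t * (k n (t - a))%:C) /\
  corr phi k n a = integralC (fun t => phi t * (k n (t - a))%:C).
Proof.
move=> gp bk Nm.
have i1 := band_pairing_bound n (growth_shift a gp) bk Nm.
have [] := integralC_shift (- a) i1; rewrite /corr /pairing.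
rewrite (_ : (fun x => phi (x - a + a) * (k n (x - a))%:C) =
   (fun t => phi t * (k n (t - a))%:C)); last by apply/funext => t; rewrite subrK.
by move=> i2 e2; split.
Qed.

Lemma is_derive_shifted_pairing (h : R -> R) C N b m k n a :
  measurable_fun setT h -> 0 <= C -> (forall t, `|h t| <= C * W t ^+ N) ->
  band b m k -> (N.+2 <= m)%N ->
  is_derive a (1 : R) (fun x => \int[mu]_t (h t * k n (t - x)))
    (\int[mu]_t (h t * - k n.+1 (t - a))).
Proof.
move=> mh C0 hC bk Nm; have [K K0 kK] := band_bound bk.
have Nm' : (N <= m)%N by rewrite (leq_trans _ Nm)// ltnW.
have iW : rint (fun t : R => (W t)^-1 ^+ (m - N)) by apply: rint_W; rewrite leq_subRL// addn2.
have bd i x t : `|h t * k i (t - x)| <=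
    C * (K * `|b| ^+ i) * W x ^+ m * (W t)^-1 ^+ (m - N).
  rewrite normrM (le_trans (ler_pM (normr_ge0 _) (normr_ge0 _) (hC t) (kK i (t - x))))//.
  rewrite -WX_WV// (le_trans (y := (C * W t ^+ N) * ((K * `|b| ^+ i) * (W x ^+ m * (W t)^-1 ^+ m))))//; last first.
    by rewrite le_eqVlt; apply/orP; left; apply/eqP; ring.
  rewrite ler_wpM2l ?mulr_ge0 ?exprn_ge0 ?W_ge0//.
  rewrite (le_trans (y := (K * `|b| ^+ i) * (W (t - x))^-1 ^+ m))//.
    rewrite ler_wpM2r ?WV_ge0// ler_wpM2l// -normrX ler_norm//.
  rewrite ler_wpM2l ?mulr_ge0 ?exprn_ge0// -exprMn lerXn2r ?nnegrE ?mulr_ge0 ?invr_ge0 ?W_ge0//.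
  by rewrite -(WN x) WV_shift.
have mk i x : measurable_fun setT (fun t => h t * k i (t - x)).
  apply: measurable_funM => //.
  have ma : measurable_fun setT (fun t : R => t - x) by exact: measurable_funB.
  exact: (measurableT_comp (band_measurable i bk) ma).
have i1 x : rint (fun t => h t * k n (t - x)).
  by apply: (rint_le (mk n x) _ (bd n x)); exact: rintZ.
(* For |x - a| < 1 the weight [W x] is at most [W (|a| + 1)], which gives a dominating function
   independent of x. *)
apply: (@is_derive_under_integral _ (fun x t => h t * k n (t - x))
   (fun x t => h t * - k n.+1 (t - x)) setT a
   (fun t => C * (K * `|b| ^+ n.+1) * W (`|a| + 1) ^+ m * (W t)^-1 ^+ (m - N))).
- exact: measurableT.
- by move=> x _; exact: i1.
- move=> x t; apply: is_derive_scale.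
  have := @is_derive1_comp R (k n) (fun x => -1 * x + t) x _ _ (bk.1 n (-1 * x + t)) (is_derive_affine (-1) t x).
  have -> : k n \o (fun x => -1 * x + t) = (fun x => k n (t - x)).
    by apply/funext => y /=; rewrite mulN1r addrC.
  by move=> d; apply: (is_derive_eq d); rewrite mulN1r mulrN1 [- x + t]addrC.
- move=> t; apply: mulr_ge0; last exact: WV_ge0.
  apply: mulr_ge0; last by rewrite exprn_ge0 ?W_ge0.
  by rewrite mulr_ge0// mulr_ge0// exprn_ge0.
- exact: (rintZ _ iW).
- move=> x t xa _; rewrite mulrN normrN (le_trans (bd n.+1 x t))//.
  rewrite ler_wpM2r ?WV_ge0// ler_wpM2l ?mulr_ge0 ?exprn_ge0//.
  rewrite lerXn2r ?nnegrE ?W_ge0// /W lerD2l [X in _ <= X]ger0_norm ?addr_ge0//.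
  have := ler_norm a; have := ler_norm (- a); rewrite normrN ler_norml.
  by move: xa; lra.
Qed.

Lemma is_derive_corr phi C N b m k n (a : R) : growth phi C N -> band b m k ->
  (N.+2 <= m)%N ->
  is_derive a (1 : R) (fun x => complex.Re (corr phi k n x)) (- complex.Re (corr phi k n.+1 a)) /\
  is_derive a (1 : R) (fun x => complex.Im (corr phi k n x)) (- complex.Im (corr phi k n.+1 a)).
Proof.
move=> gp bk Nm; have C0 := growth_ge0 gp; case: (gp) => [[m1 m2] gpC].
have eR i : (fun x => complex.Re (corr phi k i x)) =
    (fun x => \int[mu]_t (complex.Re (phi t) * k i (t - x))).
  apply/funext => x; rewrite (corrE i x gp bk Nm).2 /=.
  by apply: eq_Rintegral => t _; case: (phi t) => ? ? /=; rewrite mulr0 subr0.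
have eI i : (fun x => complex.Im (corr phi k i x)) =
    (fun x => \int[mu]_t (complex.Im (phi t) * k i (t - x))).
  apply/funext => x; rewrite (corrE i x gp bk Nm).2 /=.
  by apply: eq_Rintegral => t _; case: (phi t) => ? ? /=; rewrite mulr0 add0r.
have [[ir ii] _] := corrE n.+1 a gp bk Nm.
have irR : rint (fun t => complex.Re (phi t) * k n.+1 (t - a)).
  apply: eq_integrable ir => // t _ /=; congr EFin.
  by case: (phi t) => ? ? /=; rewrite mulr0 subr0.
have iiR : rint (fun t => complex.Im (phi t) * k n.+1 (t - a)).
  apply: eq_integrable ii => // t _ /=; congr EFin.
  by case: (phi t) => ? ? /=; rewrite mulr0 add0r.
have N1 (h : R -> R) : rint (fun t => h t * k n.+1 (t - a)) ->
    \int[mu]_t (h t * - k n.+1 (t - a)) = - \int[mu]_t (h t * k n.+1 (t - a)).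
  move=> ih; rewrite -[RHS]mulN1r -RintegralZl//.
  by apply: eq_Rintegral => t _; rewrite mulN1r mulrN.
split.
  rewrite eR (congr1 (@^~ a) (eR n.+1)) /= -N1//.
  apply: (is_derive_shifted_pairing n a m1 C0 _ bk Nm) => t.
  exact: le_trans (Re_ler_c1 _) (gpC t).
rewrite eI (congr1 (@^~ a) (eI n.+1)) /= -N1//.
apply: (is_derive_shifted_pairing n a m2 C0 _ bk Nm) => t.
exact: le_trans (Im_ler_c1 _) (gpC t).
Qed.

End Convolution.

(** * Removing frequencies *)

Section LocalVanishing.
Context (R : realType).
Notation mu := (@lebesgue_measure R).
Implicit Types (phi f : R -> R[i]) (k : nat -> R -> R) (h : R -> R).

Lemma geometric_le0 (x D q : R) : 0 <= q -> q < 1 ->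
  (forall n, x <= D * q ^+ n) -> x <= 0.
Proof.
move=> q0 q1 xD; rewrite leNgt; apply/negP => x0.
have qc : D * q ^+ n @[n --> \oo] --> (0 : R).
  rewrite -(mulr0 D); apply: cvgM; first exact: cvg_cst.
  by apply: cvg_expr; rewrite ger0_norm.
have /cvgrPdist_lt/(_ x x0)[n _ /(_ n (leqnn n))] := qc.
rewrite /= sub0r normrN => h; have := xD n; have := ler_norm (D * q ^+ n).
by lra.
Qed.

Lemma growth_const (C : R) phi : mC (phi : measurableTypeR R -> R[i]) ->
  (forall t, c1 (phi t) <= C) -> growth phi C 0.
Proof. by move=> mp pC; split => // t; rewrite expr0 mulr1. Qed.

(** Pairing e^(i w t) with successive derivatives of h multiplies the size by |w| each time, as the
    translate by a of the exponential is e^(i w a) times itself. The band allows growth like b^n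
    only, and b < |w|. *)
Lemma far_vanish b m h w : 0 <= b -> b < `|w| -> (2 <= m)%N -> isband b m h ->
  integralC (fun t => J (w * t) * (h t)%:C) = 0.
Proof.
move=> b0 bw m2 [k bk <-].
pose phi (t : R) := J (w * t).
have gp : growth phi 2 0.
  apply: growth_const => [|t]; last exact: c1J.
  by apply: mC_J; exact: measurable_funM.
have [D D0 cD] := corr_bound gp bk m2.
pose z n := pairing phi (k n).
have cE n a : corr phi k n a = J (w * a) * z n.
  rewrite /z /pairing -integralCZ; last exact: band_pairing_bound gp bk m2.
  congr integralC; apply/funext => t.
  by rewrite /phi mulrDr JD mulrCA mulrA [J (w * t) * J _]mulrC.
have zE n : c1 (z n.+1) = `|w| * c1 (z n).
  have [d1 d2] := is_derive_corr n 0 gp bk m2.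
  have a1 : is_derive (0 : R) (1 : R) (fun x => w * x + 0) w := is_derive_affine w 0 0.
  have dc : is_derive (0 : R) (1 : R) (fun x => cos (w * x + 0)) 0.
    have := @is_derive1_comp R cos (fun x => w * x + 0) 0 _ w (is_derive_cos (w * 0 + 0)) a1.
    by rewrite mulr0 addr0 sin0 oppr0 mul0r.
  have ds : is_derive (0 : R) (1 : R) (fun x => sin (w * x + 0)) w.
    have := @is_derive1_comp R sin (fun x => w * x + 0) 0 _ w (is_derive_sin (w * 0 + 0)) a1.
    by rewrite mulr0 addr0 cos0 mul1r.
  have e1 : is_derive (0 : R) (1 : R)
      (fun x => complex.Re (z n) * cos (w * x + 0) - complex.Im (z n) * sin (w * x + 0))
      (- (w * complex.Im (z n))).
    have := is_deriveB (is_derive_scale (complex.Re (z n)) dc)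
      (is_derive_scale (complex.Im (z n)) ds).
    by move=> d; apply: (is_derive_eq d); rewrite mulr0 sub0r mulrC.
  have e2 : is_derive (0 : R) (1 : R)
      (fun x => complex.Im (z n) * cos (w * x + 0) + complex.Re (z n) * sin (w * x + 0))
      (w * complex.Re (z n)).
    have := is_deriveD (is_derive_scale (complex.Im (z n)) dc)
      (is_derive_scale (complex.Re (z n)) ds).
    by move=> d; apply: (is_derive_eq d); rewrite mulr0 add0r mulrC.
  have f1 : (fun x => complex.Re (corr phi k n x)) =
    (fun x => complex.Re (z n) * cos (w * x + 0) - complex.Im (z n) * sin (w * x + 0)).
    by apply/funext => x; rewrite cE addr0; case: (z n) => ? ? /=; ring.
  have f2 : (fun x => complex.Im (corr phi k n x)) =
    (fun x => complex.Im (z n) * cos (w * x + 0) + complex.Re (z n) * sin (w * x + 0)).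
    by apply/funext => x; rewrite cE addr0; case: (z n) => ? ? /=; ring.
  rewrite f1 in d1; rewrite f2 in d2.
  have := etrans (esym (@derive_val _ _ _ _ _ _ _ d1)) (@derive_val _ _ _ _ _ _ _ e1).
  have := etrans (esym (@derive_val _ _ _ _ _ _ _ d2)) (@derive_val _ _ _ _ _ _ _ e2).
  have -> : corr phi k n.+1 0 = z n.+1 by rewrite cE mulr0 J0 mul1r.
  move=> h2 /oppr_inj h1; rewrite /c1 h1 -[complex.Im (z n.+1)]opprK h2 normrN !normrM.
  by rewrite addrC mulrDr.
have w0 : 0 < `|w| by exact: le_lt_trans bw.
have zn n : c1 (z n) = `|w| ^+ n * c1 (z 0%N).
  by elim: n => [|n IH]; rewrite ?expr0 ?mul1r// zE IH exprS mulrA.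
apply: c1_eq0; apply/eqP; rewrite eq_le c1_ge0 andbT.
apply: (@geometric_le0 _ D (b / `|w|)); first by rewrite divr_ge0.
  by rewrite ltr_pdivrMr// mul1r.
move=> n; have := cD n 0; rewrite cE mulr0 J0 mul1r zn /W normr0 addr0 expr1n mulr1.
by rewrite expr_div_n mulrA ler_pdivlMr ?exprn_gt0// mulrC.
Qed.

Lemma lip_of_derive (F F' : R -> R) (B a b : R) :
  (forall x, is_derive x (1 : R) F (F' x)) ->
  (forall x, `|x - a| <= `|b - a| -> `|F' x| <= B) ->
  `|F b - F a| <= B * `|b - a|.
Proof.
move=> dF FB.
have cF : continuous F.
  move=> x; apply: differentiable_continuous.
  by apply/derivable1_diffP; have [] := dF x.
have [ab|ba|->] := ltgtP a b; last by rewrite !subrr normr0 mulr0.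
  have [c] := MVT ab (fun x _ => dF x) (continuous_subspaceT cF).
  rewrite in_itv /= => /andP[ac cb] ->; rewrite normrM ler_wpM2r//; apply: FB.
  by rewrite !gtr0_norm ?subr_gt0//; lra.
have [c] := MVT ba (fun x _ => dF x) (continuous_subspaceT cF).
rewrite in_itv /= => /andP[ac cb] e; rewrite distrC e normrM.
rewrite [X in _ <= _ * X]distrC ler_wpM2r//; apply: FB.
by rewrite !ltr0_norm ?subr_lt0//; lra.
Qed.

(* Let M n be the weighted sup norm of the n-th derivative Y of the correlation
   a |-> <phi(. + a), k 0>, so that M n = O(d ^ n). If M n.+1 < 2 d M n, then Y
   varies slowly on the scale where the mass of f sits, and the equation
   int f(t) Y(t + a) dt = 0 forces M n <= M n / 2. Hence M n >= (2 d) ^ n M 0 for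
   all n, which is only possible if M 0 = 0. *)
Lemma local_vanish phi C N f : growth phi C N -> integrableC f ->
  rint (fun t => c1 (f t) * W t ^+ N) ->
  (forall a, integralC (fun t => f t * phi (t + a)) = 0) -> integralC f != 0 ->
  exists2 d, 0 < d & forall k, band d N.+2 k -> pairing phi (k 0%N) = 0.
Proof.
move=> gp fi fW fphi f0; have C0 := growth_ge0 gp.
pose c0 := c1 (integralC f)^-1.
(* [g d] dominates f(t) (Y(a) - Y(t + a)), up to the factor M_n and the weight at a: 4 d |t| is the
   Lipschitz bound for small t, 2 the trivial bound for large t, and the last factor is the weight
   lost in passing from a to t + a. *)
pose g (d t : R) : R := c1 (f t) * (Num.min (4 * (d * `|t|)) 2 * (1 + d * `|t|) ^+ N).
have mg (d : R) : measurable_fun setT (g d).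
  apply: measurable_funM; first by apply: measurable_c1; exact: integrableC_mC.
  have mn : measurable_fun setT (fun t : R => d * `|t|) by exact: measurable_funM.
  apply: measurable_funM.
    by apply: measurable_minr => //; exact: measurable_funM.
  by apply: measurable_funX; exact: measurable_funD.
have min0 (d t : R) : 0 <= d -> 0 <= Num.min (4 * (d * `|t|)) 2.
  by move=> d0; rewrite le_min ler0n andbT mulr_ge0// mulr_ge0.
have pow0 (d t : R) : 0 <= d -> 0 <= (1 + d * `|t|) ^+ N.
  by move=> d0; rewrite exprn_ge0// addr_ge0// mulr_ge0.
have g0 (d t : R) : 0 <= d -> 0 <= g d t.
  by move=> d0; rewrite mulr_ge0 ?c1_ge0// mulr_ge0 ?min0 ?pow0.
have gle (d t : R) : 0 <= d -> d <= 1 -> g d t <= 2 * (c1 (f t) * W t ^+ N).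
  move=> d0 d1; rewrite mulrCA ler_wpM2l ?c1_ge0// ler_pM//.
  - exact: min0.
  - exact: pow0.
  - by rewrite ge_min lexx orbT.
  - rewrite lerXn2r ?nnegrE ?W_ge0 ?addr_ge0 ?mulr_ge0//.
    by rewrite /W lerD2l ler_piMl.
have ig d : 0 <= d -> d <= 1 -> rint (g d).
  move=> d0 d1; apply: (rint_le (mg d) (rintZ 2 fW)) => t.
  by rewrite ger0_norm ?g0// gle.
(* By dominated convergence the integral of [g d] tends to 0 with d; d is taken small enough to
   outweigh the inverse of the integral of f. *)
have [d d0 [d1 dg]] : exists2 d : R, 0 < d & d <= 1 /\ c0 * \int[mu]_t g d t <= 2^-1.
  have cg : \int[mu]_t g n.+1%:R^-1 t @[n --> \oo] --> \int[mu]_t (cst 0 t : R).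
    apply: (Rintegral_cvg (fun n => mg n.+1%:R^-1) _ (rintZ 2 fW)).
    - exact: measurable_cst.
    - move=> n t; rewrite ger0_norm ?g0 ?invr_ge0//.
      by apply: gle; rewrite ?invr_ge0 ?invf_le1 ?ler1n ?ltr0n.
    - move=> t.
      have cb : (c1 (f t) * (4 * `|t|) * W t ^+ N) * n.+1%:R^-1 @[n --> \oo] --> (0 : R).
        rewrite -[X in _ --> X](mulr0 (c1 (f t) * (4 * `|t|) * W t ^+ N)).
        by apply: cvgM; [exact: cvg_cst|exact: cvg_harmonic].
      apply: (squeeze_cvgr _ (cvg_cst 0) cb); apply: nearW => n.
      rewrite g0 ?invr_ge0//= /g -!mulrA ler_wpM2l ?c1_ge0//.
      rewrite (le_trans (y := 4 * (n.+1%:R^-1 * `|t|) * W t ^+ N))//; last first.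
        by rewrite le_eqVlt; apply/orP; left; apply/eqP; ring.
      apply: ler_pM.
      + by rewrite min0 ?invr_ge0.
      + by rewrite pow0 ?invr_ge0.
      + by rewrite ge_min lexx.
      + rewrite lerXn2r ?nnegrE ?W_ge0 ?addr_ge0 ?mulr_ge0 ?invr_ge0//.
        by rewrite /W lerD2l ler_piMl// invf_le1 ?ler1n ?ltr0n.
  have e0 : 0 < (2 * (c0 + 1))^-1 by rewrite invr_gt0 mulr_gt0// ltr_wpDl ?c1_ge0.
  have /cvgrPdist_lt/(_ _ e0)[n _ /(_ n (leqnn n))] := cg.
  rewrite /= Rintegral_cst// mul0r sub0r normrN => gn.
  exists n.+1%:R^-1; rewrite ?invr_gt0//; split; first by rewrite invf_le1 ?ler1n ?ltr0n.
  have gn' := le_lt_trans (ler_norm _) gn.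
  rewrite (le_trans (ler_wpM2l (c1_ge0 _) (ltW gn')))//.
  rewrite invfM mulrCA ler_piMr ?invr_ge0// ler_pdivrMr ?mul1r ?lerDl//.
  by rewrite ltr_wpDl ?c1_ge0.
exists d => // k bk; apply/eqP/negP => /negP z0.
have Nm : (N.+2 <= N.+2)%N by [].
have [D D0 cD] := corr_bound gp bk Nm.
(* The weight is scaled by d so that the factor [w t] lost under a translation by t tends to 1 as d
   tends to 0. *)
pose w (a : R) := (1 + d * `|a|) ^+ N.
have w_gt0 a : 0 < w a by rewrite exprn_gt0// ltr_pwDl// mulr_ge0// ltW.
have w1 : w 0 = 1 by rewrite /w normr0 mulr0 addr0 expr1n.
have wD a t : w (t + a) <= w a * w t.
  rewrite /w -exprMn lerXn2r ?nnegrE ?mulr_ge0 ?addr_ge0 ?mulr_ge0 ?(ltW d0)//.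
  rewrite mulrDl mul1r mulrDr mulr1.
  have := ler_wpM2l (ltW d0) (ler_normD t a).
  have : 0 <= d * `|a| * (d * `|t|) by rewrite !mulr_ge0 ?(ltW d0).
  by rewrite mulrDr; lra.
pose V n := [set c1 (corr phi k n a) / w a | a in setT].
have Vub n : ubound (V n) (D * (d^-1) ^+ N * d ^+ n).
  move=> _ [a _ <-]; rewrite ler_pdivrMr// (le_trans (cD n a))//.
  rewrite -!mulrA ler_wpM2l// [X in _ <= X]mulrCA ler_wpM2l ?exprn_ge0 ?(ltW d0)//.
  rewrite /w -exprMn lerXn2r ?nnegrE ?W_ge0 ?mulr_ge0 ?addr_ge0 ?mulr_ge0 ?invr_ge0 ?(ltW d0)//.
  rewrite mulrDr mulr1 mulrA mulVf ?gt_eqF// mul1r /W lerD2r.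
  by rewrite invf_ge1.
have Vsup n : has_sup (V n).
  by split; [exists (c1 (corr phi k n 0) / w 0); exists 0|exists (D * (d^-1) ^+ N * d ^+ n)].
pose M n := sup (V n).
have cM n a : c1 (corr phi k n a) <= M n * w a.
  rewrite -ler_pdivrMr//; apply: sup_upper_bound => //.
  by exists a.
have M_ge0 n : 0 <= M n.
  by have := cM n 0; rewrite w1 mulr1; apply: le_trans; exact: c1_ge0.
have M0 : 0 < M 0%N.
  have := cM 0%N 0; rewrite w1 mulr1; apply: lt_le_trans.
  rewrite lt_neqAle c1_ge0 andbT eq_sym; apply/eqP => /c1_eq0 c00.
  move: z0; suff <- : corr phi k 0 0 = pairing phi (k 0%N) by rewrite c00 eqxx.
  by rewrite /corr; congr pairing; apply/funext => t; rewrite addr0.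
have Mb n : M n <= D * (d^-1) ^+ N * d ^+ n by apply: ge_sup => //; exact: (Vsup n).1.
have step n : 0 < M n -> 2 * d * M n <= M n.+1.
  move=> Mn; rewrite leNgt; apply/negP => Mlt.
  suff : M n <= 2^-1 * M n by rewrite leNgt gtr_pMl// invf_lt1 ?ltr1n.
  apply: ge_sup; first exact: (Vsup n).1.
  move=> _ [a _ <-]; rewrite ler_pdivrMr//.
  pose Y (x : R) := corr phi k n x.
  have w_ge1 t : 1 <= w t by rewrite exprn_ege1// lerDl mulr_ge0// ltW.
  have w_mono x t : `|x| <= `|t| -> w x <= w t.
    move=> xt; rewrite /w lerXn2r ?nnegrE ?addr_ge0 ?mulr_ge0 ?(ltW d0)//.
    by rewrite lerD2l ler_wpM2l// ltW.
  (* The constant 4 is 2 from the assumption [M n.+1 < 2 * d * M n], doubled because real and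
     imaginary parts are estimated separately. *)
  have lipY t : c1 (Y a - Y (t + a)) <=
      M n * w a * (Num.min (4 * (d * `|t|)) 2 * (1 + d * `|t|) ^+ N).
    rewrite -/(w t) mulrCA minr_pMl ?mulr_ge0 ?(ltW Mn) ?(ltW (w_gt0 _))//.
    rewrite le_min; apply/andP; split.
      have B x : `|x - a| <= `|t + a - a| -> c1 (corr phi k n.+1 x) <= 2 * d * M n * (w a * w t).
        rewrite addrK => xa; apply: (le_trans (cM _ _)).
        apply: ler_pM; [exact: M_ge0|exact: ltW (w_gt0 _)|exact: ltW|].
        by rewrite -{1}(subrK a x) (le_trans (wD _ _))// ler_wpM2l ?(ltW (w_gt0 _))// w_mono.
      have l1 := @lip_of_derive (fun x => complex.Re (Y x)) _ (2 * d * M n * (w a * w t)) a (t + a)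
        (fun x => (is_derive_corr n x gp bk Nm).1).
      have l2 := @lip_of_derive (fun x => complex.Im (Y x)) _ (2 * d * M n * (w a * w t)) a (t + a)
        (fun x => (is_derive_corr n x gp bk Nm).2).
      have -> : 4 * (d * `|t|) * (M n * w a * w t) =
         2 * d * M n * (w a * w t) * `|t + a - a| + 2 * d * M n * (w a * w t) * `|t + a - a|.
        by rewrite addrK; ring.
      rewrite -c1N opprB.
      have -> : c1 (Y (t + a) - Y a) = `|complex.Re (Y (t + a)) - complex.Re (Y a)| +
        `|complex.Im (Y (t + a)) - complex.Im (Y a)|.
        by rewrite /c1; case: (Y (t + a)) (Y a) => ? ? [].
      apply: lerD.
        by apply: l1 => x /B; apply: le_trans; rewrite normrN Re_ler_c1.
      by apply: l2 => x /B; apply: le_trans; rewrite normrN Im_ler_c1.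
    rewrite (le_trans (c1B _ _))// (le_trans (lerD (cM n a) (cM n (t + a))))//.
    rewrite mulr_natl mulr2n lerD//.
      by rewrite ler_peMr ?w_ge1// mulr_ge0 ?(ltW Mn) ?(ltW (w_gt0 _)).
    by rewrite -mulrA ler_wpM2l ?(ltW Mn).
  (* Y is an average of translates of [phi], so by Fubini it satisfies the same equation. *)
  have [fY fY0] : integrableC (fun t => f t * Y (t + a)) /\
      integralC (fun t => f t * Y (t + a)) = 0.
    have [K K0 kK] := band_bound bk.
    pose F (z : measurableTypeR R * measurableTypeR R) :=
      f z.1 * (phi (z.2 + (z.1 + a)) * (k n z.2)%:C).
    have mF : mC F.
      apply: mCM.
        exact: (mC_comp (T' := (measurableTypeR R * measurableTypeR R)%type)
          measurable_fst (integrableC_mC fi)).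
      apply: mCM.
        apply: (mC_comp (T' := (measurableTypeR R * measurableTypeR R)%type) _ gp.1).
        apply: measurable_funD; first exact: measurable_snd.
        by apply: measurable_funD => //; exact: measurable_fst.
      apply: mC_real.
      exact: (measurableT_comp (band_measurable n bk) measurable_snd).
    pose q (u : R) := C * W a ^+ N * K * d ^+ n * (W u)^-1 ^+ 2.
    have iq : rint q by apply: rintZ; exact: rint_W.
    have q0 u : 0 <= q u.
      by rewrite mulr_ge0 ?WV_ge0// !mulr_ge0 ?exprn_ge0 ?W_ge0 ?(ltW d0).
    have p0 t : 0 <= c1 (f t) * W t ^+ N by rewrite mulr_ge0 ?c1_ge0 ?exprn_ge0 ?W_ge0.
    have Fpq z : c1 (F z) <= c1 (f z.1) * W z.1 ^+ N * q z.2.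
      case: z => t u; rewrite /F /= (le_trans (c1M _ _))// -mulrA ler_wpM2l ?c1_ge0//.
      rewrite mulrC c1R mulrC.
      rewrite (le_trans (ler_pM (c1_ge0 _) (normr_ge0 _) (gp.2 _) (kK n u)))//.
      have h1 : W (u + (t + a)) ^+ N <= W u ^+ N * (W t ^+ N * W a ^+ N).
        rewrite (le_trans (WXD _ _ _))// ler_wpM2l ?exprn_ge0 ?W_ge0//.
        exact: WXD.
      rewrite (le_trans (ler_wpM2r _ (ler_wpM2l C0 h1)))//.
        exact: le_trans (normr_ge0 _) (kK n u).
      rewrite le_eqVlt; apply/orP; left; apply/eqP; rewrite /q.
      have <- : W u ^+ N * (W u)^-1 ^+ N.+2 = (W u)^-1 ^+ 2.
        have N2 : (N <= N.+2)%N by rewrite (leq_trans (leqnSn _)).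
        by rewrite (WX_WV _ N2) -addn2 addKn.
      move: ((W u)^-1 ^+ N.+2) (W u ^+ N) (W t ^+ N) (W a ^+ N) (d ^+ n) => x1 x2 x3 x4 x5.
      by ring.
    have [i1 i2 e] := fubiniC mF fW iq p0 q0 Fpq.
    have E t : integralC (fun u => F (t, u)) = f t * Y (t + a).
      exact: (integralCZ (f t) (band_pairing_bound n (growth_shift (t + a) gp) bk Nm)).
    have EE : (fun t => integralC (fun u => F (t, u))) = (fun t => f t * Y (t + a)).
      by apply/funext => t; exact: E.
    have Z u : integralC (fun t => F (t, u)) = 0.
      have ifp : integrableC (fun t => f t * phi (t + (u + a))).
        have [mg' gg] := growth_shift (u + a) gp.
        apply: (integrableC_dom (p := fun t => C * W (u + a) ^+ N * (c1 (f t) * W t ^+ N))).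
        - exact: (mCM (integrableC_mC fi) mg').
        - exact: (rintZ _ fW).
        - move=> t; apply: (le_trans (c1M _ _)); rewrite [X in _ <= X]mulrCA.
          exact: (ler_wpM2l (c1_ge0 _) (gg t)).
      have FE : (fun t => F (t, u)) = (fun t => (k n u)%:C * (f t * phi (t + (u + a)))).
        by apply/funext => t; rewrite /F [RHS]mulrC -mulrA addrCA.
      by rewrite FE (integralCZ _ ifp) fphi mulr0.
    rewrite -EE; split; first exact: i1.
    rewrite e (_ : (fun u => integralC (fun t => F (t, u))) = (fun _ => 0)).
      exact: integralC0.
    by apply/funext => u; exact: Z.
  have fYa : integrableC (fun t => f t * Y a).
    have := integrableCZ (Y a) fi.
    by rewrite (_ : (fun x => Y a * f x) = (fun t => f t * Y a))//; apply/funext => t; rewrite mulrC.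
  (* By the equation, the integral of f(t) Y(t + a) can be subtracted for free; this leaves only
     increments of Y. *)
  have key : integralC f * Y a = integralC (fun t => f t * (Y a - Y (t + a))).
    rewrite mulrC -(integralCZ (Y a) fi).
    rewrite (_ : (fun t => f t * (Y a - Y (t + a))) =
       (fun t => f t * Y a + (-1) * (f t * Y (t + a)))); last first.
      by apply/funext => t; ring.
    rewrite integralCD//; last exact: integrableCZ.
    rewrite (integralCZ (-1) fY) fY0 mulr0 addr0.
    by congr integralC; apply/funext => t; rewrite mulrC.
  have ifd : integrableC (fun t => f t * (Y a - Y (t + a))).
    rewrite (_ : (fun t => f t * (Y a - Y (t + a))) =
       (fun t => f t * Y a + (-1) * (f t * Y (t + a)))); last first.
      by apply/funext => t; ring.
    by apply: integrableCD => //; exact: integrableCZ.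
  have bd t : c1 (f t * (Y a - Y (t + a))) <= M n * w a * g d t.
    apply: (le_trans (c1M _ _)); rewrite /g [X in _ <= X]mulrCA.
    exact: (ler_wpM2l (c1_ge0 _) (lipY t)).
  have igd := ig d (ltW d0) d1.
  have := c1_integralC ifd (rintZ (M n * w a) igd) bd.
  rewrite -key RintegralZl// => kb.
  have -> : corr phi k n a = (integralC f)^-1 * (integralC f * Y a).
    by rewrite mulKf.
  rewrite (le_trans (c1M _ _))// -/c0.
  rewrite (le_trans (ler_wpM2l (c1_ge0 _) kb))// -/c0.
  rewrite -[X in _ <= X]mulrA [X in X <= _]mulrCA [X in X <= _]mulrC.
  have X0 : 0 <= M n * w a by rewrite mulr_ge0 ?(ltW Mn) ?(ltW (w_gt0 _)).
  exact: (ler_wpM2r X0 dg).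
have grow n : (2 * d) ^+ n * M 0%N <= M n.
  elim: n => [|n IH]; first by rewrite expr0 mul1r.
  have Mn : 0 < M n.
    by apply: lt_le_trans IH; rewrite mulr_gt0// exprn_gt0// mulr_gt0.
  apply: le_trans (step n Mn); rewrite exprS -mulrA ler_wpM2l//.
  by rewrite mulr_ge0// ltW.
have : M 0%N <= 0.
  apply: (@geometric_le0 _ (D * (d^-1) ^+ N) 2^-1) => //.
    by rewrite invf_lt1// ltr1n.
  move=> n; have := le_trans (grow n) (Mb n).
  rewrite exprMn mulrAC ler_pM2r ?exprn_gt0// => h.
  by rewrite [X in _ <= _ * X]exprVn ler_pdivlMr ?exprn_gt0// mulrC.
by rewrite leNgt M0.
Qed.

End LocalVanishing.

(** * The Fejer kernel *)

Section DiagonalVanishing.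
Context (R : realType).
Notation mu := (@lebesgue_measure R).
Notation RT := (measurableTypeR R).

Lemma integralC_sum (n : nat) (F : nat -> R -> R[i]) :
  (forall i, integrableC (F i)) ->
  integrableC (fun x => \sum_(i < n) F i x) /\
  integralC (fun x => \sum_(i < n) F i x) = \sum_(i < n) integralC (F i).
Proof.
move=> iF; elim: n => [|n [IH1 IH2]].
  under eq_fun do rewrite big_ord0.
  rewrite big_ord0; split; last exact: integralC0.
  by split; exact: integrable0.
under eq_fun do rewrite big_ord_recr /=.
split; first exact: (integrableCD IH1 (iF n)).
by rewrite big_ord_recr /= (integralCD IH1 (iF n)) IH2.
Qed.

Lemma Rintegral_gt0 (q : R -> R) : continuous q -> (forall t, 0 <= q t) ->
  0 < q 0 -> rint q -> 0 < \int[mu]_t q t.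
Proof.
move=> cq q0 q00 iq.
have h0 : 0 < q 0 / 2 by rewrite divr_gt0.
have /cvgrPdist_lt/(_ _ h0)/nbhs_ballP[d /= d0 dq] := cq 0.
pose I : set R := [set` `[(0 : R), d / 2]].
have mI : measurable (I : set RT) by exact: measurable_itv.
have qI t : I t -> q 0 / 2 <= q t.
  rewrite /I /= in_itv /= => /andP[t0 td].
  have /dq : ball (0 : R) d t by rewrite /ball /= sub0r normrN ger0_norm//; lra.
  by move=> h; have := le_lt_trans (ler_norm _) h; lra.
have muI : mu I = (d / 2)%:E.
  by rewrite /I lebesgue_measure_itv /= lte_fin divr_gt0// oppr0 adde0.
have h1 : ((q 0 / 2 * (d / 2))%:E <= \int[mu]_(t in I) (q t)%:E)%E.
  rewrite EFinM -muI -integral_cst//.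
  apply: ge0_le_integral => //.
  - by move=> t _; rewrite lee_fin ltW.
  - apply/measurable_EFinP; apply: measurable_funTS.
    exact: continuous_measurable_fun.
have h2 : (\int[mu]_(t in I) (q t)%:E <= \int[mu]_t (q t)%:E)%E.
  apply: ge0_subset_integral => //.
  - by apply/measurable_EFinP; exact: continuous_measurable_fun.
  - by move=> t _; rewrite lee_fin.
rewrite -lte_fin /Rintegral fineK; last exact: (integrable_fin_num measurableT iq).
apply: lt_le_trans (le_trans h1 h2).
by rewrite lte_fin !mulr_gt0// invr_gt0.
Qed.

Definition dirichlet (n : nat) (x : R) : R[i] := \sum_(j < n) J (2 * j%:R * x).

Lemma JX (a : R) (n : nat) : J a ^+ n = J (n%:R * a).
Proof.
elim: n => [|n IH]; first by rewrite expr0 mul0r J0.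
by rewrite exprS IH -JD -natr1 mulrDl mul1r addrC.
Qed.

Lemma dirichlet_geom (n : nat) (x : R) :
  dirichlet n x * (J (2 * x) - 1) = J (2 * (n%:R * x)) - 1.
Proof.
rewrite [2 * (n%:R * x)]mulrCA -(JX (2 * x)) subrX1 [RHS]mulrC; congr (_ * _).
rewrite /dirichlet; apply: eq_bigr => j _; rewrite (JX (2 * x)); congr J.
by rewrite mulrCA mulrA.
Qed.

Lemma J_sub1 (x : R) : (J (2 * x) - 1) * (J (2 * - x) - 1) = (4 * sin x ^+ 2)%:C.
Proof.
have := cos2Dsin2 x => h.
have e1 : cos (2 * x) = 1 - 2 * sin x ^+ 2.
  have hc : cos x * cos x = 1 - sin x ^+ 2 by rewrite -h expr2; ring.
  by rewrite mulr_natl mulr2n cosD hc; ring.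
have e2 : sin (2 * x) = 2 * sin x * cos x.
  by rewrite mulr_natl mulr2n sinD; ring.
rewrite /J mulrN cosN sinN e1 e2; apply/eqP; rewrite eq_complex /=.
apply/andP; split; apply/eqP; last by ring.
rewrite -[4 * _](_ : 4 * sin x ^+ 2 * (cos x ^+ 2 + sin x ^+ 2) = 4 * sin x ^+ 2); last by rewrite h mulr1.
by ring.
Qed.

(** For x <> 0 both sides are multiplied by 4 x^2. With x sinc x = sin x and |e^(2 i x) - 1|^2 = 4
    sin(x)^2, summing the geometric series gives 4 sin(n x)^2 on both sides. The even frequencies in
    [dirichlet] produce sin x instead of sin(x/2). *)
Lemma fejer (n : nat) (x : R) : (0 < n)%N ->
  dirichlet n x * dirichlet n (- x) * (sinc x ^+ 2)%:C =
  (n%:R ^+ 2 * sinc (n%:R * x) ^+ 2)%:C.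
Proof.
move=> n0; have [->|x0] := eqVneq x 0.
  rewrite oppr0 mulr0 sinc0 expr1n mulr1 /dirichlet.
  under eq_bigr do rewrite mulr0 J0.
  rewrite sumr_const card_ord !mulr1.
  by rewrite (rmorphXn (real_complex R)) /= ?rmorph_nat expr2 ?mulr1 ?rmorph1 ?mulr1.
have xC : (4 * x ^+ 2)%:C != 0 :> R[i].
  by rewrite -[0]/(0%:C) (inj_eq (@complexI R)) mulf_neq0// expf_neq0.
apply: (mulIf xC).
have h := congr2 *%R (dirichlet_geom n x) (dirichlet_geom n (- x)).
rewrite [RHS](_ : _ = (4 * (n%:R * x * sinc (n%:R * x)) ^+ 2)%:C); last first.
  by rewrite -rmorphM /=; congr (_%:C); ring.
rewrite sinc_sin -J_sub1 -mulrN -h.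
rewrite -[LHS]mulrA.
have -> : (sinc x ^+ 2)%:C * (4 * x ^+ 2)%:C = (4 * sin x ^+ 2)%:C :> R[i].
  by rewrite -rmorphM /=; congr (_%:C); rewrite -sinc_sin; ring.
by rewrite -J_sub1; ring.
Qed.

End DiagonalVanishing.

(** * Recovering a diagonal integral from frequency-wise vanishing *)

Section DiagonalIntegral.
Context (R : realType).
Notation mu := (@lebesgue_measure R).
Notation RT := (measurableTypeR R).

Lemma integralC_real (h : R -> R) :
  integralC (fun t => (h t)%:C) = (\int[mu]_t h t)%:C.
Proof.
rewrite /integralC /=; congr (_ +i* _).
by rewrite /Rintegral integral0.
Qed.

Lemma cvg_c1 (u : nat -> R[i]) (z : R[i]) :
  complex.Re (u n) @[n --> \oo] --> complex.Re z ->
  complex.Im (u n) @[n --> \oo] --> complex.Im z ->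
  c1 (u n - z) @[n --> \oo] --> (0 : R).
Proof.
have h0 (f : nat -> R) (a : R) : f n @[n --> \oo] --> a ->
    `|f n - a| @[n --> \oo] --> (0 : R).
  move=> fa; rewrite -(@normr0 R R) -(subrr a); apply: cvg_norm.
  by apply: cvgB => //; exact: cvg_cst.
move=> /h0 h1 /h0 h2.
have -> : (fun n => c1 (u n - z)) = (fun n => `|complex.Re (u n) - complex.Re z| +
    `|complex.Im (u n) - complex.Im z|).
  by apply/funext => n; rewrite /c1; case: (u n) => ? ?; case: (z) => ? ?.
by rewrite -[X in _ --> X]addr0; exact: cvgD.
Qed.

Lemma cvg_c1_scale (a : nat -> R) (b : R) (u : nat -> R[i]) (z : R[i]) :
  a n @[n --> \oo] --> b -> c1 (u n - z) @[n --> \oo] --> (0 : R) ->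
  c1 ((a n)%:C * u n - b%:C * z) @[n --> \oo] --> (0 : R).
Proof.
move=> ha hu.
have h0 : `|a n| * c1 (u n - z) + `|a n - b| * c1 z @[n --> \oo] --> (0 : R).
  rewrite -[X in _ --> X](_ : `|b| * 0 + `|b - b| * c1 z = 0); last first.
    by rewrite subrr normr0 mulr0 mul0r addr0.
  apply: cvgD; first by apply: cvgM => //; exact: cvg_norm.
  apply: cvgM; last exact: cvg_cst.
  by apply: cvg_norm; apply: cvgB => //; exact: cvg_cst.
apply: (squeeze_cvgr _ (cvg_cst 0) h0).
apply: nearW => n; rewrite c1_ge0 /=.
have -> : (a n)%:C * u n - b%:C * z = (a n)%:C * (u n - z) + (a n - b)%:C * z.
  by rewrite rmorphB /=; ring.
by apply: le_trans (c1D _ _) _; rewrite !c1R.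
Qed.

Lemma cvg_divn (u : R) : u / n.+1%:R @[n --> \oo] --> (0 : R).
Proof.
rewrite -[X in _ --> X](mulr0 u); apply: cvgM; first exact: cvg_cst.
exact: cvg_harmonic.
Qed.

Lemma sinc_bound (c : R) M : 0 < c ->
  exists2 K, 0 <= K & forall t, `|sinc (c * t) ^+ M| <= K * (W t)^-1 ^+ M.
Proof.
by move=> c0; apply: isband_bound (isband_sincX M c0 (ltr1n R 2)).
Qed.

Lemma sinc_continuous : continuous (@sinc R).
Proof. exact: (isband_continuous (isband_sinc (ltr1n R 2))). Qed.

Context (Psi : R -> R -> R[i]) (C : R) (N : nat) (c : R).
Hypothesis mPsi : mC (fun z : (RT * RT)%type => Psi z.1 z.2).
Hypothesis C0 : 0 <= C.
Hypothesis Psi_bound : forall s t,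
  c1 (Psi s t) <= C * W s ^+ N * (W t)^-1 ^+ (N + 4).
Hypothesis cRe : forall t, continuous (fun s => complex.Re (Psi s t) : R).
Hypothesis cIm : forall t, continuous (fun s => complex.Im (Psi s t) : R).
Hypothesis c0 : 0 < c.

(** Of the exponent N + 4, two powers become the Fejer kernel, N compensate the growth of
    [diagonal_shift], and two are left for integrability. *)
Let kap (r : R) := sinc (c * r) ^+ (N + 4).

Let mkap : measurable_fun setT (kap : RT -> R).
Proof.
apply: continuous_measurable_fun => r; rewrite /kap.
apply: (@continuous_comp _ _ _ (fun r => sinc (c * r)) (fun x => x ^+ (N + 4))).
  apply: (@continuous_comp _ _ _ (fun r => c * r) (@sinc R)); last exact: sinc_continuous.
  exact: mulrl_continuous.
exact: exprn_continuous.
Qed.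

(** The integral along the line t - s = r; its value at r = 0 is the diagonal integral. *)
Definition diagonal_shift (r : R) : R[i] := integralC (fun t => Psi (t - r) t).
Local Notation G := diagonal_shift.

Lemma diagonal_shift_dom (r t : R) :
  c1 (Psi (t - r) t) <= C * W r ^+ N * (W t)^-1 ^+ 4.
Proof.
apply: le_trans (Psi_bound _ _) _.
rewrite exprD mulrA ler_wpM2r ?WV_ge0// -!mulrA ler_wpM2l// .
apply: le_trans (ler_wpM2r (WV_ge0 t N) (WXD N t (- r))) _.
rewrite WN mulrAC -exprMn mulfV ?gt_eqF ?W_gt0// expr1n mul1r.
by [].
Qed.

Lemma mC_diagonal_shift (r : R) : mC (fun t : RT => Psi (t - r) t).
Proof.
have := @mC_comp R _ _ _ _ _ (fun t : RT => (t - r : RT, t : RT)) _ mPsi.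
apply; apply/measurable_fun_pairP; split; last exact: measurable_id.
rewrite (_ : _ \o _ = fun x : RT => (1 * x + - r)%R : RT); first exact: measurable_affine.
by apply/funext => x /=; rewrite mul1r.
Qed.

Lemma diagonal_shift_bound : exists2 D, 0 <= D & forall r, c1 (G r) <= D * W r ^+ N.
Proof.
have i4 : rint (fun t : R => (W t)^-1 ^+ 4) by exact: rint_W.
exists (C * \int[mu]_t (W t)^-1 ^+ 4).
  by rewrite mulr_ge0// Rintegral_ge0// => t _; exact: WV_ge0.
move=> r; have ir := rintZ (C * W r ^+ N) i4.
have h := integrableC_dom (mC_diagonal_shift r) ir (diagonal_shift_dom r).
apply: le_trans (c1_integralC h ir (diagonal_shift_dom r)) _.
by rewrite RintegralZl// mulrAC.
Qed.

Lemma diagonal_shift_cvg (u : R) :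
  c1 (G (u / n.+1%:R) - G 0) @[n --> \oo] --> (0 : R).
Proof.
have i4 : rint (fun t : R => (W t)^-1 ^+ 4) by exact: rint_W.
apply: (@integralC_cvg R (fun n t => Psi (t - u / n.+1%:R) t) (fun t => Psi (t - 0) t)
  (fun t => C * W u ^+ N * (W t)^-1 ^+ 4)).
- by move=> n; exact: mC_diagonal_shift.
- exact: rintZ.
- move=> n t; apply: le_trans (diagonal_shift_dom _ _) _.
  rewrite ler_wpM2r ?WV_ge0// ler_wpM2l// lerXn2r ?nnegrE ?W_ge0//.
  rewrite /W lerD2l normrM ler_piMr// ger0_norm ?invr_ge0// invf_le1 ?ler1n//.
- exact: mC_diagonal_shift.
move=> t; have h : t - u / n.+1%:R @[n --> \oo] --> t - 0.
  by apply: cvgB; [exact: cvg_cst|exact: cvg_divn].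
apply: cvg_c1.
  exact: (cvg_comp _ _ h (@cRe t (t - 0))).
exact: (cvg_comp _ _ h (@cIm t (t - 0))).
Qed.

Lemma kap_bound : exists2 K, 0 <= K &
  forall r, c1 ((kap r)%:C : R[i]) <= K * (W r)^-1 ^+ (N + 4).
Proof.
have [K K0 h] := sinc_bound (N + 4) c0.
by exists K => // r; rewrite c1_real; exact: h.
Qed.

(* In the coordinates (r, t) = (t - s, t), either alternative annihilates
   int int J (w r) * kap r * Psi (t - r) t. *)
Definition vanishing_frequency (w : R) :=
  (forall t, integralC (fun s => J (w * (t - s)) * (kap (t - s))%:C * Psi s t) = 0) \/
  (forall s, integralC (fun t => J (w * (t - s)) * (kap (t - s))%:C * Psi s t) = 0).

Let mC2 (w : R) : mC (fun z : (RT * RT)%type =>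
  J (w * (z.2 - z.1)) * (kap (z.2 - z.1))%:C * Psi z.1 z.2).
Proof.
have mB : measurable_fun setT (fun z : (RT * RT)%type => z.2 - z.1 : R).
  by apply: measurable_funB; [exact: measurable_snd|exact: measurable_fst].
apply: mCM => //; apply: mCM.
  by apply: mC_J; apply: measurable_funM => //; exact: measurable_cst.
by apply: mC_real; exact: (measurableT_comp mkap mB).
Qed.

(** Fubini in (s, t) makes both alternatives available, Fubini in (r, t) produces [diagonal_shift].
    For fixed t the inner integrals of the two agree by the reflection s = t - r. *)
Lemma vanishing_frequencyP (w : R) : vanishing_frequency w ->
  integrableC (fun r => J (w * r) * (kap r)%:C * G r) /\
  integralC (fun r => J (w * r) * (kap r)%:C * G r) = 0.
Proof.
have [K K0 hK] := kap_bound => hw.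
pose F s t := J (w * (t - s)) * (kap (t - s))%:C * Psi s t.
pose H r t := J (w * r) * (kap r)%:C * Psi (t - r) t.
have i2 : rint (fun t : R => (W t)^-1 ^+ 2) by exact: rint_W.
have i4 : rint (fun t : R => (W t)^-1 ^+ 4) by exact: rint_W.
have KC0 : 0 <= 2 * K * C by rewrite !mulr_ge0.
have bJ r z : c1 (J (w * r) * (kap r)%:C * z) <= 2 * (K * (W r)^-1 ^+ (N + 4)) * c1 z.
  apply: le_trans (c1M _ _) _; rewrite ler_wpM2r ?c1_ge0//.
  apply: le_trans (c1M _ _) _; apply: ler_pM; rewrite ?c1_ge0// ?c1J//.
(* Two powers of the decay of [kap] are dropped. The other N + 2 are exchanged for decay in s at the
   price of growth in t; this leaves exponent -2 in each variable. *)
have Fb z : c1 (F z.1 z.2) <= (2 * K * C * (W z.1)^-1 ^+ 2) * (W z.2)^-1 ^+ 2.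
  case: z => s t /=; apply: le_trans (bJ _ _) _.
  apply: (@le_trans _ _ (2 * (K * (W (t - s))^-1 ^+ (N + 2)) *
     (C * W s ^+ N * (W t)^-1 ^+ (N + 4)))).
    apply: ler_pM; rewrite ?c1_ge0// ?mulr_ge0 ?WV_ge0//.
    rewrite !ler_wpM2l// ler_wiXn2l ?leq_add2l ?WV_le1//.
    by rewrite invr_ge0 W_ge0.
  have h : (W (t - s))^-1 ^+ (N + 2) <= W t ^+ (N + 2) * (W s)^-1 ^+ (N + 2).
    rewrite -exprMn lerXn2r ?nnegrE ?mulr_ge0 ?invr_ge0 ?W_ge0//.
    by rewrite addrC -(WN s); exact: WV_shift.
  apply: (@le_trans _ _ (2 * K * C * (W s ^+ N * (W t)^-1 ^+ (N + 4)) *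
     (W t ^+ (N + 2) * (W s)^-1 ^+ (N + 2)))).
    rewrite [X in X <= _](_ : _ = 2 * K * C * (W s ^+ N * (W t)^-1 ^+ (N + 4)) *
      (W (t - s))^-1 ^+ (N + 2)); last by ring.
    by rewrite ler_wpM2l// mulr_ge0// mulr_ge0 ?WV_ge0// exprn_ge0 ?W_ge0.
  rewrite [X in X <= _](_ : _ = 2 * K * C * (W s ^+ N * (W s)^-1 ^+ (N + 2)) *
      (W t ^+ (N + 2) * (W t)^-1 ^+ (N + 4))); last by ring.
  by rewrite !WX_WV ?leq_addr ?leq_add2l// addKn subnDl.
have Hb z : c1 (H z.1 z.2) <= (2 * K * C * (W z.1)^-1 ^+ 4) * (W z.2)^-1 ^+ 4.
  case: z => r t /=; apply: le_trans (bJ _ _) _.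
  apply: (@le_trans _ _ (2 * (K * (W r)^-1 ^+ (N + 4)) * (C * W r ^+ N * (W t)^-1 ^+ 4))).
    by rewrite ler_wpM2l ?diagonal_shift_dom// !mulr_ge0 ?WV_ge0.
  rewrite [X in X <= _](_ : _ = 2 * K * C * (W r ^+ N * (W r)^-1 ^+ (N + 4)) * (W t)^-1 ^+ 4); last by ring.
  by rewrite WX_WV ?leq_addr// addKn.
have mH : mC (fun z : (RT * RT)%type => H z.1 z.2).
  have m1 : measurable_fun setT (fun z : (RT * RT)%type => z.1 : R) by exact: measurable_fst.
  apply: mCM; first apply: mCM.
  - by apply: mC_J; apply: measurable_funM => //; exact: measurable_cst.
  - by apply: mC_real; exact: (measurableT_comp mkap m1).
  - have := @mC_comp R _ _ _ _ _ (fun z : (RT * RT)%type => (z.2 - z.1 : RT, z.2 : RT)) _ mPsi.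
    apply; apply/measurable_fun_pairP; split; last exact: measurable_snd.
    by apply: measurable_funB; [exact: measurable_snd|exact: measurable_fst].
have W0 m (t : R) : 0 <= (W t)^-1 ^+ m by exact: WV_ge0.
have [_ _ Fs] := fubiniC (mC2 w) (rintZ _ i2) i2 (fun s => mulr_ge0 KC0 (W0 2 s)) (W0 2) Fb.
have [Hi _ Hs] := fubiniC mH (rintZ _ i4) i4 (fun s => mulr_ge0 KC0 (W0 4 s)) (W0 4) Hb.
have Hr r : integralC (fun t => H r t) = J (w * r) * (kap r)%:C * G r.
  exact: integralCZ (integrableC_dom (mC_diagonal_shift r) (rintZ _ i4) (diagonal_shift_dom r)).
have -> : (fun r => J (w * r) * (kap r)%:C * G r) = (fun r => integralC (fun t => H r t)).
  by apply/funext => r; rewrite Hr.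
split; first exact: Hi.
rewrite Hs /=.
have FH t : integralC (fun s => F s t) = integralC (fun r => H r t).
  have iH : integrableC (fun r => H r t).
    apply: (integrableC_dom (mC_pair2 t mH) (rintZ (2 * K * C * (W t)^-1 ^+ 4) i4)).
    by move=> r; rewrite mulrAC; exact: (Hb (r, t)).
  have [_ <-] := integralC_reflect t iH.
  by congr integralC; apply/funext => s; rewrite /F /H subKr.
rewrite -(_ : (fun t => integralC (fun s => F s t)) = fun t => integralC (fun r => H r t)); last first.
  by apply/funext => t; exact: FH.
case: hw => hw.
  rewrite (_ : (fun t => _) = fun=> 0); first exact: integralC0.
  by apply/funext => t; exact: hw.
rewrite -[LHS]Fs /= (_ : (fun s => _) = fun=> 0); first exact: integralC0.
by apply/funext => s; exact: hw.
Qed.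

Hypothesis all_vanish : forall w, vanishing_frequency w.

(* Averaging over the frequencies 2 c (i - j) with i, j <= n turns the factor
   sinc (c r) ^ 2 of [kap r] into a Fejer kernel, which concentrates at r = 0. *)
Lemma fejer_vanish (n : nat) :
  integrableC (fun r => (sinc (n.+1%:R * (c * r)) ^+ 2 * sinc (c * r) ^+ (N + 2))%:C * G r) /\
  integralC (fun r => (sinc (n.+1%:R * (c * r)) ^+ 2 * sinc (c * r) ^+ (N + 2))%:C * G r) = 0.
Proof.
pose F i j r := J ((2 * c * i%:R - 2 * c * j%:R) * r) * (kap r)%:C * G r.
have Fi (i j : nat) := vanishing_frequencyP (all_vanish (2 * c * i%:R - 2 * c * j%:R)).
have S1 (i : nat) := integralC_sum n.+1 (fun j => (Fi i j).1).
have S2 := integralC_sum n.+1 (fun i => (S1 i).1).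
have E : (fun r => \sum_(i < n.+1) \sum_(j < n.+1) F i j r) =
  (fun r => (n.+1%:R ^+ 2)%:C *
    ((sinc (n.+1%:R * (c * r)) ^+ 2 * sinc (c * r) ^+ (N + 2))%:C * G r)).
  apply/funext => r.
  have -> : (n.+1%:R ^+ 2)%:C *
      ((sinc (n.+1%:R * (c * r)) ^+ 2 * sinc (c * r) ^+ (N + 2))%:C * G r) =
    dirichlet n.+1 (c * r) * (dirichlet n.+1 (- (c * r)) * ((kap r)%:C * G r)).
    rewrite /kap (_ : N + 4 = 2 + (N + 2))%N; last by rewrite addnCA.
    transitivity ((n.+1%:R ^+ 2 * sinc (n.+1%:R * (c * r)) ^+ 2)%:C *
        ((sinc (c * r) ^+ (N + 2))%:C * G r)).
      by rewrite !(rmorphM (real_complex R)) /= !mulrA.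
    rewrite -fejer// (exprD _ 2 (N + 2)).
    by rewrite (rmorphM (real_complex R) (_ ^+ 2) (_ ^+ (N + 2))) /= !mulrA.
  rewrite mulr_suml; apply: eq_bigr => i _.
  rewrite mulr_suml mulr_sumr; apply: eq_bigr => j _.
  rewrite /F (_ : _ * r = 2 * i%:R * (c * r) + 2 * j%:R * - (c * r)); last by ring.
  by rewrite JD !mulrA.
have n0 : (n.+1%:R ^+ 2)%:C != 0 :> R[i].
  by rewrite -[0]/(0%:C) (inj_eq (@complexI R)) expf_neq0// pnatr_eq0.
have I1 : integrableC (fun r => (n.+1%:R ^+ 2)%:C *
    ((sinc (n.+1%:R * (c * r)) ^+ 2 * sinc (c * r) ^+ (N + 2))%:C * G r)).
  by rewrite -E; exact: S2.1.
have I0 : integralC (fun r => (n.+1%:R ^+ 2)%:C *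
    ((sinc (n.+1%:R * (c * r)) ^+ 2 * sinc (c * r) ^+ (N + 2))%:C * G r)) = 0.
  rewrite -E S2.2; apply: big1 => i _; rewrite (S1 i).2; apply: big1 => j _.
  exact: (Fi i j).2.
have E2 : (fun r => ((n.+1%:R ^+ 2)%:C)^-1 * ((n.+1%:R ^+ 2)%:C *
    ((sinc (n.+1%:R * (c * r)) ^+ 2 * sinc (c * r) ^+ (N + 2))%:C * G r))) =
   (fun r => (sinc (n.+1%:R * (c * r)) ^+ 2 * sinc (c * r) ^+ (N + 2))%:C * G r).
  by apply/funext => r; rewrite mulKf.
rewrite -E2; split; first exact: (integrableCZ _ I1).
by rewrite (integralCZ _ I1) I0 mulr0.
Qed.

(** After the substitution r = u/(n + 1) the vanishing integral of [fejer_vanish] has integrand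
    sinc(c u)^2 sinc(c u/(n + 1))^(N + 2) G(u/(n + 1)). As n grows it tends to sinc(c u)^2 G(0),
    whose integral is G(0) times a positive number. *)
Lemma diag_vanish : integralC (fun t => Psi t t) = 0.
Proof.
suff : G 0 = 0 by rewrite /G; under eq_fun do rewrite subr0.
pose h n (u : R) := (sinc (c * u) ^+ 2 * sinc (c * (u / n.+1%:R)) ^+ (N + 2))%:C * G (u / n.+1%:R).
have h0 n : integrableC (h n) /\ integralC (h n) = 0.
  have [i1 i2] := fejer_vanish n.
  have n1 : n.+1%:R^-1 != 0 :> R by rewrite invr_eq0 pnatr_eq0.
  have [j1 j2] := integralC_affine 0 n1 i1.
  have E : h n = fun u : R => (sinc (n.+1%:R * (c * (n.+1%:R^-1 * u + 0))) ^+ 2 *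
      sinc (c * (n.+1%:R^-1 * u + 0)) ^+ (N + 2))%:C * G (n.+1%:R^-1 * u + 0).
    apply/funext => u; rewrite addr0 /h [n.+1%:R^-1 * u]mulrC.
    have -> // : n.+1%:R * (c * (u / n.+1%:R)) = c * u.
    by rewrite mulrC -!mulrA mulVf ?mulr1// pnatr_eq0.
  rewrite E; split=> //; apply/eqP; move/eqP: j2.
  by rewrite i2 eq_sym mulf_eq0 => /orP[|//]; rewrite -[0]/(0%:C) (inj_eq (@complexI R)) normr_eq0 (negbTE n1).
have [K K0 hK] := sinc_bound (N + 2) c0.
have [K' K'0 hK'] := sinc_bound 2 c0.
have [D D0 hD] := diagonal_shift_bound.
have i2 : rint (fun t : R => (W t)^-1 ^+ 2) by exact: rint_W.
have csinc : continuous (fun u : R => sinc (c * u)).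
  move=> u; apply: (@continuous_comp _ _ _ (fun r => c * r) (@sinc R)); last exact: sinc_continuous.
  exact: mulrl_continuous.
have csincX m : continuous (fun u : R => sinc (c * u) ^+ m).
  move=> u; apply: (@continuous_comp _ _ _ (fun r => sinc (c * r)) (fun x => x ^+ m)).
    exact: csinc.
  exact: (@exprn_continuous R m).
have isinc : rint (fun u : R => sinc (c * u) ^+ 2).
  by apply: (rint_le (continuous_measurable_fun (csincX 2)) (rintZ K' i2)).
have lim0 : integralC (fun u => (sinc (c * u) ^+ 2)%:C * G 0) = 0.
  apply: (@integralC_eq0_lim R h _ (fun u => K' * K * D * (W u)^-1 ^+ 2)).
  - by move=> n; exact: (integrableC_mC (h0 n).1).
  - exact: rintZ.
  - move=> n u; rewrite /h c1R normrM.
    apply: (@le_trans _ _ ((K' * (W u)^-1 ^+ 2 * (K * (W (u / n.+1%:R))^-1 ^+ (N + 2))) *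
      (D * W (u / n.+1%:R) ^+ N))).
      by apply: ler_pM; rewrite ?c1_ge0// ?mulr_ge0// ler_pM.
    rewrite [X in X <= _](_ : _ = (K' * K * D * (W u)^-1 ^+ 2) *
      (W (u / n.+1%:R) ^+ N * (W (u / n.+1%:R))^-1 ^+ (N + 2))); last by ring.
    rewrite WX_WV ?leq_addr// addKn; apply: ler_piMr.
      by rewrite !mulr_ge0 ?WV_ge0// invr_ge0 W_ge0.
    by rewrite expr2 mulr_ile1 ?WV_le1// invr_ge0 W_ge0.
  - apply: mCM; last exact: mC_cst.
    by apply: mC_real; exact: continuous_measurable_fun.
  - move=> u; rewrite -[sinc (c * u) ^+ 2]mulr1; apply: cvg_c1_scale; last exact: diagonal_shift_cvg.
    apply: cvgM; first exact: cvg_cst.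
    rewrite -[X in _ --> X](_ : sinc (c * 0) ^+ (N + 2) = 1); last first.
      by rewrite mulr0 sinc0 expr1n.
    exact: (cvg_comp _ _ (cvg_divn u) (csincX (N + 2) 0)).
  - by move=> n; exact: (h0 n).2.
have int0 : integralC (fun u => G 0 * (sinc (c * u) ^+ 2)%:C) = 0.
  by rewrite -lim0; congr integralC; apply/funext => u; rewrite mulrC.
move/eqP: int0; rewrite integralCZ; last first.
  split; first exact: isinc.
  exact: integrable0.
rewrite integralC_real mulf_eq0 => /orP[/eqP//|].
rewrite -[0]/(0%:C) (inj_eq (@complexI R)) gt_eqF//.
by apply: Rintegral_gt0 => // [t|]; rewrite ?sqr_ge0// mulr0 sinc0 expr1n.
Qed.

End DiagonalIntegral.

(** * From annihilating functions to vanishing band-limited integrals *)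

Section SpectralSynthesis.
Context (R : realType).
Notation mu := (@lebesgue_measure R).
Notation RT := (measurableTypeR R).

(* [killer N phi z] certifies that z is not a frequency of phi. *)
Definition killer (N : nat) (phi : R -> R[i]) (z : R) := exists f : R -> R[i],
  [/\ integrableC f, rint (fun t => c1 (f t) * W t ^+ N), fourier f z != 0 &
    forall a, integralC (fun t => f t * phi (t + a)) = 0].

Definition cont (phi : R -> R[i]) :=
  continuous (fun t : R => complex.Re (phi t) : R) /\
  continuous (fun t : R => complex.Im (phi t) : R).

Lemma mC_cont (phi : R -> R[i]) : cont phi -> mC (phi : RT -> R[i]).
Proof. by case; exact: mC_continuous. Qed.

Lemma contMr (phi : R -> R[i]) (z : R[i]) : cont phi -> cont (fun s => phi s * z).
Proof.
move=> [cR cI]; split.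
  have -> : (fun s => complex.Re (phi s * z)) = fun s =>
      complex.Re (phi s) * complex.Re z - complex.Im (phi s) * complex.Im z.
    by apply/funext => s; case: (phi s) z => [? ?] [? ?].
  move=> s; apply: cvgB; apply: cvgM; by [exact: cR|exact: cI|exact: cvg_cst].
have -> : (fun s => complex.Im (phi s * z)) = fun s =>
    complex.Re (phi s) * complex.Im z + complex.Im (phi s) * complex.Re z.
  by apply/funext => s; case: (phi s) z => [? ?] [? ?].
move=> s; apply: cvgD; apply: cvgM; by [exact: cR|exact: cI|exact: cvg_cst].
Qed.

Lemma diag_vanish_mul (Phi : R -> R -> R[i]) C N c (u : R -> R[i]) K :
  mC (fun z : (RT * RT)%type => Phi z.1 z.2) -> 0 <= C ->
  (forall s t, c1 (Phi s t) <= C * W s ^+ N) -> (forall t, cont (Phi ^~ t)) ->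
  mC (u : RT -> R[i]) -> 0 <= K -> (forall t, c1 (u t) <= K * (W t)^-1 ^+ (N + 4)) ->
  0 < c ->
  (forall w, vanishing_frequency (fun s t => Phi s t * u t) N c w) ->
  integralC (fun t => Phi t t * u t) = 0.
Proof.
move=> mPhi C0 hC cPhi mu' K0 hK c0 hw.
apply: (@diag_vanish R (fun s t => Phi s t * u t) (C * K) N c) => //.
- apply: mCM => //.
  exact: (mC_comp (h := fun z : (RT * RT)%type => z.2) measurable_snd mu').
- exact: mulr_ge0.
- move=> s t; apply: le_trans (c1M _ _) _.
  rewrite [X in _ <= X](_ : _ = C * W s ^+ N * (K * (W t)^-1 ^+ (N + 4))); last by ring.
  by apply: ler_pM; rewrite ?c1_ge0.
- by move=> t; have [] := contMr (u t) (cPhi t).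
- by move=> t; have [] := contMr (u t) (cPhi t).
Qed.

Lemma modulated_band (y b : R) m h : isband b m h ->
  mC (fun t : RT => J (- (y * t)) * (h t)%:C) /\
  exists2 K, 0 <= K & forall t, c1 (J (- (y * t)) * (h t)%:C) <= K * (W t)^-1 ^+ m.
Proof.
move=> hb; have [K K0 hK] := isband_bound hb; split.
  apply: mCM; last first.
    by apply: mC_real; exact: (continuous_measurable_fun (isband_continuous hb)).
  rewrite (_ : (fun t => _) = fun t : RT => J (- y * t)); last by apply/funext => t; rewrite mulNr.
  by apply: mC_J; apply: measurable_funM; [exact: measurable_cst|exact: measurable_id].
exists (2 * K) => [|t]; first exact: mulr_ge0.
apply: le_trans (c1M _ _) _; rewrite -mulrA.
by apply: ler_pM; rewrite ?c1_ge0// ?c1J// c1_real.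
Qed.

Lemma growth_J0 (w : R) : growth (fun t => J (w * t)) 2 0.
Proof.
split=> [|t]; last by rewrite expr0 mulr1 c1J.
by apply: mC_J; apply: measurable_funM; [exact: measurable_cst|exact: measurable_id].
Qed.

Lemma isband_pairing phi C N b m (h : R -> R) : growth phi C N -> isband b m h ->
  (N.+2 <= m)%N -> integrableC (fun t => phi t * (h t)%:C).
Proof. by move=> hp [k bk <-]; exact: band_pairing_bound hp bk. Qed.

(** Modulating [f] by e^(i z t) and [phi] by e^(-i z t) moves z to the frequency 0, where
    [local_vanish] applies. The remaining factor e^(-i (z' - z) t) is split into cosine and sine and
    counted in the band of the test function, whence the condition on |z' - z| + e. *)
Lemma killer_vanish phi C N z : growth phi C N -> killer N phi z ->
  exists2 d, 0 < d & forall z' e h, 0 <= e -> `|z' - z| + e <= d ->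
    isband e N.+2 h -> integralC (fun t => J (- (z' * t)) * phi t * (h t)%:C) = 0.
Proof.
move=> hp [f [fi fW f0 fa]].
have gz w : growth (fun t => J (- w * t) * phi t) (2 * C) N by exact: growth_J.
have cJ t : c1 (J (z * t) * f t) <= 2 * c1 (f t).
  by apply: le_trans (c1M _ _) _; rewrite ler_wpM2r ?c1_ge0 ?c1J.
have mJ : mC (fun t : RT => J (z * t) * f t).
  apply: mCM; last exact: (integrableC_mC fi).
  by apply: mC_J; apply: measurable_funM; [exact: measurable_cst|exact: measurable_id].
have i1 : integrableC (fun t => J (z * t) * f t).
  exact: integrableC_dom mJ (rintZ 2 (integrableC_c1 fi)) cJ.
have i2 : rint (fun t => c1 (J (z * t) * f t) * W t ^+ N).
  apply: (rint_le _ (rintZ 2 fW)).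
    apply: measurable_funM; first exact: (measurable_c1 mJ).
    by apply: measurable_funX; exact: measurable_W.
  move=> t; rewrite ger0_norm ?mulr_ge0 ?c1_ge0 ?exprn_ge0 ?W_ge0// mulrA.
  by rewrite ler_wpM2r ?exprn_ge0 ?W_ge0.
have i3 a : integralC (fun t => J (z * t) * f t * (J (- z * (t + a)) * phi (t + a))) = 0.
  have := fa a.
  have -> : (fun t => J (z * t) * f t * (J (- z * (t + a)) * phi (t + a))) =
      fun t => J (- z * a) * (f t * phi (t + a)).
    apply/funext => t; rewrite mulrDr JD mulNr.
    by rewrite [LHS](_ : _ = (J (- (z * t)) * J (z * t)) * (J (- z * a) * (f t * phi (t + a))));
      [rewrite JN mul1r|ring].
  have [if0|nif] := pselect (integrableC (fun t => f t * phi (t + a))).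
    by rewrite (integralCZ _ if0) => ->; rewrite mulr0.
  have [K hK] : exists K, forall t, c1 (phi (t + a)) <= K * W t ^+ N.
    by have [_ h] := growth_shift a hp; exists (C * W a ^+ N).
  case: nif; apply: (integrableC_dom _ (rintZ K fW)).
    apply: mCM; first exact: (integrableC_mC fi).
    by have [] := growth_shift a hp.
  move=> t; apply: le_trans (c1M _ _) _.
  by rewrite mulrCA ler_wpM2l ?c1_ge0.
have i4 : integralC (fun t => J (z * t) * f t) != 0.
  by move: f0; rewrite /fourier; congr (_ != _); congr integralC; apply/funext => t; rewrite mulrC.
have [d d0 hd] := local_vanish (gz z) i1 i2 i3 i4.
exists d => // z' e h e0 zd hb.
have hd' q : isband d N.+2 q -> integralC (fun t => J (- z * t) * phi t * (q t)%:C) = 0.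
  by move=> [k bk <-]; exact: hd.
pose q1 t := cos ((z' - z) * t + 0) * h t.
pose q2 t := sin ((z' - z) * t) * h t.
have b1 : isband d N.+2 q1.
  have := isband_mul (isband_cos (z' - z) 0) hb.
  by apply: isband_mono; rewrite ?addr_ge0.
have b2 : isband d N.+2 q2.
  have := isband_mul (isband_sin (z' - z)) hb.
  by apply: isband_mono; rewrite ?addr_ge0.
have j1 := isband_pairing (gz z) b1 (leqnn _).
have j2 := isband_pairing (gz z) b2 (leqnn _).
have -> : (fun t => J (- (z' * t)) * phi t * (h t)%:C) = fun t =>
    J (- z * t) * phi t * (q1 t)%:C + (- 'i) * (J (- z * t) * phi t * (q2 t)%:C).
  apply/funext => t.
  rewrite (_ : - (z' * t) = - z * t + - ((z' - z) * t)); last by ring.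
  rewrite JD.
  have -> : J (- ((z' - z) * t)) = (cos ((z' - z) * t))%:C - 'i * (sin ((z' - z) * t))%:C.
    by rewrite /J cosN sinN; apply/eqP; rewrite eq_complex /=; apply/andP; split; apply/eqP; ring.
  by rewrite /q1 /q2 addr0 !rmorphM /=; ring.
by rewrite (integralCD j1 (integrableCZ _ j2)) (integralCZ _ j2) !hd'// mulr0 addr0.
Qed.

(** [killer_vanish] gives a width that depends on z. Having some common width is an additive
    property of intervals of frequencies, so [cousin] applies. *)
Lemma killer_uniform phi C N (a b : R) : growth phi C N -> a < b ->
  (forall z, a <= z <= b -> killer N phi z) ->
  exists2 d, 0 < d & forall z h, a <= z <= b -> isband d N.+2 h ->
    integralC (fun t => J (- (z * t)) * phi t * (h t)%:C) = 0.
Proof.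
move=> hp ab kz.
apply: (@cousin R (fun u v => exists2 d, 0 < d & forall z h, u <= z <= v ->
  isband d N.+2 h -> integralC (fun t => J (- (z * t)) * phi t * (h t)%:C) = 0)) => //.
  move=> u v w uv vw [d1 d10 h1] [d2 d20 h2].
  exists (Num.min d1 d2); first by rewrite lt_min d10.
  have dd : 0 <= Num.min d1 d2 by rewrite le_min !ltW.
  move=> z h /andP[uz zw] bh; have [zv|vz] := leP z v.
    apply: h1; first by rewrite uz.
    by apply: isband_mono bh; rewrite ?ge_min ?lexx.
  apply: h2; first by rewrite (ltW vz).
  by apply: isband_mono bh; rewrite ?ge_min ?lexx ?orbT.
move=> s hs; have [d d0 hd] := killer_vanish hp (kz s hs).
(* One half of d is spent on the distance to s, the other half on the band. *)
exists (d / 2) => [|u v su us sv vs uv]; first by rewrite divr_gt0.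
exists (d / 2) => [|z h /andP[uz zv]]; first by rewrite divr_gt0.
apply: hd; first by rewrite divr_ge0 ?ltW.
have : `|z - s| <= d / 2 by rewrite ler_distl; apply/andP; split; lra.
by move=> h0; lra.
Qed.

(* The hypotheses of [diag_vanish] hold at every frequency w: close to y by
   [killer_uniform], away from y because the band of h does not reach w - y. *)
Lemma killer_patch phi C N (b y e : R) h : growth phi C N -> cont phi -> 0 <= b -> b < e ->
  (forall z, `|z - y| <= e -> killer N phi z) -> isband b (N + 4) h ->
  integralC (fun t => J (- y * t) * phi t * (h t)%:C) = 0.
Proof.
move=> hp [cR cI] b0 be kz hb.
have [d d0 hd] : exists2 d, 0 < d & forall z h, `|z - y| <= e -> isband d N.+2 h ->
    integralC (fun t => J (- (z * t)) * phi t * (h t)%:C) = 0.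
  have [//||d d0 hd] := @killer_uniform phi C N (y - e) (y + e) hp.
  - by lra.
  - by move=> z zy; apply: kz; rewrite ler_distl.
  by exists d => // z h0 zy; apply: hd; rewrite -ler_distl.
have N0 : 0 < (N + 4)%:R :> R by rewrite ltr0n addnS.
(* The sinc power is to have band d': at most d for the frequencies near y, and with d' + b < e for
   those beyond distance e. The halving in [c] below is there because [isband_sincX] is used with
   the bound 2 > 1. *)
pose d' := Num.min d ((e - b) / 2).
have d'0 : 0 < d' by rewrite lt_min d0 divr_gt0// subr_gt0.
pose c := d' / (N + 4)%:R / 2.
have c0 : 0 < c by rewrite !divr_gt0.
have bk : isband d' (N + 4) (fun t => sinc (c * t) ^+ (N + 4)).
  have := isband_sincX (N + 4) c0 (ltr1n R 2).
  have -> // : (N + 4)%:R * (c * 2%:R) = d'.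
  by rewrite /c divfK// mulrC divfK// gt_eqF.
have [mJh [K K0 hK]] := modulated_band y hb.
under eq_fun do rewrite mulNr (mulrC (J _)) -mulrA.
apply: (@diag_vanish_mul (fun s _ => phi s) C N c (fun t => J (- (y * t)) * (h t)%:C) K) => //.
- exact: (mC_comp (h := fun z : (RT * RT)%type => z.1) measurable_fst hp.1).
- exact: growth_ge0 hp.
- by move=> s _; case: hp.
move=> w; have [wy|wy] := leP `|w - y| e.
  left=> t; pose q s := sinc (c * (t - s)) ^+ (N + 4).
  have bq : isband d N.+2 q.
    have n1 : -1 != 0 :> R by rewrite oppr_eq0 oner_neq0.
    have := isband_affine t n1 bk.
    rewrite normrN1 mul1r => h1.
    have -> : q = fun s => sinc (c * (-1 * s + t)) ^+ (N + 4).
      by apply/funext => s; rewrite /q mulN1r addrC.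
    by apply: isband_mono h1; rewrite ?(ltW d'0) ?ge_min ?lexx// -[N.+2]addn2 leq_add2l.
  have iq := isband_pairing (growth_J (- w) hp) bq (leqnn _).
  have -> : (fun s => J (w * (t - s)) * (sinc (c * (t - s)) ^+ (N + 4))%:C * (phi s * (J (- (y * t)) * (h t)%:C))) =
      fun s => (J (w * t) * (J (- (y * t)) * (h t)%:C)) *
        (J (- w * s) * phi s * (q s)%:C).
    by apply/funext => s; rewrite mulrBr -mulNr JD /q; ring.
  rewrite (integralCZ _ iq).
  have := hd w q wy bq; under eq_fun do rewrite -mulNr.
  by move=> ->; rewrite mulr0.
right=> s; pose q t := sinc (c * (t - s)) ^+ (N + 4) * h t.
have bq : isband (d' + b) (N + 4 + (N + 4)) q.
  have := isband_mul (isband_affine (- s) (oner_neq0 R) bk) hb.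
  rewrite normr1 mul1r (_ : (fun t => _) = q)//.
  by apply/funext => t; rewrite /q mul1r.
have m2 : (2 <= N + 4 + (N + 4))%N by rewrite !addnS.
have iq := isband_pairing (growth_J0 (w - y)) bq m2.
have -> : (fun t => J (w * (t - s)) * (sinc (c * (t - s)) ^+ (N + 4))%:C * (phi s * (J (- (y * t)) * (h t)%:C))) =
    fun t => (J (- (w * s)) * phi s) * (J ((w - y) * t) * (q t)%:C).
  apply/funext => t; rewrite mulrBr mulrBl !JD /q rmorphM /=; ring.
rewrite (integralCZ _ iq) (far_vanish _ _ m2 bq) ?mulr0//.
  by rewrite addr_ge0// ltW.
have : d' <= (e - b) / 2 by rewrite ge_min lexx orbT.
by move=> h1; apply: lt_trans wy; lra.
Qed.

Lemma diagonal_killed (Phi : R -> R -> R[i]) C N (y0 e b : R) h :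
  0 <= C -> (forall s t, c1 (Phi s t) <= C * W s ^+ N) ->
  (forall t, cont (Phi ^~ t)) -> (forall s, cont (Phi s)) ->
  (forall w, (forall z, `|z - w| <= e -> forall t, killer N (Phi ^~ t) z) \/
     (forall z, `|z - (y0 - w)| <= e -> forall s, killer 0 (Phi s) z)) ->
  0 < e -> 0 <= b -> b <= e / 2 -> isband b (N + 4) h ->
  integralC (fun t => Phi t t * (J (- (y0 * t)) * (h t)%:C)) = 0.
Proof.
move=> C0 hC cs ct kk e0 b0 be hb.
have N0 : 0 < (N + 4)%:R :> R by rewrite ltr0n addnS.
(* This gives the sinc power the band e/4. The bands met in s and t are then e/4 and e/4 + b <=
   3e/4, both strictly below e, as [killer_patch] requires. *)
pose c := e / 4 / (N + 4)%:R / 2.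
have e4 : 0 < e / 4 by rewrite divr_gt0.
have c0 : 0 < c by rewrite !divr_gt0.
have bk : isband (e / 4) (N + 4) (fun t => sinc (c * t) ^+ (N + 4)).
  have := isband_sincX (N + 4) c0 (ltr1n R 2).
  have -> // : (N + 4)%:R * (c * 2%:R) = e / 4.
  by rewrite /c divfK// mulrC divfK// gt_eqF.
have [mJh [K K0 hK]] := modulated_band y0 hb.
apply: (@diag_vanish_mul Phi C N c (fun t => J (- (y0 * t)) * (h t)%:C) K) => //.
  apply: mC_caratheodory => [t|t|s]; [by case: (cs t)|by case: (cs t)|exact: mC_cont].
move=> w; have [kw|kw] := kk w.
  left=> t; pose q s := sinc (c * (t - s)) ^+ (N + 4).
  have gt : growth (Phi ^~ t) C N by split=> [|s //]; exact: mC_cont.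
  have bq : isband (e / 4) (N + 4) q.
    have n1 : -1 != 0 :> R by rewrite oppr_eq0 oner_neq0.
    have := isband_affine t n1 bk.
    rewrite normrN1 mul1r (_ : (fun s => _) = q)//.
    by apply/funext => s; rewrite /q mulN1r addrC.
  have m2 : (N.+2 <= N + 4)%N by rewrite -[N.+2]addn2 leq_add2l.
  have iq := isband_pairing (growth_J (- w) gt) bq m2.
  have -> : (fun s => J (w * (t - s)) * (sinc (c * (t - s)) ^+ (N + 4))%:C *
        (Phi s t * (J (- (y0 * t)) * (h t)%:C))) =
      fun s => (J (w * t) * (J (- (y0 * t)) * (h t)%:C)) *
        (J (- w * s) * Phi s t * (q s)%:C).
    by apply/funext => s; rewrite mulrBr -mulNr JD /q; ring.
  rewrite (integralCZ _ iq) (killer_patch (e := e) gt (cs t) (ltW e4) _ _ bq) ?mulr0//.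
    by rewrite gtr_pMr// invf_lt1// ltr1n.
  by move=> z zw; exact: kw.
right=> s; pose q t := sinc (c * (t - s)) ^+ (N + 4) * h t.
have gs : growth (Phi s) (C * W s ^+ N) 0.
  by apply: growth_const => //; exact: mC_cont.
have bq : isband (e / 4 + b) (0 + 4) q.
  have := isband_mul (isband_affine (- s) (oner_neq0 R) bk) hb.
  rewrite normr1 mul1r (_ : (fun t => _) = q); last first.
    by apply/funext => t; rewrite /q mul1r.
  apply: isband_mono; rewrite ?lexx// ?addr_ge0 ?(ltW e4)//.
  by rewrite add0n addnA leq_addl.
have iq := isband_pairing (growth_J (- (y0 - w)) gs) bq isT.
have -> : (fun t => J (w * (t - s)) * (sinc (c * (t - s)) ^+ (N + 4))%:C *
      (Phi s t * (J (- (y0 * t)) * (h t)%:C))) =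
    fun t => J (- (w * s)) * (J (- (y0 - w) * t) * Phi s t * (q t)%:C).
  apply/funext => t; rewrite mulrBr (_ : - (y0 - w) * t = w * t - y0 * t); last by ring.
  by rewrite !JD /q rmorphM /=; ring.
rewrite (integralCZ _ iq) (killer_patch (e := e) gs (ct s) _ _ _ bq) ?mulr0//.
- by rewrite addr_ge0// ltW.
- by lra.
- by move=> z zw; exact: kw.
Qed.

(* Unlike the functions h of [diagonal_killed], whose decay depends on the growth
   exponent N, these do not depend on N, hence not on the vector w below. *)
Definition test_fun (y0 c t : R) : R[i] := J (- (y0 * t)) * (sinc (c * t) ^+ 2)%:C.

Lemma test_fun_bound y0 c : 0 < c -> exists2 K, 0 <= K &
  forall t, c1 (test_fun y0 c t) <= K * (W t)^-1 ^+ 2.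
Proof. by move=> c0; have [_] := modulated_band y0 (isband_sincX 2 c0 (ltr1n R 2)). Qed.

Lemma mC_test_fun y0 c : 0 < c -> mC (test_fun y0 c : RT -> R[i]).
Proof. by move=> c0; have [] := modulated_band y0 (isband_sincX 2 c0 (ltr1n R 2)). Qed.

Lemma integrable_test_fun y0 c : 0 < c -> integrableC (test_fun y0 c).
Proof.
move=> c0; have [K K0 hK] := test_fun_bound y0 c0.
by apply: (integrableC_dom (mC_test_fun y0 c0) _ hK); apply: rintZ; exact: rint_W.
Qed.

Lemma fourier_test_fun y0 c : 0 < c -> fourier (test_fun y0 c) y0 != 0.
Proof.
move=> c0; have -> : fourier (test_fun y0 c) y0 = (\int[mu]_t sinc (c * t) ^+ 2)%:C.
  rewrite -integralC_real; congr integralC; apply/funext => t.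
  by rewrite /test_fun -/(J _) mulrAC JN mul1r.
have cs : continuous (fun t : R => sinc (c * t) ^+ 2).
  exact: isband_continuous (isband_sincX 2 c0 (ltr1n R 2)).
have [K K0 hK] := sinc_bound 2 c0.
rewrite -[0]/(0%:C) (inj_eq (@complexI R)) gt_eqF//.
apply: Rintegral_gt0 => // [t||]; first exact: sqr_ge0.
  by rewrite mulr0 sinc0 expr1n.
apply: (rint_le (continuous_measurable_fun cs) (rintZ K _) hK); exact: rint_W.
Qed.

(** [test_fun] lacks the decay of order N + 4 that [diagonal_killed] asks for. A factor sinc(d_n
    t)^(N + 4) supplies it and tends to 1 as d_n tends to 0; the bound [D] on the diagonal gives a
    dominating function free of N. *)
Lemma diagonal_test_vanish (Phi : R -> R -> R[i]) C N D (y0 e : R) :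
  0 <= C -> (forall s t, c1 (Phi s t) <= C * W s ^+ N) ->
  (forall t, c1 (Phi t t) <= D) ->
  (forall t, cont (Phi ^~ t)) -> (forall s, cont (Phi s)) ->
  (forall w, (forall z, `|z - w| <= e -> forall t, killer N (Phi ^~ t) z) \/
     (forall z, `|z - (y0 - w)| <= e -> forall s, killer 0 (Phi s) z)) ->
  0 < e -> integralC (fun t => Phi t t * test_fun y0 (e / 12) t) = 0.
Proof.
move=> C0 hC hD cs ct kk e0.
have N0 : 0 < (N + 4)%:R :> R by rewrite ltr0n addnS.
(* The square of sinc has band 4 c = e/3 and the cut-off has band at most 2 c = e/6, together the
   e/2 allowed by [diagonal_killed]. *)
pose c := e / 12; have c0 : 0 < c by rewrite divr_gt0.
pose d n := c / (N + 4)%:R / n.+1%:R.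
have d0 n : 0 < d n by rewrite !divr_gt0// ltr0n.
pose h n t := sinc (c * t) ^+ 2 * sinc (d n * t) ^+ (N + 4).
have hb n : isband (e / 2) (N + 4) (h n).
  have := isband_mul (isband_sincX 2 c0 (ltr1n R 2)) (isband_sincX (N + 4) (d0 n) (ltr1n R 2)).
  apply: isband_mono; last exact: leq_addl.
    by rewrite addr_ge0 ?mulr_ge0 ?ltW.
  have -> : (N + 4)%:R * (d n * 2) = 2 * c * n.+1%:R^-1.
    rewrite /d; field. by rewrite !gt_eqF// ltr0n.
  have : 2 * c * n.+1%:R^-1 <= 2 * c.
    apply: ler_piMr; first by rewrite mulr_ge0// ltW.
    by rewrite invf_le1 ?ltr0n ?ler1n.
  by rewrite /c; move: (_ / n.+1%:R) => x; lra.
have mPhi : mC (fun t : RT => Phi t t).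
  have m2 : mC (fun z : (RT * RT)%type => Phi z.1 z.2).
    apply: mC_caratheodory => [t|t|s]; [by case: (cs t)|by case: (cs t)|exact: mC_cont].
  have := @mC_comp R _ _ _ _ _ (fun t : RT => (t, t)) _ m2; apply.
  by apply/measurable_fun_pairP; split; exact: measurable_id.
have D0 : 0 <= D by apply: le_trans (hD 0); exact: c1_ge0.
have [K K0 hK] := test_fun_bound y0 c0.
have mh n : measurable_fun setT (fun t : RT => sinc (d n * t) ^+ (N + 4)).
  exact: continuous_measurable_fun (isband_continuous (isband_sincX (N + 4) (d0 n) (ltr1n R 2))).
have sinc1 x M : `|sinc x ^+ M| <= 1 :> R.
  by rewrite normrX exprn_ile1// sincn_le1.
apply: (@integralC_eq0_lim R (fun n t => Phi t t * (test_fun y0 c t *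
  (sinc (d n * t) ^+ (N + 4))%:C)) _ (fun t => D * K * (W t)^-1 ^+ 2)).
- by move=> n; exact: mCM mPhi (mCM (mC_test_fun y0 c0) (mC_real (mh n))).
- by apply: rintZ; exact: rint_W.
- move=> n t; apply: le_trans (c1M _ _) _; rewrite -mulrA.
  apply: ler_pM; rewrite ?c1_ge0//.
  rewrite mulrC c1R; apply: le_trans (hK t).
  by rewrite ler_piMl ?c1_ge0.
- exact: mCM mPhi (mC_test_fun y0 c0).
- move=> t.
  rewrite [X in c1 (_ - X) @[_ --> _]](_ : _ = (1 : R)%:C * (Phi t t * test_fun y0 c t)); last first.
    by rewrite mul1r.
  under eq_fun do rewrite mulrA (mulrC _ (_ ^+ (N + 4))%:C).
  apply: cvg_c1_scale; last by rewrite subrr c1_0; exact: cvg_cst.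
  rewrite -[X in _ --> X](_ : (@sinc R) 0 ^+ (N + 4) = 1); last by rewrite sinc0 expr1n.
  have -> : (fun n => sinc (d n * t) ^+ (N + 4)) =
      (fun n => (fun x => sinc x ^+ (N + 4)) (c / (N + 4)%:R * t / n.+1%:R)).
    by apply/funext => n; rewrite /d mulrAC.
  have cX : continuous (fun x : R => sinc x ^+ (N + 4)).
    move=> x; apply: (@continuous_comp _ _ _ (@sinc R) (fun x => x ^+ (N + 4))).
      exact: sinc_continuous.
    exact: (@exprn_continuous R (N + 4)).
  exact: (cvg_comp _ _ (cvg_divn _) (cX 0)).
- move=> n; rewrite -[RHS](diagonal_killed C0 hC cs ct kk e0 _ (lexx _) (hb n)).
    congr integralC; apply/funext => t.
    rewrite /test_fun -mulrA; congr (_ * (_ * _)).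
    by rewrite /h (rmorphM (real_complex R) (_ ^+ 2) (_ ^+ (N + 4))).
  by rewrite divr_ge0// ltW.
Qed.

End SpectralSynthesis.

(** * Weighted integrability of Schwartz functions *)

Section SchwartzDecay.
Context (R : realType).
Notation RT := (measurableTypeR R).

Lemma WX_le (M : nat) (t : R) : W t ^+ M <= 2 ^+ M * (1 + `|t| ^+ M).
Proof.
have [t1|t1] := leP `|t| 1.
  apply: (@le_trans _ _ (2 ^+ M)).
    by rewrite lerXn2r ?nnegrE ?W_ge0// /W; lra.
  by rewrite ler_peMr ?exprn_ge0// lerDl exprn_ge0.
apply: (@le_trans _ _ (2 ^+ M * `|t| ^+ M)).
  rewrite -exprMn lerXn2r ?nnegrE ?W_ge0 ?mulr_ge0// /W; lra.
by rewrite ler_wpM2l ?exprn_ge0// lerDr.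
Qed.

Lemma real_schwartz_decay (h : R -> R) M : real_schwartz h ->
  measurable_fun setT (h : RT -> R) /\
  exists2 K, 0 <= K & forall t, `|h t| <= K * (W t)^-1 ^+ M.
Proof.
move=> [dh bh]; split.
  apply: continuous_measurable_fun => x.
  apply: differentiable_continuous; apply/derivable1_diffP; exact: (dh 0%N x).
have [C0 h0] := bh 0%N 0%N; have [C1 h1] := bh M 0%N.
have K0 : 0 <= C0 + C1.
  by apply: addr_ge0; [apply: le_trans (h0 0)|apply: le_trans (h1 0)]; rewrite mulr_ge0 ?exprn_ge0.
exists (2 ^+ M * (C0 + C1)) => [|t]; first by rewrite mulr_ge0 ?exprn_ge0.
rewrite exprVn ler_pdivlMr ?exprn_gt0 ?W_gt0//.
apply: le_trans (ler_wpM2l (normr_ge0 _) (WX_le M t)) _.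
rewrite mulrCA ler_wpM2l ?exprn_ge0// mulrDr mulr1.
apply: lerD; first by have := h0 t; rewrite expr0 mul1r.
by rewrite mulrC; exact: h1.
Qed.

Lemma schwartz_weight (f : R -> R[i]) N : schwartz f ->
  integrableC f /\ rint (fun t => c1 (f t) * W t ^+ N).
Proof.
move=> [sR sI].
have [mR [K K0 hK]] := real_schwartz_decay N.+2 sR.
have [mI [L L0 hL]] := real_schwartz_decay N.+2 sI.
have mf : mC (f : RT -> R[i]) by [].
have i2 : rint (fun t : R => (K + L) * (W t)^-1 ^+ 2) by apply: rintZ; exact: rint_W.
have h t : c1 (f t) * W t ^+ N <= (K + L) * (W t)^-1 ^+ 2.
  apply: (@le_trans _ _ ((K + L) * (W t)^-1 ^+ N.+2 * W t ^+ N)).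
    rewrite ler_wpM2r ?exprn_ge0 ?W_ge0// /c1 mulrDl.
    by apply: lerD; [exact: hK|exact: hL].
  have N2 : (N <= N.+2)%N by rewrite -[N.+2]addn2 leq_addr.
  by rewrite -mulrA [X in _ * X]mulrC WX_WV// -[N.+2]addn2 addKn.
have iw : rint (fun t => c1 (f t) * W t ^+ N).
  apply: rint_le i2 _.
    apply: measurable_funM; first exact: measurable_c1.
    by apply: measurable_funX; exact: measurable_W.
  by move=> t; rewrite ger0_norm// mulr_ge0 ?c1_ge0 ?exprn_ge0 ?W_ge0.
split=> //; apply: (integrableC_dom mf iw) => t.
by rewrite ler_peMr ?c1_ge0// exprn_ege1// W_ge1.
Qed.

End SchwartzDecay.

(** * Weak integrals and the closure of a sum of sets *)

Section SpectrumTools.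
Context (R : realType).

Lemma linear_function (V : lmodType R[i]) (f : V -> R[i]^o) :
  (forall a x y, f (a *: x + y) = a * f x + f y) ->
  exists l : {linear V -> R[i]^o}, l = f :> (V -> R[i]^o).
Proof.
move=> hf; have lf : linear f by move=> a x y; exact: hf.
pose L := GRing.isLinear.Build _ _ _ _ f lf.
pose l : {linear V -> R[i]^o} := HB.pack f L.
by exists l.
Qed.

Lemma is_integral_fun (V : tvsType R[i]) (F : R -> V) w (f : V -> R[i]^o) :
  is_integral F w -> (forall a x y, f (a *: x + y) = a * f x + f y) ->
  continuous f -> integrableC (f \o F) /\ integralC (f \o F) = f w.
Proof. by move=> hF /linear_function[l <-]; exact: hF. Qed.

Lemma cont_comp (T : topologicalType) (f : T -> R[i]^o) (c : R -> T) :
  continuous f -> continuous c -> cont (fun t => f (c t) : R[i]).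
Proof.
move=> cf cc.
have h (t : R) : {for t, continuous (f \o c)} by exact: (continuous_comp (cc t) (cf (c t))).
split=> t; first exact: (continuous_comp (h t) (@Re_continuous R _)).
exact: (continuous_comp (h t) (@Im_continuous R _)).
Qed.

Lemma c1_le_norm (z : R[i]) (r : R) : `|z| <= r%:C -> c1 z <= 2 * r.
Proof.
case: z => a b h; rewrite /c1 /= mulr_natl mulr2n; apply: lerD; rewrite -lecR.
  exact: le_trans (normc_ge_Re (a +i* b)) h.
by apply: le_trans h; rewrite normc_def /= lecR -[X in X <= _]sqrtr_sqr ler_wsqrtr// lerDr sqr_ge0.
Qed.

(** Let r bound the distance from y to E + F from below. If both alternatives failed with radius
    r/3, approximating the two points within r/6 would give a in E and b in F with |a + b - y| < 2
    (r/3 + r/6) = r. The radius does not depend on w. *)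
Lemma closure_add_split (E F : set R) y : ~ closure [set a + b | a in E & b in F] y ->
  exists2 r, 0 < r & forall w,
    (forall z, `|z - w| <= r -> ~ closure E z) \/
    (forall z, `|z - (y - w)| <= r -> ~ closure F z).
Proof.
move=> hy.
have [r r0 he] : exists2 r, 0 < r & forall a b, E a -> F b -> r <= `|a + b - y|.
  apply: contrapT => hn; apply: hy => B /nbhs_ballP[r /= r0 hB].
  apply: contrapT => hB'; apply: hn; exists r => // a b Ea Fb.
  rewrite leNgt; apply/negP => h; apply: hB'; exists (a + b); split.
    by exists a => //; exists b.
  by apply: hB; rewrite /ball /= distrC.
have e3 : 0 < r / 3 by rewrite divr_gt0.
have e6 : 0 < r / 6 by rewrite divr_gt0.
have near (S : set R) z : closure S z -> exists2 a, S a & `|a - z| < r / 6.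
  move=> /(_ _ (nbhsx_ballx z _ e6))[a [Sa /=]]; rewrite /ball /= => h.
  by exists a; rewrite // distrC.
exists (r / 3) => // w.
apply: contrapT => /not_orP[h1 h2]; apply: h1 => z1 hz1 E1; apply: h2 => z2 hz2 F2.
have [a Ea ha] := near _ _ E1; have [b Fb hb] := near _ _ F2.
have := he a b Ea Fb.
have -> : a + b - y = (a - z1) + (z1 - w) + ((b - z2) + (z2 - (y - w))) by ring.
move=> h; have := le_trans h (ler_normD _ _).
have := ler_normD (a - z1) (z1 - w); have := ler_normD (b - z2) (z2 - (y - w)).
by lra.
Qed.

End SpectrumTools.

(** * Smooth vectors *)

Section SmoothVectors.
Context (R : realType) (g : tvsType R) (G : preTopologicalGroupType).
Context (A : set (chart G g)) (phi : chart G g) (expG : g -> G).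
Context (gamma : R -> G -> G).
Context (H : completeNormedModType R[i]) (dot : {dot H for Num.conj}).
Context (pi : G -> H -> H) (U : R -> H -> H).
Context (hg : hausdorff_space g) (lieG : lie_group A) (Aphi : A phi).
Context (phi1 : chart_dom phi 1%g) (hexp : exponential_map A phi expG).
Context (hgamma : automorphic_flow A gamma) (hdot : hilbert_dot dot).
Context (hpi : continuous_unitary_rep dot (fun x y : G => (x * y)%g) pi).
Context (hU : continuous_unitary_rep dot (fun s t : R => s + t) U).
Context (hpiU : continuous_unitary_rep dot (semidirect_mul gamma)
    (fun p : G * R => pi p.1 \o U p.2)).

Let e : g := phi 1%g.
Let Hoo := smooth_vectors A pi.
Let rH : tvsType R := realified H.
Let hrH : hausdorff_space rH := @realified_hausdorff R H.

Lemma unitary_inj (T : H -> H) : unitary_op dot T -> injective T.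
Proof.
move=> uT x y xy; apply/eqP; rewrite -subr_eq0 -normr_eq0 -(unitary_norm hdot _ uT).
have [lT _ _] := uT.
have -> : T (x - y) = T x - T y.
  by have := lT (-1) y x; rewrite !scaleN1r (addrC (- y)) (addrC (- T y)).
by rewrite xy subrr normr0.
Qed.

Lemma pi1 v : pi 1%g v = v.
Proof.
have [uP mP _] := hpi; apply: (unitary_inj (uP 1%g)).
by have := congr1 (@^~ v) (mP 1%g 1%g); rewrite /= mulg1 => <-.
Qed.

Lemma U0 v : U 0 v = v.
Proof.
have [uP mP _] := hU; apply: (unitary_inj (uP 0)).
by have := congr1 (@^~ v) (mP 0 0); rewrite /= addr0 => <-.
Qed.

Lemma piM x y v : pi (x * y)%g v = pi x (pi y v).
Proof. by have [_ -> _] := hpi. Qed.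

Lemma UD s t v : U (s + t) v = U s (U t v).
Proof. by have [_ -> _] := hU. Qed.

(** The covariance relation, read off from (1, t) (x, 0) = (gamma_t(x), t) in the semidirect
    product. *)
Lemma U_pi t x v : U t (pi x v) = pi (gamma t x) (U t v).
Proof.
have [_ mP _] := hpiU.
have := congr1 (@^~ v) (mP (1%g, t) (x, 0)).
by rewrite /= mul1g addr0 U0 pi1 => ->.
Qed.

Definition orbit (w : H) (y : g) : rH := pi (chart_inv phi y) w.

Lemma Cn_orbit n w : Hoo w -> Cn n (chart_cod phi) (orbit w).
Proof. by move=> /smooth_into_tvs[_]; apply. Qed.

Lemma orbit1 w : orbit w e = w.
Proof. by rewrite /orbit /e (chart_inv_phi lieG Aphi) ?inE// pi1. Qed.

Lemma open_cod_phi : open (chart_cod phi).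
Proof. by have [[]] := chart_phi lieG Aphi. Qed.

(** The derivative of [pi] along a curve through the unit depends on its velocity only. It is
    applied to the exponential curve and to the image of that curve under the flow. *)
Lemma orbit_velocity w (y : R -> G) x : Hoo w -> y 0 = 1%g ->
  y t @[t --> (0 : R)^'] --> (1%g : G) ->
  t^-1 *: (phi (y t) - e) @[t --> (0 : R)^'] --> x ->
  t^-1 *: ((pi (y t) w : rH) - w) @[t --> (0 : R)^'] --> dderiv (orbit w) e x.
Proof.
move=> sw y0 yc yx.
have := @dderiv_curve R g rH (orbit w) _ (fun t => phi (y t)) x
  open_cod_phi (Cn_orbit 1 sw).
rewrite y0 => /(_ (cod_phi1 lieG Aphi phi1) yx).
rewrite -/e orbit1; apply: cvg_trans; apply: near_eq_cvg.
have [[od _] _ _ _ _] := chart_phi lieG Aphi.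
have nd : \forall t \near (0 : R)^', chart_dom phi (y t).
  by apply: yc; exact: open_nbhs_nbhs.
near=> t; rewrite /orbit (chart_inv_phi lieG Aphi)// inE; near: t; exact: nd.
Unshelve. all: by end_near. Qed.

Lemma exp_orbit_velocity w x : Hoo w ->
  t^-1 *: ((pi (expG (t *: x)) w : rH) - w) @[t --> (0 : R)^'] -->
  dderiv (orbit w) e x.
Proof.
move=> sw; apply: (orbit_velocity sw).
- by rewrite scale0r (exp0 hexp).
- exact: continuous_exp_line hexp _.
- exact: exp_velocity hexp _.
Qed.

(** In the chart the derivative is a directional derivative of one C^1 map at one point, hence
    linear and continuous in [x]; this is not visible from the separate one-parameter groups. *)
Lemma dpi_realE w x : Hoo w -> dpi_real expG pi x w = dderiv (orbit w) e x.
Proof.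
move=> sw; apply: (dderivE hrH); rewrite /is_dderiv.
apply: cvg_trans (@exp_orbit_velocity w x sw); apply: near_eq_cvg; near=> t.
by rewrite scale0r (exp0 hexp) pi1 add0r [t *: 1]mulr1.
Unshelve. all: by end_near. Qed.

Lemma dpi_real_lin w x y a : Hoo w ->
  dpi_real expG pi (a *: x + y) w =
  a%:C *: dpi_real expG pi x w + dpi_real expG pi y w.
Proof.
move=> sw; rewrite !dpi_realE//.
rewrite (dderivD _ _ hrH open_cod_phi (Cn_orbit 1 sw) (cod_phi1 lieG Aphi phi1)).
by rewrite (dderivZ _ _ hrH open_cod_phi (Cn_orbit 1 sw) (cod_phi1 lieG Aphi phi1)).
Qed.

Lemma continuous_dpi_real w : Hoo w ->
  continuous (fun x => dpi_real expG pi x w : H).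
Proof.
move=> sw; have -> : (fun x => dpi_real expG pi x w) =
    (fun p : g * g => dderiv (orbit w) p.1 p.2) \o (fun x => (e, x)).
  by apply/funext => x; rewrite dpi_realE.
move=> x; apply: continuous_comp.
  by apply: cvg_pair; [exact: cvg_cst|exact: cvg_id].
have := (Cn_orbit 1 sw).2 (e, x).
by rewrite inE; apply; split => //; exact: (cod_phi1 lieG Aphi phi1).
Qed.

Lemma continuous_pi v : continuous (fun x => pi x v : rH).
Proof. by have [_ _] := hpi; apply. Qed.

Lemma smooth_vectorsP v : Hoo v <->
  forall c, A c -> Cinfty (chart_cod c) (fun y => pi (chart_inv c y) v : rH).
Proof.
split=> [/smooth_into_tvs[_ sv] c Ac|sv]; first exact: sv.
by apply/smooth_into_tvs; split => //; exact: continuous_pi.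
Qed.

Lemma atlas_chart c : A c -> is_chart c.
Proof. by have [_ [chA _ _] _ _] := lieG; exact: chA. Qed.

Lemma open_cod c : A c -> open (chart_cod c).
Proof. by move=> /atlas_chart[[]]. Qed.

Lemma atlas_cover x : exists2 c, A c & chart_dom c x.
Proof. by have [_ [_ cov _] _ _] := lieG; exact: cov. Qed.

Lemma smooth_vectors_lin a v w : Hoo v -> Hoo w -> Hoo (a *: v + w).
Proof.
move=> /smooth_vectorsP sv /smooth_vectorsP sw; apply/smooth_vectorsP => c Ac n.
have Ls : linear (fun p : rH * rH => a *: (p.1 : H) + (p.2 : H) : rH).
  move=> k p q /=; rewrite !realified_scaleE !scalerDr !scalerA mulrC.
  by rewrite addrACA.
pose L := GRing.isLinear.Build _ _ _ _ _ Ls.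
pose l : {linear (rH * rH)%type -> rH} :=
  HB.pack (fun p : rH * rH => a *: (p.1 : H) + (p.2 : H) : rH) L.
have lc : continuous l.
  move=> p; apply: (@tvs_cvgD R[i] H); last exact: (@cvg_snd rH rH).
  apply: (@tvs_cvgZ R[i] H); first exact: cvg_cst.
  exact: (@cvg_fst rH rH).
apply: (Cn_eq (f := l \o (fun y => (pi (chart_inv c y) v, pi (chart_inv c y) w) : rH * rH))) => //.
- exact: open_cod.
- move=> y _ /=; have [uP _ _] := hpi; have [lP _ _] := uP (chart_inv c y).
  by rewrite lP.
apply: (Cn_comp (hausdorff_prod hrH hrH) hrH (open_cod Ac) openT) => //.
- by apply: Cn_pair => //; [exact: open_cod|exact: sv|exact: sw].
- exact: Cn_linear.
Qed.

(** The orbit map of dpi(x) v is a partial derivative: pi(h) dpi(x) v is the derivative of the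
    smooth map (h, k) |-> pi(h k) v at k = 1 in the direction (0, x). *)
Lemma smooth_vectors_dpi_real v x : Hoo v -> Hoo (dpi_real expG pi x v).
Proof.
move=> sv; apply/smooth_vectorsP => c Ac n.
have [_ [_ _ _] smul _] := lieG.
have chP d : prod_atlas A A d -> open (chart_cod d) /\
    {in chart_cod d, continuous (chart_inv d)}.
  by move=> [c1 Ac1 [c2 Ac2 <-]]; apply: prod_chart_inv; exact: atlas_chart.
have chT (d : chart rH rH) : tvs_atlas rH d -> open (chart_dom d).
  by move=> ->; exact: openT.
have := smooth_map_comp hg hrH chP atlas_chart atlas_cover chT smul sv.
move=> /smooth_into_tvs[_ sP].
have Ppc : prod_atlas A A (prod_chart c phi) by exists c => //; exists phi.
pose P : g * g -> rH := fun p => pi (chart_inv c p.1 * chart_inv phi p.2)%g v.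
have {}sP m : Cn m (chart_cod c `*` chart_cod phi) P by exact: sP Ppc m.
have oP : open (chart_cod c `*` chart_cod phi) by have [] := chP _ Ppc.
pose aff := fun y : g => ((y, e), (0, x)) : (g * g) * (g * g).
have hgg := hausdorff_prod hg hg.
apply: (Cn_eq (f := (fun p => dderiv P p.1 p.2) \o aff)) => //.
- exact: open_cod.
- move=> y; rewrite inE => cy /=.
  (* Both sides are limits of the same quotient, one by differentiating along (y, phi(exp(t x))),
     the other by continuity of the operator pi(h). *)
  apply: (cvg_unique hrH (F := (fun t : R => t^-1 *: (P (y, phi (expG (t *: x))) - P (y, e))) @ (0 : R)^')).
    have := @dderiv_curve R _ rH P _ (fun t => (y, phi (expG (t *: x)))) (0, x) oP (sP 1%N).
    rewrite scale0r (exp0 hexp); apply; first by split => //; exact: (cod_phi1 lieG Aphi phi1).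
    apply: (@cvg_pair _ _ _ _ (nbhs (0 : g)) (nbhs x) _ _ _ (fun t : R => t^-1 *: (y - y))).
      by rewrite subrr; under eq_fun do rewrite scaler0; exact: cvg_cst.
    exact: exp_velocity hexp _.
  have [uP _ _] := hpi; have [l lE lc] := unitary_linear hdot (uP (chart_inv c y)).
  rewrite (dpi_realE x sv) -lE.
  apply: cvg_trans (cvg_comp _ _ (@exp_orbit_velocity v x sv) (lc _)).
  apply: near_eq_cvg.
  have [[od _] _ _ _ _] := chart_phi lieG Aphi.
  have nd : \forall t \near (0 : R)^', chart_dom phi (expG (t *: x)).
    by apply: (continuous_exp_line hexp); exact: open_nbhs_nbhs.
  near=> t; have dt : chart_dom phi (expG (t *: x)) by near: t; exact: nd.
  rewrite /P /= linearZ linearB lE /e !(chart_inv_phi lieG Aphi) ?inE// mulg1.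
  by rewrite piM.
- have idl : Cn n (chart_cod c) (idfun : g -> g).
    by apply: (@Cn_linear R n g g _ idfun) => // y; exact: cvg_id.
  apply: (Cn_comp (hausdorff_prod hgg hgg) hrH (open_cod Ac) (openXT oP)) => //.
  + apply: Cn_pair => //; first exact: open_cod.
      apply: Cn_pair => //; first exact: open_cod.
      exact: Cn_cst.
    exact: Cn_cst.
  + by have [] := sP n.+1.
  + by move=> y cy; split => //; split => //; exact: (cod_phi1 lieG Aphi phi1).
Unshelve. all: by end_near. Qed.

Lemma smooth_vectors_dpi v z : Hoo v -> Hoo (dpi expG pi z v).
Proof.
by move=> sv; rewrite /dpi addrC; apply: smooth_vectors_lin;
  exact: smooth_vectors_dpi_real.
Qed.

(** By covariance pi(h) U_t v = U_t pi(gamma_(-t)(h)) v, where gamma_(-t) is smooth and U_t is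
    linear and continuous. *)
Lemma smooth_vectors_U t v : Hoo v -> Hoo (U t v).
Proof.
move=> sv; apply/smooth_vectorsP => c Ac n.
have chA d : A d -> open (chart_cod d) /\ {in chart_cod d, continuous (chart_inv d)}.
  by move=> /atlas_chart[[]].
have chT (d : chart rH rH) : tvs_atlas rH d -> open (chart_dom d).
  by move=> ->; exact: openT.
have [sg _ g0 gD _] := hgamma.
have := smooth_map_comp hg hrH chA atlas_chart atlas_cover chT (sg (- t)) sv.
move=> /smooth_into_tvs[_ sP].
have [uP _ _] := hU; have [l lE lc] := unitary_linear hdot (uP t).
apply: (Cn_eq (f := l \o (fun y => pi (gamma (- t) (chart_inv c y)) v : rH))) => //.
- exact: open_cod.
- move=> y _ /=; rewrite lE U_pi; congr (pi _ _).
  by have := congr1 (@^~ (chart_inv c y)) (gD t (- t)); rewrite subrr g0 /= => <-.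
apply: (Cn_comp hrH hrH (open_cod Ac) openT) => //.
- exact: sP Ac n.
- exact: Cn_linear.
Qed.

(** * The inner product and the skew-symmetry of the derived representation *)

Lemma dotZr a u v : dot u (a *: v) = Num.conj a * dot u v.
Proof. by rewrite linearZr_LR. Qed.
Lemma dotZl a u v : dot (a *: u) v = a * dot u v.
Proof. by rewrite linearZl_LR. Qed.
Lemma conj_norm2 (v : H) : Num.conj (`|v| ^+ 2) = `|v| ^+ 2.
Proof. by apply: CrealP; rewrite rpredX// normr_real. Qed.
Lemma dot_norm_le u v : `|dot u v| <= `|u| * `|v|.
Proof.
have [->|v0] := eqVneq v 0; first by rewrite linear0r !normr0 mulr0.
have nv : 0 < `|v| ^+ 2 by rewrite exprn_gt0 ?normr_gt0.
rewrite -(@ler_pXn2r _ 2) ?nnegrE ?mulr_ge0//.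
pose a := dot u v / `|v| ^+ 2.
have ca : Num.conj a = Num.conj (dot u v) / `|v| ^+ 2.
  by rewrite /a [LHS]rmorphM fmorphV; congr (_ / _); exact: conj_norm2.
have := dnorm_ge0 dot (u - a *: v).
have -> : dot (u - a *: v) (u - a *: v) = `|u| ^+ 2 - `|dot u v| ^+ 2 / `|v| ^+ 2.
  rewrite linearBl linearBr /= linearBr /= !dotZl !dotZr -!hdot.
  rewrite (hermC dot v u) expr0 mul1r /= ca /a normCK.
  by field; rewrite normr_eq0.
by rewrite subr_ge0 ler_pdivrMr// exprMn.
Qed.

Lemma dotC u v : dot u v = Num.conj (dot v u).
Proof. by rewrite hermC expr0 mul1r. Qed.

Lemma conjR (a : R) : Num.conj a%:C = a%:C :> R[i].
Proof. exact: conjc_real. Qed.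

Lemma conj_i : Num.conj ('i : R[i]) = - 'i.
Proof. by apply/eqP; rewrite eq_complex /= oppr0 !eqxx. Qed.

Lemma dot_lin a u v w : dot (a *: u + v) w = a * dot u w + dot v w.
Proof. by rewrite linearPl. Qed.

Lemma dot_cvg (T : Type) (F : set_system T) {FF : Filter F} (f k : T -> H) a b :
  f @ F --> a -> k @ F --> b -> (dot (f t) (k t) : R[i]^o) @[t --> F] --> dot a b.
Proof.
move=> fa kb; apply: (iffRL (@cvgrPdist_lt R[i] R[i]^o _ _ FF _ _)) => e0 e0p.
pose M := `|b| + 1.
have M0 : 0 < M by rewrite ltr_wpDl.
have A0 : 0 < `|a| + 1 by rewrite ltr_wpDl.
have d1 : 0 < e0 / 2 / M by rewrite !divr_gt0.
have d2 : 0 < e0 / 2 / (`|a| + 1) by rewrite !divr_gt0.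
have n1 := @cvgr_dist_lt R[i] H _ F _ f a fa _ d1.
have n2 := @cvgr_dist_lt R[i] H _ F _ k b kb _ d2.
have n3 := @cvgr_dist_lt R[i] H _ F _ k b kb _ ltr01.
near=> t.
have h1 : `|a - f t| < e0 / 2 / M by near: t; exact: n1.
have h2 : `|b - k t| < e0 / 2 / (`|a| + 1) by near: t; exact: n2.
have h3 : `|b - k t| < 1 by near: t; exact: n3.
have -> : dot a b - dot (f t) (k t) = dot a (b - k t) + dot (a - f t) (k t).
  by rewrite linearBr linearBl /=; ring.
have kM : `|k t| <= M.
  have -> : k t = b - (b - k t) by rewrite subKr.
  by rewrite (le_trans (ler_normB _ _))// lerD2l ltW.
rewrite (le_lt_trans (ler_normD _ _))// (splitr e0) ltr_leD//.
  rewrite (le_lt_trans (dot_norm_le _ _))//.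
  rewrite (le_lt_trans (y := (`|a| + 1) * `|b - k t|))//.
    by rewrite ler_wpM2r// lerDl.
  by rewrite mulrC -ltr_pdivlMr.
rewrite (le_trans (dot_norm_le _ _))//.
rewrite (le_trans (y := `|a - f t| * M))// ?ler_wpM2l//.
by rewrite -ler_pdivlMr// ltW.
Unshelve. all: by end_near. Qed.

Lemma dot_pi h u v : dot (pi h u) v = dot u (pi h^-1%g v).
Proof.
have [uP _ _] := hpi; have [_ isoP _] := uP h.
by rewrite -[RHS]isoP -piM mulgV pi1.
Qed.

Lemma expN x (s : R) : expG ((- s) *: x) = (expG (s *: x))^-1%g.
Proof.
have [_ hD _] := hexp.
apply: (@mulgI _ (expG (s *: x))).
by rewrite mulgV -hD subrr scale0r (exp0 hexp).
Qed.

Lemma dot_dpi_real t x v w : Hoo v -> Hoo w ->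
  dot (U t (dpi_real expG pi x v)) w =
  - dot (U t v) (dpi_real expG pi (lie_map phi (gamma t) x) w).
Proof.
move=> sv sw; rewrite !dpi_realE//.
have [uP _ _] := hU; have [l lE lc] := unitary_linear hdot (uP t).
have c1 := cvg_comp _ _ (@exp_orbit_velocity v x sv) (lc _).
have {}c1 : (dot (l (s^-1 *: ((pi (expG (s *: x)) v : rH) - v))) w : R[i]^o)
    @[s --> (0 : R)^'] --> dot (l (dderiv (orbit v) e x)) w.
  have c3 : w @[_ --> (0 : R)^'] --> w by exact: cvg_cst.
  by have := dot_cvg c1 c3; apply.
have c2 : s^-1 *: ((pi (gamma t (expG (s *: x))) w : rH) - w) @[s --> (0 : R)^'] -->
    dderiv (orbit w) e (lie_map phi (gamma t) x).
  apply: (orbit_velocity sw).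
  - by rewrite scale0r (exp0 hexp) (gamma1 hgamma).
  - rewrite -(gamma1 hgamma t).
    apply: cvg_comp (@continuous_exp_line _ _ _ _ _ _ hexp x) _.
    exact: continuous_gamma hgamma _ _.
  - exact: (@flow_exp_velocity _ _ _ _ _ _ _ lieG Aphi phi1 hexp hgamma t x).
(* The adjoint of pi(exp(s x)) is pi(exp(-s x)), so the limit for [w] is reparametrised by -s; the
   minus sign of the statement comes from here. *)
have n1 : s * (-1) @[s --> (0 : R)^'] --> (0 : R)^'.
  by apply: mulr_dnbhs0; rewrite oppr_eq0 oner_eq0.
have {}c2 := cvg_comp _ _ n1 c2.
have c4 : U t v @[_ --> (0 : R)^'] --> U t v by exact: cvg_cst.
have {}c2 := dot_cvg c4 c2.
have c5 : (-1 : R[i]^o) @[_ --> (0 : R)^'] --> (-1 : R[i]^o) by exact: cvg_cst.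
have {}c2 := @tvs_cvgZ R[i] R[i]^o _ _ _ _ _ _ _ c5 (c2 _).
have hC : hausdorff_space R[i]^o by exact: (@norm_hausdorff R[i] R[i]^o).
suff c6 : (dot (l (s^-1 *: ((pi (expG (s *: x)) v : rH) - v))) w : R[i]^o)
    @[s --> (0 : R)^'] -->
    (-1 * dot (U t v) (dderiv (orbit w) e (lie_map phi (gamma t) x)) : R[i]^o).
  by rewrite -mulN1r -[in LHS]lE; exact: (cvg_unique hC c1 c6).
suff fE : (fun s : R => dot (l (s^-1 *: ((pi (expG (s *: x)) v : rH) - v))) w) =
    (fun s : R => -1 * dot (U t v) ((s * -1)^-1 *:
        ((pi (gamma t (expG ((s * -1) *: x))) w : rH) - w))).
  by rewrite fE; exact: c2.
apply/funext => s /=.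
rewrite mulN1r linearZ linearB lE !realified_scaleE.
rewrite U_pi dotZl dotZr /= linearBl linearBr /= dot_pi.
rewrite mulrN1 expN (gammaV hgamma) conjR invrN rmorphN /=.
by rewrite mulNr opprK linearBr /= mulrBr.
Qed.

Definition qform (w : H) (z : complexified g) : H :=
  dpi_real expG pi z.1 w - 'i *: dpi_real expG pi z.2 w.

Lemma dot_dpi t z v w : Hoo v -> Hoo w ->
  dot (U t (dpi expG pi z v)) w =
  - dot (U t v) (qform w (lie_mapC phi (gamma t) z)).
Proof.
move=> sv sw; rewrite /dpi /qform /lie_mapC /=.
have [uP _ _] := hU; have [lT _ _] := uP t.
rewrite addrC lT dot_lin !dot_dpi_real// linearBr.
rewrite [X in _ = - (_ - X)]dotZr [Num.conj _]conj_i.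
by ring.
Qed.

Lemma dot_inj x y : (forall u, dot u x = dot u y) -> x = y.
Proof.
move=> h; apply/eqP; rewrite -subr_eq0 -(dnorm_eq0 dot) linearBr /=.
by rewrite h subrr.
Qed.

Lemma qform_antilin w a z z' : Hoo w ->
  qform w (a *: z + z') = Num.conj a *: qform w z + qform w z'.
Proof.
(* Paired with an arbitrary vector, the identity becomes one between scalars, which [ring] settles
   modulo i^2 = -1. *)
move=> sw; apply: dot_inj => u; rewrite /qform complexified_scaleE /=.
rewrite -!scaleNr -!addrA !dpi_real_lin//.
rewrite !(linearDr, linearBr, linearNr, dotZr, scalerDr, scalerBr, scalerN) /=.
rewrite !dotZr !conjR.
have -> : Num.conj (- 'i) = 'i :> R[i] by rewrite rmorphN /= conj_i opprK.
have -> : Num.conj (Num.conj a) = (complex.Re a)%:C + 'i * (complex.Im a)%:C.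
  by rewrite conjCK {1}(complexE a) mulrC.
have -> : (- complex.Im a)%:C = - (complex.Im a)%:C :> R[i] by rewrite rmorphN.
have ii : ('i * 'i)%R = -1 :> R[i] by rewrite -expr2 sqrCi.
by rewrite complexiE; ring: ii.
Qed.

(** * Approximate representation of functionals on a subspace *)

Definition rnorm (x : H) : R := complex.Re `|x|.

Lemma rnormE x : (rnorm x)%:C = `|x|.
Proof. by rewrite /rnorm; apply: RRe_real; exact: normr_real. Qed.

Lemma rnorm_ge0 x : 0 <= rnorm x.
Proof. by rewrite -ler0c rnormE. Qed.

Lemma rnormD x y : rnorm (x + y) <= rnorm x + rnorm y.
Proof. by rewrite -lecR rmorphD /= !rnormE ler_normD. Qed.

Lemma rnorm_sqr x : rnorm x ^+ 2 = complex.Re (dot x x).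
Proof. by rewrite -hdot -rnormE -rmorphXn. Qed.

Lemma continuous_rnorm : continuous (rnorm : H -> R^o).
Proof.
move=> x; apply: (@continuous_comp H R[i]^o R^o (fun x => `|x|)).
  exact: (@norm_continuous R[i] H).
exact: Re_continuous.
Qed.

(** The discriminant inequality, obtained at the minimum s = -a / b^2. For b = 0 the left side is
    affine in s and bounded below, which forces a = 0. *)
Lemma quadratic_le (a b c : R) : 0 <= b -> 0 <= c ->
  (forall s, - c ^+ 2 <= 2 * s * a + s ^+ 2 * b ^+ 2) -> `|a| <= c * b.
Proof.
move=> b0 c0 h; rewrite -(@ler_pXn2r _ 2) ?nnegrE ?mulr_ge0// -normrX ger0_norm ?sqr_ge0//.
have [bE|bN] := eqVneq b 0.
  have [->|aN] := eqVneq a 0; first by rewrite expr0n sqr_ge0.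
  exfalso; have := h (- (c ^+ 2 + 1) / (2 * a)).
  rewrite bE expr0n mulr0 addr0.
  have -> : 2 * (- (c ^+ 2 + 1) / (2 * a)) * a = - (c ^+ 2 + 1) by field.
  by lra.
have := h (- a / b ^+ 2).
have -> : 2 * (- a / b ^+ 2) * a + (- a / b ^+ 2) ^+ 2 * b ^+ 2 = - (a ^+ 2 / b ^+ 2).
  by field.
by rewrite lerN2 ler_pdivrMr ?exprn_even_gt0// exprMn.
Qed.

(* An almost-minimizer u of |u|^2 - 2 Re (l u) on the subspace S represents l
   up to epsilon, which avoids projecting onto the closure of S. *)
Lemma riesz_approx (S : set H) (l : {linear H -> R[i]^o}) (eps : R) :
  continuous l -> S 0 -> (forall a v w, S v -> S w -> S (a *: v + w)) ->
  0 < eps -> exists2 u, S u & forall x, S x ->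
    `|complex.Re (l x - dot x u)| <= eps * rnorm x /\
    `|complex.Im (l x - dot x u)| <= eps * rnorm x.
Proof.
move=> cl S0 Slin e0.
have [M M0 lM] : exists2 M : R, 0 <= M & forall x, complex.Re (l x) <= M * rnorm x.
  have /linear_boundedP/pinfty_ex_gt0[M M0 lM] :=
    @continuous_linear_bounded R[i] H R[i]^o 0 l (cl 0).
  have ME : (complex.Re M)%:C = M by apply: RRe_real; exact: gtr0_real.
  exists (complex.Re M); first by rewrite -ler0c ME ltW.
  move=> x; rewrite -lecR rmorphM /= ME rnormE.
  apply: le_trans (lM x); apply: le_trans (normc_ge_Re _).
  by rewrite lecR ler_norm.
pose J u := rnorm u ^+ 2 - 2 * complex.Re (l u).
pose V := [set J u | u in S].
have Vinf : has_inf V.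
  split; first by exists (J 0), 0.
  exists (- M ^+ 2) => _ [u Su <-]; rewrite /J.
  have := lM u; have := rnorm_ge0 u; set r := rnorm u; set q := complex.Re _.
  by move=> r0 qr; have := sqr_ge0 (r - M); rewrite sqrrB; lra.
have [_ [u Su <-] Ju] : exists2 y, V y & y < inf V + eps ^+ 2.
  by apply: inf_adherent => //; rewrite exprn_gt0.
exists u => // x Sx.
have key y : S y -> `|complex.Re (l y - dot y u)| <= eps * rnorm y.
  move=> Sy; rewrite -normrN; apply: quadratic_le; rewrite ?rnorm_ge0 ?ltW// => s.
  have SV : V (J (s%:C *: y + u)) by exists (s%:C *: y + u) => //; exact: Slin.
  have : inf V <= J (s%:C *: y + u) by apply: inf_lbound => //; case: Vinf.
  (* Moving u by s y changes the functional by a quadratic polynomial in s, bounded below by -eps^2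
     as u is an almost-minimizer; [quadratic_le] then bounds its linear coefficient. *)
  have -> : J (s%:C *: y + u) = J u + (2 * s * - complex.Re (l y - dot y u) +
      s ^+ 2 * rnorm y ^+ 2).
    rewrite /J linearP !rnorm_sqr linearPl !linearPr /=.
    rewrite (dotC u y).
    case: (l y) => ? ?; case: (l u) => ? ?; case: (dot y u) => ? ?.
    case: (dot y y) => ? ?; case: (dot u u) => ? ?.
    by rewrite /GRing.scale /=; simpc; rewrite /=; ring.
  by move: Ju; lra.
split; first exact: key.
(* The imaginary part follows from the real part at -i x. *)
have Six : S ((- 'i) *: x) by rewrite -[_ *: _]addr0; exact: Slin.
have := key _ Six.
have -> : rnorm ((- 'i) *: x) = rnorm x.
  by rewrite /rnorm normrZ normrN ?complexiE normCi mul1r.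
suff -> : complex.Re (l (- 'i *: x) - dot (- 'i *: x) u) =
  complex.Im (l x - dot x u) by [].
rewrite linearZ dotZl -?complexiE /=.
case: (l x) => ? ?; case: (dot x u) => ? ?.
by rewrite /GRing.scale /=; simpc.
Qed.

Lemma c1_dot u v : c1 (dot u v) <= 2 * (rnorm u * rnorm v).
Proof. by apply: c1_le_norm; rewrite rmorphM /= !rnormE; exact: dot_norm_le. Qed.

Lemma rnormU t v : rnorm (U t v) = rnorm v.
Proof. by rewrite /rnorm (unitary_norm hdot v (let: And3 h _ _ := hU in h t)). Qed.

Lemma continuous_U v : continuous (fun t => U t v).
Proof. by case: hU. Qed.

Lemma linear_U a u v t : U t (a *: u + v) = a *: U t u + U t v.
Proof. by have [h _ _] := hU; have [l _ _] := h t; exact: l. Qed.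

Lemma continuous_U_right t : continuous (U t).
Proof.
have [h _ _] := hU.
by have [l <- c] := unitary_linear hdot (h t).
Qed.

Lemma continuous_qform w : Hoo w -> continuous (qform w).
Proof.
move=> hw z.
have c1' : {for z, continuous (fun z : complexified g => dpi_real expG pi z.1 w : H)}.
  apply: (@continuous_comp _ _ _ (fun z : complexified g => z.1) (fun x => dpi_real expG pi x w : H)).
    exact: cvg_fst.
  exact: continuous_dpi_real.
have c2' : {for z, continuous (fun z : complexified g => 'i *: dpi_real expG pi z.2 w : H)}.
  apply: cvgZr.
  apply: (@continuous_comp _ _ _ (fun z : complexified g => z.2) (fun x => dpi_real expG pi x w : H)).
    exact: cvg_snd.
  exact: continuous_dpi_real.
exact: cvgB c1' c2'.
Qed.

Lemma qform0 w : Hoo w -> qform w 0 = 0.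
Proof.
move=> hw; have := qform_antilin 1 0 0 hw.
rewrite scaler0 addr0 rmorph1 scale1r => h.
by apply: (addrI (qform w 0)); rewrite -h addr0.
Qed.

Lemma qform_seminorm w : Hoo w -> continuous_seminorm (fun z => rnorm (qform w z)).
Proof.
move=> hw; split.
- move=> x y; have := qform_antilin 1 x y hw; rewrite rmorph1 !scale1r => ->.
  exact: rnormD.
- move=> a x; have := qform_antilin a x 0 hw; rewrite qform0// !addr0 => ->.
  by rewrite !rnormE normrZ norm_conjC.
- move=> z; apply: (@continuous_comp _ _ _ (qform w) rnorm).
    exact: continuous_qform.
  exact: continuous_rnorm.
Qed.

(** * Matrix coefficients and their frequencies *)

Context (halpha : continuous (fun p : R * complexified g => lie_mapC phi (gamma p.1) p.2)).
Let al (t : R) : complexified g -> complexified g := lie_mapC phi (gamma t).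

Lemma al_comp s t x : al (s + t) x = al s (al t x).
Proof. by rewrite /al /lie_mapC /= !(lie_map_comp hg lieG Aphi phi1 hgamma). Qed.

Lemma al_linear t a x y : al t (a *: x + y) = a *: al t x + al t y.
Proof.
rewrite /al /lie_mapC !complexified_scaleE /=.
rewrite -!scaleNr !(lie_mapD hg lieG Aphi phi1 hgamma) !(lie_mapZ hg lieG Aphi phi1 hgamma).
by [].
Qed.

Lemma continuous_al_left x : continuous (fun t : R => al t x).
Proof.
move=> t; apply: (@continuous_comp _ _ _ (fun t : R => (t, x))
  (fun p : R * complexified g => al p.1 p.2)); last exact: halpha.
have h1 : {for t, continuous (fun t : R => t)} by exact: cvg_id.
have h2 : {for t, continuous (fun _ : R => x)} by exact: cvg_cst.
exact: cvg_pair h1 h2.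
Qed.

Lemma continuous_al_right t : continuous (al t).
Proof.
move=> x; apply: (@continuous_comp _ _ _ (fun x : complexified g => (t, x))
  (fun p : R * complexified g => al p.1 p.2)); last exact: halpha.
have h1 : {for x, continuous (fun x : complexified g => x)} by exact: cvg_id.
have h2 : {for x, continuous (fun _ : complexified g => t)} by exact: cvg_cst.
exact: cvg_pair h2 h1.
Qed.

Definition matrix_coef v w x (s t : R) : R[i] := - dot (U t v) (qform w (al s x)).

Lemma continuous_neg_dot (T : topologicalType) (f k : T -> H) :
  continuous f -> continuous k -> continuous (fun x => - dot (f x) (k x) : R[i]^o).
Proof. by move=> cf ck x; apply: cvgN; apply: dot_cvg; [exact: cf|exact: ck]. Qed.

Lemma cont_matrix_coef_left v w x t : Hoo w -> cont (fun s => matrix_coef v w x s t).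
Proof.
move=> hw; apply: (@cont_comp R _ (fun z => - dot (U t v) (qform w z)) (fun s => al s x)).
  by apply: continuous_neg_dot; [move=> ?; exact: cvg_cst|exact: continuous_qform].
exact: continuous_al_left.
Qed.

Lemma cont_matrix_coef_right v w x s : cont (matrix_coef v w x s).
Proof.
apply: (@cont_comp R _ (fun u => - dot u (qform w (al s x))) (fun t => U t v)).
  by apply: continuous_neg_dot; [move=> ?; exact: cvg_id|move=> ?; exact: cvg_cst].
exact: continuous_U.
Qed.

Lemma dot_antilin a u v w :
  dot u (Num.conj a *: v + w) = a * dot u v + dot u w.
Proof.
by rewrite dotC dot_lin rmorphD rmorphM /= conjCK -!dotC.
Qed.

(** [qform] is antilinear and sits in the antilinear slot of [dot], so together they form a linear
    functional that may be applied to the vector-valued equation for x. Precomposing it with al_a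
    gives the equation at the translate by a. *)
Lemma matrix_coef_killer_left (f : R -> R[i]) N v w x z t : Hoo w ->
  integrableC f -> rint (fun t => c1 (f t) * W t ^+ N) -> fourier f z != 0 ->
  is_integral (fun s => f s *: al s x) 0 ->
  killer N (fun s => matrix_coef v w x s t) z.
Proof.
move=> hw fi fN fz f0; exists f; split=> // a.
have [||_] := is_integral_fun (f := fun y => - dot (U t v) (qform w (al a y))) f0.
- move=> b y y'; rewrite al_linear qform_antilin// dot_antilin.
  by rewrite opprD mulrN.
- apply: continuous_neg_dot; first by move=> ?; exact: cvg_cst.
  move=> y; apply: (@continuous_comp _ _ _ (al a) (qform w)).
    exact: continuous_al_right.
  exact: continuous_qform.
have al0 : al a 0 = 0.
  have := al_linear a 1 0 0; rewrite scaler0 addr0 scale1r => h.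
  by apply: (addrI (al a 0)); rewrite -h addr0.
rewrite al0 qform0// linear0 oppr0 => <-; congr integralC; apply/funext => s /=.
have := al_linear a (f s) (al s x) 0; rewrite al0 !addr0 => ->.
have := qform_antilin (f s) (al a (al s x)) 0 hw; rewrite qform0// !addr0 => ->.
by rewrite dotZr conjCK -al_comp /matrix_coef mulrN addrC.
Qed.

Lemma matrix_coef_killer_right (f : R -> R[i]) v w x z s :
  integrableC f -> fourier f z != 0 -> is_integral (fun t => f t *: U t v) 0 ->
  killer 0 (matrix_coef v w x s) z.
Proof.
move=> fi fz f0; exists f; split=> //.
  by under eq_fun do rewrite expr0 mulr1; exact: integrableC_c1.
move=> a.
have U0' t : U t 0 = 0.
  have := linear_U 1 0 0 t; rewrite scaler0 addr0 scale1r => h.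
  by apply: (addrI (U t 0)); rewrite -h addr0.
have [||_] := is_integral_fun (f := fun u => - dot (U a u) (qform w (al s x))) f0.
- by move=> b y y'; rewrite linear_U dot_lin opprD mulrN.
- by apply: continuous_neg_dot; [exact: continuous_U_right|move=> ?; exact: cvg_cst].
rewrite U0' linear0l oppr0 => <-; congr integralC; apply/funext => t /=.
have := linear_U (f t) (U t v) 0 a; rewrite U0' !addr0 => ->.
by rewrite dotZl -UD /matrix_coef mulrN addrC.
Qed.

Lemma matrix_coef_diag v w x t : Hoo v -> Hoo w ->
  matrix_coef v w x t t = dot (U t (dpi expG pi x v)) w.
Proof. by move=> hv hw; rewrite dot_dpi. Qed.

Local Notation mu := (@lebesgue_measure R).

(** The orbit of [d] stays in the smooth vectors and has constant norm, so [riesz_approx]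
    approximates a continuous functional by inner products uniformly along it. The integral of the
    functional is then below every multiple r > 0 of a constant. *)
Lemma is_integral_dense d (f : R -> R[i]) : Hoo d -> integrableC f ->
  (forall w, Hoo w -> integralC (fun t => dot (U t d) w * f t) = 0) ->
  is_integral (fun t => f t *: U t d) 0.
Proof.
move=> hd fi hf l cl.
have Hoo0 : Hoo 0.
  by have := smooth_vectors_lin (-1) hd hd; rewrite scaleN1r addNr.
have ra (r : R) : 0 < r -> exists2 u, Hoo u &
    forall t, c1 (l (U t d) - dot (U t d) u) <= 2 * (r * rnorm d).
  move=> r0; have [u Su hu] := riesz_approx cl Hoo0 (fun a v w => @smooth_vectors_lin a v w) r0.
  exists u => // t; have [h1 h2] := hu _ (smooth_vectors_U t hd).
  by rewrite rnormU in h1 h2; rewrite /c1 mulr_natl mulr2n lerD.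
have lE : (l \o fun t => f t *: U t d) = fun t => f t * l (U t d).
  by apply/funext => t /=; rewrite linearZ.
have clU : cont (fun t => l (U t d)) by apply: cont_comp => //; exact: continuous_U.
have cdU u : cont (fun t => dot (U t d) u).
  apply: (@cont_comp R _ (fun x => dot x u : R[i]^o)); last exact: continuous_U.
  by move=> x; apply: dot_cvg; [exact: cvg_id|exact: cvg_cst].
have mf := integrableC_mC fi.
have bd u t : c1 (dot (U t d) u) <= 2 * (rnorm d * rnorm u).
  by rewrite -(rnormU t d); exact: c1_dot.
have idU u : integrableC (fun t => dot (U t d) u * f t).
  apply: (integrableC_dom (mCM (mC_cont (cdU u)) mf)
    (rintZ (2 * (rnorm d * rnorm u)) (integrableC_c1 fi))) => t.
  by apply: le_trans (c1M _ _) _; rewrite ler_wpM2r ?c1_ge0.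
(* One approximation, with error parameter 1, already bounds the functional along the orbit and
   makes the integrand integrable. *)
have [u1 _ hu1] := ra 1 ltr01.
have ilU : integrableC (fun t => f t * l (U t d)).
  apply: (integrableC_dom (mCM mf (mC_cont clU))
    (rintZ (2 * (1 * rnorm d) + 2 * (rnorm d * rnorm u1)) (integrableC_c1 fi))) => t.
  apply: le_trans (c1M _ _) _; rewrite mulrC ler_wpM2r ?c1_ge0//.
  rewrite -[l _](subrK (dot (U t d) u1)); apply: le_trans (c1D _ _) _.
  by apply: lerD; [exact: hu1|exact: bd].
rewrite lE; split=> //; rewrite linear0; apply: c1_eq0.
apply/eqP; rewrite eq_le c1_ge0 andbT.
set I := integralC _.
have hI (r : R) : 0 < r -> c1 I <= r * (2 * rnorm d * \int[mu]_t c1 (f t)).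
  move=> r0; have [u hu1' hu] := ra r r0.
  have -> : I = integralC (fun t => f t * l (U t d) + -1 * (dot (U t d) u * f t)).
    by rewrite (integralCD ilU (integrableCZ _ (idU u))) (integralCZ _ (idU u)) hf// mulr0 addr0.
  have ic := rintZ (2 * (r * rnorm d)) (integrableC_c1 fi).
  have := c1_integralC (integrableCD ilU (integrableCZ (-1) (idU u))) ic.
  rewrite RintegralZl//; last exact: integrableC_c1.
  rewrite [2 * (r * _)]mulrCA -!mulrA; apply => t.
  rewrite (_ : _ + _ = f t * (l (U t d) - dot (U t d) u)); last by rewrite mulN1r mulrBr [dot _ _ * _]mulrC.
  apply: le_trans (c1M _ _) _.
  rewrite [X in _ <= X](_ : _ = c1 (f t) * (2 * (r * rnorm d))); last by ring.
  by rewrite ler_wpM2l ?c1_ge0.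
have M0 : 0 <= 2 * rnorm d * \int[mu]_t c1 (f t).
  by rewrite !mulr_ge0 ?rnorm_ge0// Rintegral_ge0// => t _; exact: c1_ge0.
move: (2 * rnorm d * _) M0 hI => M M0 hI.
rewrite leNgt; apply/negP => c0.
have M1 : 0 < M + 1 by rewrite ltr_wpDl.
have q0 : 0 < c1 I / (M + 1) by rewrite divr_gt0.
have := hI _ q0; rewrite mulrAC ler_pdivlMr// mulrDr mulr1.
by rewrite gerDl leNgt c0.
Qed.

(** The common form of both assertions: the test functions have to be integrable against the growth
    of p(al_s x), and the exponent may depend on the seminorm p. *)
Lemma spectral_sum (T : set (R -> R[i])) (E F : set R) x v :
  (forall p, continuous_seminorm p -> exists N,
     (exists C, forall s, p (al s x) <= C * W s ^+ N) /\
     forall f, T f -> integrableC f /\ rint (fun t => c1 (f t) * W t ^+ N)) ->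
  Spec T al x `<=` closure E -> Hoo v ->
  Spec (@integrableC R) U v `<=` closure F ->
  Spec (@integrableC R) U (dpi expG pi x v) `<=` closure [set a + b | a in E & b in F].
Proof.
move=> hT hE hv hF y0 hy0; apply: contrapT => /closure_add_split[r r0 he].
have e12 : 0 < r / 12 by rewrite divr_gt0.
have hd : Hoo (dpi expG pi x v) by exact: smooth_vectors_dpi.
have notSpec (V : tvsType R[i]) (S : set (R -> R[i])) (al' : R -> V -> V) u z :
    ~ Spec S al' u z -> exists f, [/\ S f, is_integral (fun t => f t *: al' t u) 0 &
      fourier f z != 0].
  move=> hn; apply: contrapT => hf; apply: hn => f Sf f0; apply: contrapT => /eqP fz.
  by apply: hf; exists f.
(* This test function has nonzero transform at [y0]; once it is seen to annihilate dpi(x) v,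
   membership of [y0] in the spectrum is contradicted. *)
have := fourier_test_fun y0 e12.
rewrite (hy0 _ (integrable_test_fun y0 e12)) ?eqxx//.
apply: is_integral_dense => //; first exact: integrable_test_fun.
move=> w hw; have [N [[C hC] fT]] := hT _ (qform_seminorm hw).
under eq_fun do rewrite -(matrix_coef_diag x _ hv hw).
apply: (@diagonal_test_vanish R (matrix_coef v w x) (2 * (rnorm v * `|C|)) N
  (2 * (rnorm (dpi expG pi x v) * rnorm w))) => //.
- by rewrite !mulr_ge0 ?rnorm_ge0.
- move=> s t; rewrite /matrix_coef c1N; apply: le_trans (c1_dot _ _) _.
  rewrite rnormU -!mulrA !ler_wpM2l ?rnorm_ge0//.
  apply: le_trans (hC s) _.
  by rewrite ler_wpM2r ?exprn_ge0 ?W_ge0// ler_norm.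
- move=> t; rewrite matrix_coef_diag//; apply: le_trans (c1_dot _ _) _.
  by rewrite rnormU.
- by move=> t; exact: cont_matrix_coef_left.
- by move=> s; exact: cont_matrix_coef_right.
move=> om; have [h|h] := he om; [left|right] => z zo q.
  have [|f [Tf f0 fz]] := notSpec _ T al x z; first by move=> /hE; exact: h.
  have [fi fN] := fT _ Tf.
  exact: (matrix_coef_killer_left v q hw fi fN fz f0).
have [|f [Tf f0 fz]] := notSpec _ (@integrableC R) U v z; first by move=> /hF; exact: h.
exact: (matrix_coef_killer_right w x q Tf fz f0).
Qed.

End SmoothVectors.

Theorem theorem3p1 (R : realType) (g : tvsType R) (G : preTopologicalGroupType)
    (A : set (chart G g)) (phi : chart G g) (expG : g -> G)
    (gamma : R -> G -> G)
    (H : completeNormedModType R[i]) (dot : {dot H for Num.conj})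
    (pi : G -> H -> H) (U : R -> H -> H) :
  hausdorff_space g -> complete_tvs g ->
  lie_group A -> A phi -> chart_dom phi 1%g ->
  exponential_map A phi expG ->
  automorphic_flow A gamma ->
  hilbert_dot dot ->
  continuous_unitary_rep dot (fun x y : G => (x * y)%g) pi ->
  continuous_unitary_rep dot (fun s t : R => s + t) U ->
  continuous_unitary_rep dot (semidirect_mul gamma)
    (fun p : G * R => pi p.1 \o U p.2) ->
  let alpha (t : R) := lie_mapC phi (gamma t) in
  let Hoo := smooth_vectors A pi in
  let HooE (F : set R) := Hoo `&` spectral_subspace (@integrableC R) U F in
  continuous (fun p : R * complexified g => alpha p.1 p.2) ->
  (equicontinuous_rep alpha ->
    forall E F : set R,
      [set dpi expG pi x v |
         x in spectral_subspace (@integrableC R) alpha E & v in HooE F]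
      `<=` HooE [set x + y | x in E & y in F]) /\
  (polynomially_bounded alpha ->
    forall E F : set R,
      [set dpi expG pi x v |
         x in spectral_subspace (@schwartz R) alpha E & v in HooE F]
      `<=` HooE [set x + y | x in E & y in F]).
Proof.
move=> hg _ lieG Aphi phi1 hexp hgamma hdot hpi hU hpiU alpha Hoo HooE halpha.
split=> hb E F _ [x hx [v [hv hF] <-]].
  split; first exact: (smooth_vectors_dpi hg lieG Aphi phi1 hexp hdot hpi).
  apply: (spectral_sum hg lieG Aphi phi1 hexp hgamma hdot hpi hU hpiU halpha _ hx hv hF).
  (* Equicontinuity is the case of growth exponent 0, where plain integrability of f is the required
     weighted one. *)
  move=> p /hb[q _ hq]; exists 0%N; split.
    by exists (q x) => s; rewrite expr0 mulr1; exact: hq.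
  move=> f fi; split=> //.
  by under eq_fun do rewrite expr0 mulr1; exact: integrableC_c1.
split; first exact: (smooth_vectors_dpi hg lieG Aphi phi1 hexp hdot hpi).
apply: (spectral_sum hg lieG Aphi phi1 hexp hgamma hdot hpi hU hpiU halpha _ hx hv hF).
move=> p /hb[N [q [_ hq]]]; exists N; split; last by move=> f; exact: schwartz_weight.
(* The factor 2 comes from 1 + |s|^N <= 2 (1 + |s|)^N. *)
exists (2 * `|q x|) => s; apply: le_trans (hq s x) _.
rewrite [X in _ <= X](_ : _ = 2 * W s ^+ N * `|q x|); last by ring.
have s0 : 0 <= 1 + `|s| ^+ N by rewrite addr_ge0// exprn_ge0.
apply: le_trans (ler_wpM2l s0 (ler_norm _)) _.
rewrite ler_wpM2r// mulr_natl mulr2n.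
apply: lerD; first by rewrite exprn_ege1// W_ge1.
by rewrite lerXn2r ?nnegrE ?W_ge0// /W lerDr.
Qed.
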